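(* Fix $\xi,\eta_1,\eta_2\in(0,1)$, $\rho>0$, $T>0$, $\lambda>0$, a function $q$ on $[0,T]$ and a continuous function $a:[0,1]^2\to\mathbb R$ with $a(x,y)\ne0$ for $(x,y)\in(0,1)^2$. Let $A_{\widetilde{\mathbf N}}$ be the $(m+1)n_1n_2\times(m+1)n_1n_2$ matrix defined in the context, and assume that $$\frac{\alpha_m}{\beta_{n_1}}\to\nu_1,\qquad \frac{\alpha_m}{\beta_{n_2}}\to\nu_2\qquad\text{as } m,n_1,n_2\to\infty,$$ with $\nu_1\neq0$ or $\nu_2\neq0$. Then, with $$\kappa(x,y,\theta_1,\theta_2,\theta_3)=h_\xi(\theta_1)+a(x,y)\big(\nu_1g_{\eta_1}(\theta_2)+\nu_2g_{\eta_2}(\theta_3)\big),\qquad (x,y)\in[0,1]^2,\ (\theta_1,\theta_2,\theta_3)\in[-\pi,\pi]^3,$$ it holds that $\{A_{\widetilde{\mathbf N}}\}_{\widetilde{\mathbf N}}\sim_{\mathrm{GLT}}\kappa$ and $\{A_{\widetilde{\mathbf N}}\}_{\widetilde{\mathbf N}}\sim_{\sigma}\kappa$.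
   Context: **Parameters.** $m,n_1,n_2$ are positive integers depending on an index $k\in\mathbb N$, all tending to infinity as $k\to\infty$ (with matrix sizes tending monotonically to infinity); sequences and limits are with respect to $k$. $\Delta t=T/m$, $\alpha_m=(\Delta t)^{\xi}\Gamma(2-\xi)$, $\beta_{n_\ell}=\big(\tfrac1{n_\ell+1}\big)^{\eta_\ell}\Gamma(2-\eta_\ell)$ for $\ell=1,2$; $\nu_1,\nu_2$ are finite real numbers. $x_i=i/(n_1+1)$, $y_j=j/(n_2+1)$, $t_s=s\Delta t$. **Coefficients.** For $k\ge1$ and $\zeta\in(0,1)$ put $w_0^{(\zeta)}=1$, $w_k^{(\zeta)}=(k+1)^{1-\zeta}-2k^{1-\zeta}+(k-1)^{1-\zeta}$, and set $\gamma_k=w_k^{(\xi)}$, $\delta_k=w_k^{(\eta_1)}$, $\sigma_k=w_k^{(\eta_2)}$ for $k\ge0$. $B^x_{n_1}$, $B^y_{n_2}$, $U_m$ are the lower triangular Toeplitz matrices of sizes $n_1,n_2,m$ whose $(i,j)$ entries for $i\ge j$ are $\delta_{i-j}$, $\sigma_{i-j}$, $\gamma_{i-j}e^{-\rho(i-j)\Delta t}$ respectively (and $0$ for $i<j$). $h_\xi(\theta)=\sum_{k\ge0}\gamma_ke^{\mathrm ik\theta}$, $g_{\eta_1}(\theta)=\sum_{k\ge0}\delta_ke^{\mathrm ik\theta}$, $g_{\eta_2}(\theta)=\sum_{k\ge0}\sigma_ke^{\mathrm ik\theta}$; these are continuous $2\pi$-periodic functions, the symbols of $\{U_m\}$, $\{B^x_{n_1}\}$,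 $\{B^y_{n_2}\}$. **The matrices.** Write $M=n_1n_2$. Spatial indices correspond to grid points $(x_i,y_j)$, $1\le i\le n_1$, $1\le j\le n_2$, with $i$ varying fastest. $D_{\mathbf n}(a)$ is the $M\times M$ diagonal matrix with entries $a(x_i,y_j)$ in this order, and $$G_{\mathbf n}=D_{\mathbf n}(a)\Big(\tfrac{\alpha_m}{\beta_{n_1}}\,I_{n_2}\otimes B^x_{n_1}+\tfrac{\alpha_m}{\beta_{n_2}}\,B^y_{n_2}\otimes I_{n_1}\Big).$$ With $\mathbf e_m=(0,\dots,0,1)^T\in\mathbb R^m$ and $\mathbf q=(q(t_1),\dots,q(t_m))^T\in\mathbb R^m$, $$A_{\widetilde{\mathbf N}}=\begin{bmatrix}U_m\otimes I_M+I_m\otimes G_{\mathbf n}&-\alpha_m\,\mathbf q\otimes I_M\\ \mathbf e_m^T\otimes I_M&\frac{\lambda}{\alpha_m}G_{\mathbf n}\end{bmatrix},\qquad \widetilde{\mathbf N}=(m+1)n_1n_2 .$$ **Singular value distribution.** Let $\{A_k\}$ be a sequence of square matrices of sizes $d_k\to\infty$ and $\psi:D\subset\mathbb R^t\to\mathbb C$ measurable with $0<\mu_t(D)<\infty$ ($\mu_t$ Lebesgue measure). $\{A_k\}\sim_\sigma\psi$ means $\frac1{d_k}\sum_{i=1}^{d_k}F(\sigma_i(A_k))\to\frac1{\mu_t(D)}\int_DF(|\psi(\mathbf x)|)\,d\mathbf x$ for all continuous compactly supported $F:\mathbb R\to\mathbb C$, where $\sigma_i$ are the singular values. **GLT sequences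 (standard definition, scalar $d$-level case).** Let $\mathbf N=\mathbf N(k)\in\mathbb N^d$ with all components tending to infinity, $\nu(\mathbf N)=\prod_rN_r$, and index matrices of size $\nu(\mathbf N)$ by multi-indices $\mathbf 1\le\mathbf i\le\mathbf N$ in lexicographic order (last component fastest). For $f\in L^1([-\pi,\pi]^d)$ with Fourier coefficients $\hat f_{\mathbf k}=(2\pi)^{-d}\int f(\theta)e^{-\mathrm i\mathbf k\cdot\theta}d\theta$ put $T_{\mathbf N}(f)=[\hat f_{\mathbf i-\mathbf j}]_{\mathbf i,\mathbf j=\mathbf 1}^{\mathbf N}$; for $b:[0,1]^d\to\mathbb C$ let $\mathrm{diag}_{\mathbf N}(b)$ be the diagonal matrix with entries $b(i_1/N_1,\dots,i_d/N_d)$. For a measurable $\kappa:[0,1]^d\times[-\pi,\pi]^d\to\mathbb C$, $\{A_k\}\sim_{\mathrm{GLT}}\kappa$ means: for each $p\in\mathbb N$ there are finitely many $b_{j,p}\in C^\infty([0,1]^d)$ and trigonometric polynomials $f_{j,p}$ in $d$ variables such that $\sum_jb_{j,p}(\mathbf x)f_{j,p}(\theta)\to\kappa(\mathbf x,\theta)$ in measure as $p\to\infty$, and, with $B_{k,p}=\sum_j\mathrm{diag}_{\mathbf N}(b_{j,p})T_{\mathbf N}(f_{j,p})$, there are $c(p),\omega(p)\to0$ and $k_p$ such that for all $k\ge k_p$ one can write $A_k=B_{k,p}+R_{k,p}+E_{k,p}$ with $\operatorname{rank}R_{k,p}\le c(p)\nu(\mathbf N)$ and spectral norm $\|E_{k,p}\|\le\omega(p)$.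 Here $d=3$ and $\mathbf N=(m+1,n_2,n_1)$: the first level corresponds to $(\tau,\theta_1)$ with $\tau\in[0,1]$ (the symbol does not depend on $\tau$), the second to $(y,\theta_3)$ and the third to $(x,\theta_2)$. *)

(* Defs.v *)
From HB Require Import structures.
From mathcomp Require Import all_boot all_order all_algebra.
From mathcomp Require Import complex mxtens.
From mathcomp Require Import all_classical all_reals all_analysis.

Set Implicit Arguments.
Unset Strict Implicit.
Unset Printing Implicit Defensive.

Import Order.TTheory GRing.Theory Num.Theory.
Import numFieldNormedType.Exports.

Local Open Scope classical_set_scope.
Local Open Scope ring_scope.
Local Open Scope complex_scope.
Local Open Scope sesquilinear_scope.

(* [R[i]], packed as a [numClosedFieldType] so that it carries the topology
   and norm that MathComp-Analysis puts on every such field. *)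
Definition Cx (R : realType) : numClosedFieldType := R[i].

Definition toC (R : realType) (x : R) : Cx R := x%:C.
Definition reC (R : realType) (z : Cx R) : R := complex.Re z.
Definition imC (R : realType) (z : Cx R) : R := complex.Im z.
(* the modulus, as a real number (the norm [`|z|] lives in [Cx R]) *)
Definition absC (R : realType) (z : Cx R) : R := reC `|z|.
Definition cis (R : realType) (t : R) : Cx R := cos t +i* sin t.

Definition measurable_funC d (X : measurableType d) (R : realType)
    (D : set X) (f : X -> Cx R) : Prop :=
  measurable_fun D (fun x => reC (f x)) /\ measurable_fun D (fun x => imC (f x)).

Definition integralC d (X : measurableType d) (R : realType)
    (mu : {measure set X -> \bar R}) (D : set X) (f : X -> Cx R) : Cx R :=
  (\int[mu]_(x in D) reC (f x)) +i* (\int[mu]_(x in D) imC (f x)).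

(* Points and domains are nested pairs, so that Lebesgue measure on R^t is the
   left-nested product of [lebesgue_measure]; measurability is Borel. *)
Definition R3 (R : realType) : Type := (R * R * R)%type.

Section Lebesgue.
Context (R : realType).
Let mR := measurableTypeR R.
Let leb := @lebesgue_measure R.

Definition leb3 : {measure set (mR * mR * mR)%type -> \bar R} :=
  (leb \x leb \x leb)%E.

Definition leb5 : {measure set (mR * mR * mR * mR * mR)%type -> \bar R} :=
  (leb \x leb \x leb \x leb \x leb)%E.

Definition leb6 : {measure set (mR * mR * mR * mR * mR * mR)%type -> \bar R} :=
  (leb \x leb \x leb \x leb \x leb \x leb)%E.

End Lebesgue.

Definition cube3 (R : realType) : set (R3 R) :=
  `[0, 1] `*` `[0, 1] `*` `[0, 1].

Definition torus3 (R : realType) : set (R3 R) :=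
  `[- pi, pi] `*` `[- pi, pi] `*` `[- pi, pi].

(* square roots of the eigenvalues, with multiplicity, of A^* A *)
Definition singval (R : realType) n (A : 'M[Cx R]_n) (i : 'I_n) : R :=
  Num.sqrt (reC (spectral_diag (A ^t* *m A) 0 i)).

Definition specnorm (R : realType) n (A : 'M[Cx R]_n) : R :=
  \big[Num.max/0]_(i < n) singval A i.

(* {A_k} ~_sigma (psi, D), relative to the measure [mu] *)
Definition sv_distributed d (X : measurableType d) (R : realType)
    (mu : {measure set X -> \bar R}) (D : set X) (psi : X -> Cx R)
    (sz : nat -> nat) (A : forall k, 'M[Cx R]_(sz k)) : Prop :=
  [/\ sz @ \oo --> \oo,
      measurable D,
      (0 < mu D < +oo)%E,
      measurable_funC D psi &
      forall F : R -> Cx R,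
        continuous F -> compact (closure [set t | F t != 0]) ->
        (fun k => (sz k)%:R^-1 * \sum_(i < sz k) F (singval (A k) i)) @ \oo -->
        toC (fine (mu D))^-1 * integralC mu D (fun x => F (absC (psi x)))].

(* The multi-index 1 <= i <= N of the (0-based) position [i] in the
   lexicographic ordering, last component fastest. *)
Definition midx (N : nat * nat * nat) (i : nat) : nat * nat * nat :=
  let: (_, N2, N3) := N in
  ((i %/ (N2 * N3)).+1, ((i %/ N3) %% N2).+1, (i %% N3).+1)%N.

Definition dot3 (R : realType) (k : int * int * int) (t : R3 R) : R :=
  let: (k1, k2, k3) := k in let: (t1, t2, t3) := t in
  k1%:~R * t1 + k2%:~R * t2 + k3%:~R * t3.

Definition fourier3 (R : realType) (f : R3 R -> Cx R) (k : int * int * int) :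
    Cx R :=
  toC ((2 * pi) ^+ 3)^-1 *
  integralC (@leb3 R) (@torus3 R) (fun t => f t * cis (- dot3 k t)).

(* T_N(f), where n = N_1 N_2 N_3 *)
Definition toeplitz3 (R : realType) (N : nat * nat * nat) n
    (f : R3 R -> Cx R) : 'M[Cx R]_n :=
  \matrix_(i, j)
    let: (i1, i2, i3) := midx N i in let: (j1, j2, j3) := midx N j in
    fourier3 f (i1%:Z - j1%:Z, i2%:Z - j2%:Z, i3%:Z - j3%:Z).

(* diag_N(b), where n = N_1 N_2 N_3 *)
Definition diag3 (R : realType) (N : nat * nat * nat) n
    (b : R3 R -> Cx R) : 'M[Cx R]_n :=
  diag_mx (\row_i
    let: (N1, N2, N3) := N in let: (i1, i2, i3) := midx N i in
    b (i1%:R / N1%:R, i2%:R / N2%:R, i3%:R / N3%:R)).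

Definition trig_poly3 (R : realType) (f : R3 R -> Cx R) : Prop :=
  exists (s : seq (int * int * int)) (c : int * int * int -> Cx R),
    forall t, f t = \sum_(k <- s) c k * cis (dot3 k t).

Definition smooth3 (R : realType) (f : R * R * R -> R) : Prop :=
  forall s : seq (R * R * R),
    let g := foldr (fun v h => 'D_v h) f s in
    continuous g /\ forall x v, derivable g x v.

(* C^oo([0,1]^3), as restrictions to the closed cube of smooth functions on R^3 *)
Definition smooth_cube3 (R : realType) (b : R3 R -> Cx R) : Prop :=
  exists u v : R * R * R -> R,
    [/\ smooth3 u, smooth3 v &
        forall x, cube3 x -> b x = u x +i* v x].

Definition cvg_in_measure d (X : measurableType d) (R : realType)
    (mu : {measure set X -> \bar R}) (D : set X)
    (f : nat -> X -> Cx R) (g : X -> Cx R) : Prop :=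
  forall eps : R, 0 < eps ->
    (fun p => mu (D `&` [set x | eps <= absC (f p x - g x)])) @ \oo --> 0%E.

(* {A_k} ~_GLT kappa, kappa being defined on [0,1]^3 x [-pi,pi]^3. The sizes
   [sz k] equal N_1 N_2 N_3 but are kept abstract to avoid casts between
   matrix types. *)
Definition GLT3 (R : realType) (N : nat -> nat * nat * nat)
    (sz : nat -> nat) (A : forall k, 'M[Cx R]_(sz k))
    (kappa : R3 R -> R3 R -> Cx R) : Prop :=
  let D : set (R * R * R * R * R * R) :=
    @cube3 R `*` `[- pi, pi] `*` `[- pi, pi] `*` `[- pi, pi] in
  let on6 (g : R3 R -> R3 R -> Cx R) (z : R * R * R * R * R * R) :=
    let: (x1, x2, x3, t1, t2, t3) := z in g (x1, x2, x3) (t1, t2, t3) in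
  [/\ (fun k => (N k).1.1) @ \oo --> \oo,
      (fun k => (N k).1.2) @ \oo --> \oo,
      (fun k => (N k).2) @ \oo --> \oo,
      (forall k, sz k = (N k).1.1 * (N k).1.2 * (N k).2)%N &
      measurable_funC D (on6 kappa) /\
      exists (J : nat -> nat) (b f : nat -> nat -> R3 R -> Cx R),
        [/\ forall p j, (j < J p)%N -> smooth_cube3 (b p j),
            forall p j, (j < J p)%N -> trig_poly3 (f p j),
            cvg_in_measure (@leb6 R) D
              (fun p => on6 (fun x t => \sum_(j < J p) b p j x * f p j t))
              (on6 kappa) &
            exists (c omega : nat -> R) (K : nat -> nat),
              [/\ c @ \oo --> (0 : R),
                  omega @ \oo --> (0 : R) &
                  forall p k, (K p <= k)%N ->
                    exists Rk E : 'M[Cx R]_(sz k),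
                      [/\ A k = \sum_(j < J p)
                                  diag3 (N k) (sz k) (b p j) *m
                                  toeplitz3 (N k) (sz k) (f p j) + Rk + E,
                          (\rank Rk)%:R <= c p * (sz k)%:R &
                          specnorm E <= omega p]]]].

Section Matrices.
Context (R : realType).
Implicit Types (xi eta zeta rho T lambda : R) (m n : nat).

Definition Gamma (s : R) : R :=
  \int[@lebesgue_measure R]_(t in `[0, +oo[) (t `^ (s - 1) * expR (- t)).

(* For k = 1 the last term is 0, since 0 `^ x = 0 for x <> 0. *)
Definition wcoef zeta (k : nat) : R :=
  if k is k'.+1 then
    k.+1%:R `^ (1 - zeta) - 2 * k%:R `^ (1 - zeta) + k'%:R `^ (1 - zeta)
  else 1.

(* h_xi, g_eta1 and g_eta2 are the cases zeta = xi, eta1, eta2 *)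
Definition wsymbol zeta (theta : R) : Cx R :=
  lim (series (fun k => toC (wcoef zeta k) * cis (k%:R * theta)) @ \oo).

Definition dt T m : R := T / m%:R.
Definition alpha_ xi T m : R := dt T m `^ xi * Gamma (2 - xi).
Definition beta_ eta n : R := (1 / n.+1%:R) `^ eta * Gamma (2 - eta).

(* B^x_{n_1} and B^y_{n_2} are the cases eta = eta1, eta2 *)
Definition Bmx eta n : 'M[R]_n :=
  \matrix_(i, j) if (j <= i)%N then wcoef eta (i - j) else 0.

Definition Umx xi rho T m : 'M[R]_m :=
  \matrix_(i, j) if (j <= i)%N
    then wcoef xi (i - j) * expR (- rho * (i - j)%N%:R * dt T m) else 0.

(* The position l stands for the 0-based pair (j, i) = mxtens_unindex l of grid
   indices, i.e. l = j * n1 + i, so i varies fastest. *)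
Definition Dmx (a : R * R -> R) n1 n2 : 'M[R]_(n2 * n1) :=
  diag_mx (\row_l
    let: (j, i) := mxtens_unindex l in
    a (i.+1%:R / n1.+1%:R, j.+1%:R / n2.+1%:R)).

Definition Gmx xi eta1 eta2 T (a : R * R -> R) m n1 n2 : 'M[R]_(n2 * n1) :=
  Dmx a n1 n2 *m
  ((alpha_ xi T m / beta_ eta1 n1) *: ((1%:M : 'M[R]_n2) *t Bmx eta1 n1) +
   (alpha_ xi T m / beta_ eta2 n2) *: (Bmx eta2 n2 *t (1%:M : 'M[R]_n1))).

Definition evec m : 'cV[R]_m := \col_i (i.+1 == m)%:R.
Definition qvec T (q : R -> R) m : 'cV[R]_m := \col_i q (i.+1%:R * dt T m).

Definition Asize m n1 n2 : nat := m * (n2 * n1) + 1 * (n2 * n1).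

(* The lower right block carries a 1 x 1 identity factor only so that its size
   reads 1 * (n2 * n1), like those of the adjacent blocks. *)
Definition Amx xi eta1 eta2 rho T lambda (a : R * R -> R) (q : R -> R) m n1 n2 :
    'M[R]_(Asize m n1 n2) :=
  let G := Gmx xi eta1 eta2 T a m n1 n2 in
  let I_M := 1%:M : 'M[R]_(n2 * n1) in
  block_mx (Umx xi rho T m *t I_M + (1%:M : 'M[R]_m) *t G)
           (- (alpha_ xi T m *: (qvec T q m *t I_M)))
           ((evec m)^T *t I_M)
           ((1%:M : 'M[R]_1) *t ((lambda / alpha_ xi T m) *: G)).

Definition kappa_ xi eta1 eta2 (nu1 nu2 : R) (a : R * R -> R)
    (x y theta1 theta2 theta3 : R) : Cx R :=
  wsymbol xi theta1 +
  toC (a (x, y)) *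
    (toC nu1 * wsymbol eta1 theta2 + toC nu2 * wsymbol eta2 theta3).

End Matrices.

(* Main.v *)
Require Import Defs.
From HB Require Import structures.
From mathcomp Require Import all_boot all_order all_algebra.
From mathcomp Require Import complex mxtens ring lra zify.
From mathcomp Require Import all_classical all_reals all_analysis measurable_realfun.
Import Order.TTheory GRing.Theory Num.Theory.
Import numFieldNormedType.Exports.
Local Open Scope classical_set_scope.
Local Open Scope ring_scope.

Set Implicit Arguments.
Unset Strict Implicit.
Unset Printing Implicit Defensive.

(** The matrices are close to matrices for which the singular values can be
    computed by hand.  Since the coefficients of the fractional difference are
    absolutely summable ([sum_abs_wcoef_lt]), their symbols are uniform limits of
    trigonometric polynomials; since [a] is continuous on the closed square, it is
    a uniform limit of polynomials ([weierstrass_square], by Bernstein).  So, up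
    to any error [e], [kappa] is a finite sum of monomials in [x], [y] times
    characters.  Let [B k] be the corresponding sum of sampling matrices times
    Toeplitz matrices.  Then [A k = B k + R + E] where [R] collects the last block
    row and column, a vanishing proportion of the size, and where [E] has row and
    column sums at most [e], hence norm at most [e] by the Schur test:
    the damping factor tends to 1 on every fixed band, the grid nodes
    [i / (n + 1)] are within [1 / n] of the sampling nodes [i / n], and
    [alpha / beta] tends to [nu].  This is [approx_scheme], and it is already the
    approximation which the definition of a GLT sequence asks for
    ([glt_symbol], [glt_matrix]), with convergence of the symbols in measure
    because they converge uniformly.

    For the singular values, sums like [B k] are handled by moments.  A sampling
    matrix and a Toeplitz matrix of a character are words in three letters: the
    shift, its transpose and the diagonal matrix of the coordinate.  Formal sums
    of tensor products of such words ([term], [feval]) are closed under products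
    and adjoints, so the powers of [B^* B] are again formal sums, and the
    normalised trace of a word tends to the mean of its symbol
    ([wmx_trace_cvg]): away from the border the letters almost commute.
    As the norms stay bounded, the moments determine the limit of all averages of
    continuous functions of the singular values ([moment_density]).

    To pass from [B k] to [A k], whose norm need not be bounded, one compares
    the traces of the powers of the resolvents [(1 + A^* A)^-1].  These react to a
    perturbation of small norm, and to one of small rank whatever its norm
    ([trace_resolvent_norm], [trace_resolvent_rank]).  Hence the moments of
    [1 / (1 + sigma ^ 2)] converge for [A k] too, and a compactly supported
    function of [sigma] is a continuous function of [1 / (1 + sigma ^ 2)]
    ([average_singval_cvg]). *)

(** * Bounded operators and resolvents *)

Section OperatorBound.
Local Open Scope sesquilinear_scope.
Context {C : numClosedFieldType}.

Definition hnorm n (u : 'rV[C]_n) : C := sqrtC (dotmx u u).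

Lemma dotmx_self_ge0 n (u : 'rV[C]_n) : 0 <= dotmx u u.
Proof. exact: dnorm_ge0. Qed.

Lemma dotmx_selfE n (u : 'rV[C]_n) : dotmx u u = \sum_i `|u 0 i| ^+ 2.
Proof. by rewrite dotmxE mxE; apply: eq_bigr => i _; rewrite !mxE normCK. Qed.

Lemma hnorm_ge0 n (u : 'rV[C]_n) : 0 <= hnorm u.
Proof. by rewrite sqrtC_ge0 dotmx_self_ge0. Qed.

Lemma sqr_hnorm n (u : 'rV[C]_n) : hnorm u ^+ 2 = dotmx u u.
Proof. exact: sqrtCK. Qed.

Lemma dotmxZr_adj p n (u : 'rV[C]_p) (A : 'M[C]_(p, n)) (v : 'rV[C]_n) :
  dotmx (u *m A) v = dotmx u (v *m A^t* ).
Proof. by rewrite !dotmxE trmx_mul map_mxM trmxCK !mulmxA. Qed.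

Lemma dotmx_conj n (u v : 'rV[C]_n) : dotmx u v = (dotmx v u)^*.
Proof.
rewrite !dotmxE !mxE rmorph_sum /=; apply: eq_bigr => i _.
by rewrite !mxE rmorphM /= conjCK mulrC.
Qed.

Lemma norm_dotmx_le n (u v : 'rV[C]_n) : `|dotmx u v| <= hnorm u * hnorm v.
Proof. by have [] := CauchySchwarz_sqrt (@dotmx C n) u v. Qed.

(** The operator norm enters only through upper bounds; bounding the
    sesquilinear form makes sums and adjoints immediate. *)
Definition opbound p n (A : 'M[C]_(p, n)) (c : C) :=
  forall u v, `|dotmx (u *m A) v| <= c * (hnorm u * hnorm v).

Lemma opbound_hnorm p n (A : 'M[C]_(p, n)) c :
  0 <= c -> opbound A c -> forall u, hnorm (u *m A) <= c * hnorm u.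
Proof.
move=> c0 Ac u; have := Ac u (u *m A); rewrite -sqr_hnorm ger0_norm; last first.
  by rewrite exprn_ge0 ?hnorm_ge0.
have [->|nz] := eqVneq (hnorm (u *m A)) 0.
  by rewrite mulr_ge0 ?hnorm_ge0.
by rewrite expr2 mulrA ler_pM2r // lt_def nz hnorm_ge0.
Qed.

Lemma hnorm_opbound p n (A : 'M[C]_(p, n)) c :
  (forall u, hnorm (u *m A) <= c * hnorm u) -> opbound A c.
Proof.
move=> Ac u v; apply: le_trans (norm_dotmx_le _ _) _.
by rewrite mulrA ler_wpM2r ?hnorm_ge0.
Qed.

Lemma opboundD p n (A B : 'M[C]_(p, n)) c d :
  opbound A c -> opbound B d -> opbound (A + B) (c + d).
Proof.
move=> Ac Bd u v; rewrite mulmxDr !dotmxE mulmxDl mxE mulrDl -!dotmxE.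
by apply: le_trans (ler_normD _ _) _; apply: lerD.
Qed.

Lemma opboundN p n (A : 'M[C]_(p, n)) c : opbound A c -> opbound (- A) c.
Proof.
by move=> Ac u v; rewrite mulmxN !dotmxE mulNmx mxE normrN -dotmxE.
Qed.

Lemma opbound_adj p n (A : 'M[C]_(p, n)) c : opbound A c -> opbound (A^t* ) c.
Proof.
move=> Ac u v; rewrite dotmxZr_adj trmxCK dotmx_conj norm_conjC.
by rewrite (mulrC (hnorm u)).
Qed.

Lemma opboundM p n q (A : 'M[C]_(p, n)) (B : 'M[C]_(n, q)) c d :
  0 <= c -> 0 <= d ->
  opbound A c -> opbound B d -> opbound (A *m B) (c * d).
Proof.
move=> c0 d0 /(opbound_hnorm c0) Ac /(opbound_hnorm d0) Bd; apply: hnorm_opbound => u.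
rewrite mulmxA; apply: le_trans (Bd _) _.
by rewrite (mulrC c) -mulrA ler_wpM2l.
Qed.

Lemma opbound1 n : opbound (1%:M : 'M[C]_n) 1.
Proof. by move=> u v; rewrite mulmx1 mul1r norm_dotmx_le. Qed.

Lemma opbound1M p n q (A : 'M[C]_(p, n)) (B : 'M[C]_(n, q)) :
  opbound A 1 -> opbound B 1 -> opbound (A *m B) 1.
Proof. by move=> A1 B1; have := opboundM ler01 ler01 A1 B1; rewrite mulr1. Qed.

Lemma opboundX n (A : 'M[C]_n) r : opbound A 1 -> opbound (iter r (mulmx A) 1%:M) 1.
Proof.
move=> A1; elim: r => [|r IH]; first exact: opbound1.
exact: opbound1M.
Qed.

(** In an orthonormal basis of the row space only [\rank Z] diagonal entries
    survive, and each of them is at most the operator norm. *)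
Lemma norm_trace_le_rank n (Z : 'M[C]_n) c :
  opbound Z c -> `|\tr Z| <= (\rank Z)%:R * c.
Proof.
move=> Zc; pose V := schmidt (row_base Z).
have Vu : V \is unitarymx by rewrite schmidt_unitarymx ?rank_leq_col.
have VZ : (V :=: Z)%MS.
  by apply: eqmx_trans (eq_row_base Z); apply/eqmx_schmidt_free/row_base_free.
have /submxP[W ZW] : (Z <= V)%MS by rewrite VZ.
have -> : \tr Z = \tr (Z *m V^t* *m V).
  congr (\tr _); apply/esym; transitivity (W *m V *m V^t* *m V).
    by congr (_ *m _ *m _).
  by rewrite -(mulmxA W) (unitarymxP Vu) mulmx1.
rewrite mxtrace_mulC mulmxA /mxtrace.
apply: le_trans (ler_norm_sum _ _ _) _.
have : \sum_(i < \rank Z) c = (\rank Z)%:R * c.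
  by rewrite sumr_const card_ord mulr_natl.
move <-; apply: ler_sum => i _.
have hV : hnorm (row i V) = 1.
  by rewrite /hnorm (row_unitarymxP Vu) eqxx sqrtC1.
have := Zc (row i V) (row i V); rewrite hV !mulr1; congr (_ <= _).
congr (`|_|); rewrite dotmxE -!row_mul !mxE; apply: eq_bigr => j _.
by rewrite !mxE.
Qed.

Lemma norm_trace_le n (Z : 'M[C]_n) c :
  0 <= c -> opbound Z c -> `|\tr Z| <= n%:R * c.
Proof.
move=> c0 /norm_trace_le_rank H; apply: le_trans H _.
by rewrite ler_wpM2r // ler_nat rank_leq_row.
Qed.

End OperatorBound.

Section Gram.
Local Open Scope sesquilinear_scope.
Context {C : numClosedFieldType}.
Implicit Types (n r : nat).

Definition gram n (A : 'M[C]_n) : 'M[C]_n := A^t* *m A.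

Lemma adjmxB p n (A B : 'M[C]_(p, n)) : (A - B)^t* = A^t* - B^t*.
Proof. by apply/matrixP => i j; rewrite !mxE rmorphB. Qed.

Lemma gram_adj n (A : 'M[C]_n) : (gram A)^t* = gram A.
Proof. by rewrite /gram trmx_mul map_mxM trmxCK. Qed.

Lemma gram_normal n (A : 'M[C]_n) : gram A \is normalmx.
Proof. by apply/normalmxP; rewrite gram_adj. Qed.

Definition geig n (A : 'M[C]_n) (i : 'I_n) : C := spectral_diag (gram A) 0 i.

Definition gfun n (A : 'M[C]_n) (phi : C -> C) : 'M[C]_n :=
  (spectralmx (gram A))^t* *m diag_mx (\row_i phi (geig A i)) *m
  spectralmx (gram A).

Lemma gfun_id n (A : 'M[C]_n) : gfun A id = gram A.
Proof.
rewrite [RHS](orthomx_spectralP (gram_normal A)) invmx_unitary; last first.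
  exact: spectral_unitarymx.
by rewrite /gfun; congr (_ *m diag_mx _ *m _); apply/rowP => i; rewrite mxE.
Qed.

Lemma gfunM n (A : 'M[C]_n) phi psi :
  gfun A phi *m gfun A psi = gfun A (fun x => phi x * psi x).
Proof.
rewrite /gfun !mulmxA mulmxtVK ?spectral_unitarymx//.
congr (_ *m _); rewrite -mulmxA; congr (_ *m _).
rewrite mulmx_diag; congr diag_mx.
by apply/rowP => i; rewrite !mxE.
Qed.

Lemma gfunD n (A : 'M[C]_n) phi psi :
  gfun A phi + gfun A psi = gfun A (fun x => phi x + psi x).
Proof.
rewrite /gfun -mulmxDl -mulmxDr -raddfD /=.
by congr (_ *m diag_mx _ *m _); apply/rowP => i; rewrite !mxE.
Qed.

Lemma gfun1 n (A : 'M[C]_n) : gfun A (fun=> 1) = 1%:M.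
Proof.
rewrite /gfun (_ : diag_mx _ = 1%:M); last first.
  by apply/matrixP => i j; rewrite !mxE.
have Pu : (spectralmx (gram A))^t* \is unitarymx.
  by rewrite trmxC_unitary spectral_unitarymx.
by rewrite mulmx1 -[X in _ *m X]trmxCK (unitarymxP Pu).
Qed.

Lemma eq_gfun n (A : 'M[C]_n) phi psi :
  (forall i, phi (geig A i) = psi (geig A i)) -> gfun A phi = gfun A psi.
Proof.
move=> H; rewrite /gfun; congr (_ *m diag_mx _ *m _).
by apply/rowP => i; rewrite !mxE H.
Qed.

Lemma trace_gfun n (A : 'M[C]_n) phi : \tr (gfun A phi) = \sum_i phi (geig A i).
Proof.
rewrite /gfun mxtrace_mulC mulmxA (unitarymxP (spectral_unitarymx _)) mul1mx.
by rewrite mxtrace_diag; apply: eq_bigr => i _; rewrite mxE.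
Qed.

Lemma gfunX n (A : 'M[C]_n) phi r :
  iter r (mulmx (gfun A phi)) 1%:M = gfun A (fun x => phi x ^+ r).
Proof.
elim: r => [|r IH] /=; first by rewrite -(gfun1 A); apply: eq_gfun.
by rewrite IH gfunM; apply: eq_gfun => i; rewrite exprS.
Qed.

Lemma gfun_adj n (A : 'M[C]_n) phi :
  (forall i, (phi (geig A i))^* = phi (geig A i)) -> (gfun A phi)^t* = gfun A phi.
Proof.
move=> H; rewrite /gfun !trmx_mul !map_mxM trmxCK mulmxA.
rewrite tr_diag_mx map_diag_mx; congr (_ *m diag_mx _ *m _).
by apply/rowP => i; rewrite !mxE; exact: H.
Qed.

Lemma hnorm_spectral n (A : 'M[C]_n) (u : 'rV[C]_n) :
  dotmx (u *m (spectralmx (gram A))^t* ) (u *m (spectralmx (gram A))^t* ) = dotmx u u.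
Proof.
rewrite dotmxZr_adj trmxCK mulmxKtV ?spectral_unitarymx//.
Qed.

Lemma dotmx_gfun n (A : 'M[C]_n) phi (u : 'rV[C]_n) :
  dotmx (u *m gfun A phi) u =
  \sum_i phi (geig A i) * `|(u *m (spectralmx (gram A))^t* ) 0 i| ^+ 2.
Proof.
rewrite /gfun !mulmxA dotmxZr_adj; set w := u *m _.
rewrite dotmxE mxE; apply: eq_bigr => i _.
rewrite mul_mx_diag !mxE normCK; ring.
Qed.

Lemma dotmx_gram n (A : 'M[C]_n) (u : 'rV[C]_n) :
  dotmx (u *m A^t* ) (u *m A^t* ) = dotmx (u *m gram A) u.
Proof.
by rewrite [RHS]dotmxZr_adj gram_adj dotmxZr_adj trmxCK -mulmxA.
Qed.

Lemma geig_ge0 n (A : 'M[C]_n) i : 0 <= geig A i.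
Proof.
pose u : 'rV[C]_n := delta_mx 0 i *m spectralmx (gram A).
have : 0 <= dotmx (u *m A^t* ) (u *m A^t* ) by exact: dotmx_self_ge0.
rewrite dotmx_gram -gfun_id dotmx_gfun -mulmxA (unitarymxP (spectral_unitarymx _)) mulmx1.
rewrite (bigD1 i) //= big1 => [|j ji]; last first.
  by rewrite mxE (negbTE ji) andbF normr0 expr0n mulr0.
by rewrite mxE !eqxx normr1 expr1n mulr1 addr0.
Qed.

Lemma opbound_gfun n (A : 'M[C]_n) phi (c : C) : 0 <= c ->
  (forall i, `|phi (geig A i)| <= c) -> opbound (gfun A phi) c.
Proof.
move=> c0 Hc; apply: hnorm_opbound => u.
rewrite -(ler_pXn2r (n := 2)) ?nnegrE ?mulr_ge0 ?hnorm_ge0//.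
rewrite exprMn !sqr_hnorm -(hnorm_spectral A (u *m _)) -(hnorm_spectral A u).
rewrite /gfun !mulmxA mulmxtVK ?spectral_unitarymx//; set w := u *m _.
rewrite !dotmx_selfE mulr_sumr; apply: ler_sum => i _.
rewrite mul_mx_diag !mxE normrM exprMn mulrC ler_wpM2r ?exprn_ge0//.
by rewrite ler_pXn2r ?nnegrE.
Qed.

(** For [u A^t*] the square of the norm is the value at [u] of the form of
    [gram A]: this is how eigenvalue bounds control [A] itself. *)
Lemma opbound_geig n (A : 'M[C]_n) (c : C) : 0 <= c ->
  (forall i, geig A i <= c ^+ 2) -> opbound A c.
Proof.
move=> c0 Hc; rewrite -[A]trmxCK; apply: opbound_adj; apply: hnorm_opbound => u.
rewrite -(ler_pXn2r (n := 2)) ?nnegrE ?mulr_ge0 ?hnorm_ge0//.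
rewrite exprMn !sqr_hnorm dotmx_gram -gfun_id dotmx_gfun -(hnorm_spectral A u).
rewrite dotmx_selfE mulr_sumr; apply: ler_sum => i _.
by rewrite ler_wpM2r ?exprn_ge0.
Qed.

(** Schur test: compare the largest entry of an eigenvector of [A^* A] with
    its image. *)
Lemma geig_le_schur n (A : 'M[C]_n) (c : C) : 0 <= c ->
  (forall i, \sum_j `|A i j| <= c) -> (forall j, \sum_i `|A i j| <= c) ->
  forall i, geig A i <= c ^+ 2.
Proof.
move=> c0 Hr Hc i.
pose v : 'rV[C]_n := delta_mx 0 i *m spectralmx (gram A).
have vE : v *m gram A = geig A i *: v.
  rewrite -gfun_id /gfun /v !mulmxA mulmxtVK ?spectral_unitarymx//.
  rewrite scalemxAl; congr (_ *m _); apply/rowP => j.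
  rewrite mul_mx_diag !mxE; case: (j =P i) => [->|]; first by rewrite mulrC.
  by rewrite andbF mul0r mulr0.
have vn : exists j, v 0 j != 0.
  apply/existsP; rewrite -[X in is_true X]negbK negb_exists; apply/negP.
  move=> /forallP v0; have : dotmx v v = 0.
    by rewrite dotmx_selfE big1 // => j _; rewrite (eqP (negPn (v0 j))) normr0 expr0n.
  rewrite /v -rowE (row_unitarymxP (spectral_unitarymx _)) eqxx.
  by move/eqP; rewrite oner_eq0.
have [j0 vj0] := vn; clearbody v.
have [j [vj maxj]] : exists j, v 0 j != 0 /\ forall l, `|v 0 l| <= `|v 0 j|.
  have tot : forall k l : 'I_n, (`|v 0 k| <= `|v 0 l|) || (`|v 0 l| <= `|v 0 k|).
    by move=> k l; exact: real_leVge.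
  have [j] : exists j, forall l, `|v 0 l| <= `|v 0 j|.
    have : exists j, forall l, l \in enum 'I_n -> `|v 0 l| <= `|v 0 j|.
      elim: (enum 'I_n) => [|k s [j IH]]; first by exists j0.
      case/orP: (tot k j) => kj.
        by exists j => l; rewrite inE => /predU1P[->|/IH].
      exists k => l; rewrite inE => /predU1P[->//|/IH H].
      exact: le_trans H kj.
    by case=> j H; exists j => l; apply: H; rewrite mem_enum.
  move=> H; exists j; split=> //.
  by rewrite -normr_gt0; apply: lt_le_trans (H j0); rewrite normr_gt0.
have vjp : 0 < `|v 0 j| by rewrite normr_gt0.
rewrite -(ler_pM2r vjp).
have -> : geig A i * `|v 0 j| = `|(v *m gram A) 0 j|.
  by rewrite vE mxE normrM ger0_norm ?geig_ge0.
rewrite mxE; apply: le_trans (ler_norm_sum _ _ _) _.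
apply: (@le_trans _ _ (\sum_k \sum_l `|v 0 j| * (`|A l k| * `|A l j|))).
  apply: ler_sum => k _; rewrite normrM mxE -mulr_sumr.
  apply: ler_pM => //; apply: le_trans (ler_norm_sum _ _ _) _.
  by apply: ler_sum => l _; rewrite normrM !mxE norm_conjC.
rewrite exchange_big /= mulrC.
under eq_bigr do rewrite -mulr_sumr -mulr_suml.
rewrite -mulr_sumr ler_wpM2l // expr2.
apply: (@le_trans _ _ (\sum_l c * `|A l j|)).
  by apply: ler_sum => l _; rewrite ler_wpM2r.
by rewrite -mulr_sumr ler_wpM2l.
Qed.

(** The bounded resolvent [(1 + A^* A)^-1]: unlike [A] itself it reacts
    little to a perturbation of small rank, however large. *)
Definition resolvent n (A : 'M[C]_n) : 'M[C]_n := gfun A (fun x => (1 + x)^-1).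

Lemma geig1_gt0 n (A : 'M[C]_n) i : 0 < 1 + geig A i.
Proof. by rewrite ltr_pwDl ?ltr01// geig_ge0. Qed.

Lemma resolvent_mul n (A : 'M[C]_n) : resolvent A *m (1%:M + gram A) = 1%:M.
Proof.
rewrite -gfun_id -{1}(gfun1 A) gfunD gfunM -(gfun1 A); apply: eq_gfun => i.
by rewrite mulVf // gt_eqF ?geig1_gt0.
Qed.

Lemma mul_resolvent n (A : 'M[C]_n) : (1%:M + gram A) *m resolvent A = 1%:M.
Proof. exact: (mulmx1C (resolvent_mul A)). Qed.

Lemma opbound_resolvent n (A : 'M[C]_n) : opbound (resolvent A) 1.
Proof.
apply: opbound_gfun => // i; rewrite normfV (ger0_norm (ltW (geig1_gt0 _ _))).
by rewrite invf_le1 ?geig1_gt0 // lerDl geig_ge0.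
Qed.

Lemma resolvent_adj n (A : 'M[C]_n) : (resolvent A)^t* = resolvent A.
Proof.
apply: gfun_adj => i; apply/CrealP; apply: ger0_real.
by rewrite invr_ge0 ltW ?geig1_gt0.
Qed.

Lemma opbound_resolvent_adj n (A : 'M[C]_n) : opbound (resolvent A *m A^t* ) 1.
Proof.
apply: hnorm_opbound => u.
rewrite -(ler_pXn2r (n := 2)) ?nnegrE ?mulr_ge0 ?hnorm_ge0//.
rewrite mul1r !sqr_hnorm mulmxA dotmx_gram.
have E : dotmx (u *m resolvent A *m gram A) (u *m resolvent A) =
    dotmx (u *m gfun A (fun x => (1 + x)^-1 * x * (1 + x)^-1)) u.
  by rewrite -gfunM -gfunM gfun_id mulmxA [RHS]dotmxZr_adj resolvent_adj !mulmxA.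
have nn : 0 <= dotmx (u *m gfun A (fun x => (1 + x)^-1 * x * (1 + x)^-1)) u.
  by rewrite -E -dotmx_gram dotmx_self_ge0.
rewrite E.
have H : opbound (gfun A (fun x => (1 + x)^-1 * x * (1 + x)^-1)) 1.
  apply: opbound_gfun => // i; have g0 := geig_ge0 A i; have g1 := geig1_gt0 A i.
  rewrite ger0_norm; last by rewrite !mulr_ge0 ?invr_ge0 ?(ltW g1).
  rewrite mulrAC -invfM mulrC ler_pdivrMr ?mulr_gt0// mul1r.
  rewrite mulrDl mul1r mulrDr mulr1 -addrA ler_wpDl ?ler01//.
  by rewrite lerDl addr_ge0 ?mulr_ge0.
by have := H u u; rewrite mul1r -expr2 sqr_hnorm (ger0_norm nn).
Qed.

Lemma resolvent_sub n (A B : 'M[C]_n) :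
  resolvent A - resolvent B = resolvent A *m (gram B - gram A) *m resolvent B.
Proof.
have -> : gram B - gram A = (1%:M + gram B) - (1%:M + gram A).
  by rewrite opprD addrACA subrr add0r.
rewrite mulmxBr resolvent_mul mulmxBl mul1mx -mulmxA mul_resolvent mulmx1.
by [].
Qed.

(** The powers are exchanged one factor at a time, so that [X] and [Y] need
    not commute: cyclicity of the trace brings the other factors together, and
    they form a contraction [W]. *)
Lemma trace_iter_sub n (X Y : 'M[C]_n) r (c : C) : 0 <= c ->
  opbound X 1 -> opbound Y 1 ->
  (forall W : 'M[C]_n, opbound W 1 -> `|\tr (W *m (X - Y))| <= c) ->
  `|\tr (iter r (mulmx X) 1%:M) - \tr (iter r (mulmx Y) 1%:M)| <= r%:R * c.
Proof.
move=> c0 X1 Y1 H.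
(* A left factor makes the claim inductive. *)
suff gen : forall W : 'M[C]_n, opbound W 1 ->
    `|\tr (W *m iter r (mulmx X) 1%:M) - \tr (W *m iter r (mulmx Y) 1%:M)| <= r%:R * c.
  by have := gen 1%:M (@opbound1 _ n); rewrite !mul1mx.
elim: r => [|r IH] W W1; first by rewrite subrr normr0 mul0r.
rewrite !iterS.
have -> : \tr (W *m (X *m iter r (mulmx X) 1%:M)) -
          \tr (W *m (Y *m iter r (mulmx Y) 1%:M)) =
   (\tr (W *m X *m iter r (mulmx X) 1%:M) -
    \tr (W *m X *m iter r (mulmx Y) 1%:M)) +
   \tr (iter r (mulmx Y) 1%:M *m W *m (X - Y)).
  rewrite mulmxBr linearB /= -!mulmxA !(mxtrace_mulC (iter r _ _)) -!mulmxA.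
  by rewrite addrA subrK.
apply: le_trans (ler_normD _ _) _; rewrite -addn1 natrD mulrDl mul1r.
apply: lerD; first by apply: IH; exact: opbound1M.
by apply: H; apply: opbound1M => //; apply: opboundX.
Qed.

(** By the resolvent identity the difference of the resolvents has rank at most
    twice that of [A - B], and its norm is at most 2 whatever the size of
    [A - B]. *)
Lemma trace_resolvent_rank n (A B : 'M[C]_n) r :
  `|\tr (iter r (mulmx (resolvent A)) 1%:M) -
    \tr (iter r (mulmx (resolvent B)) 1%:M)| <= r%:R * (4 * (\rank (A - B))%:R).
Proof.
apply: trace_iter_sub; rewrite ?mulr_ge0//; try exact: opbound_resolvent.
move=> W W1.
have H2 : opbound (W *m (resolvent A - resolvent B)) 2.
  have := @opboundM _ _ _ _ W (resolvent A - resolvent B) 1 2.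
  rewrite mul1r; apply => //.
  apply: opboundD; first exact: opbound_resolvent.
  apply: opboundN; exact: opbound_resolvent.
apply: le_trans (norm_trace_le_rank H2) _.
rewrite -natrM -natrM ler_nat.
suff : (\rank (W *m (resolvent A - resolvent B)%R) <= 2 * \rank (A - B)%R)%N by lia.
rewrite (leq_trans (mxrankM_maxr _ _))// resolvent_sub.
rewrite (leq_trans (mxrankM_maxl _ _))// (leq_trans (mxrankM_maxr _ _))//.
have -> : gram B - gram A = - (B^t* *m (A - B) + (A - B)^t* *m A).
  by rewrite /gram mulmxBr adjmxB mulmxBl [in RHS]addrC addrA subrK opprB.
rewrite mxrank_opp mul2n -addnn (leq_trans (mxrank_add _ _))// leq_add//.
  exact: mxrankM_maxr.
by rewrite (leq_trans (mxrankM_maxl _ _))// mxrank_map mxrank_tr.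
Qed.

Lemma opbound_sandwich n (P E Q : 'M[C]_n) (c : C) : 0 <= c ->
  opbound P 1 -> opbound E c -> opbound Q 1 -> opbound (P *m E *m Q) c.
Proof.
move=> c0 P1 Ec Q1; have := opboundM (mulr_ge0 ler01 c0) ler01 (opboundM ler01 c0 P1 Ec) Q1.
by rewrite mul1r mulr1.
Qed.

Lemma opbound_mul_resolvent n (A : 'M[C]_n) : opbound (A *m resolvent A) 1.
Proof.
have := opbound_adj (opbound_resolvent_adj A).
by rewrite trmx_mul map_mxM trmxCK resolvent_adj.
Qed.

(** Each factor [A] or [B] is absorbed by its own resolvent, so that the bound
    does not depend on the size of [A] and [B]. *)
Lemma opbound_resolvent_sub n (A B : 'M[C]_n) (c : C) : 0 <= c ->
  opbound (A - B) c -> opbound (resolvent A - resolvent B) (c + c).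
Proof.
move=> c0 Ec.
have -> : resolvent A - resolvent B =
    - (resolvent A *m A^t* *m (A - B) *m resolvent B +
       resolvent A *m (A - B)^t* *m (B *m resolvent B)).
  rewrite resolvent_sub.
  have -> : gram B - gram A = - (A^t* *m (A - B) + (A - B)^t* *m B).
    by rewrite /gram mulmxBr adjmxB mulmxBl addrA subrK opprB.
  by rewrite mulmxN mulNmx mulmxDr mulmxDl !mulmxA.
apply: opboundN; apply: opboundD; apply: opbound_sandwich => //.
- exact: opbound_resolvent_adj.
- exact: opbound_resolvent.
- exact: opbound_resolvent.
- exact: opbound_adj.
- exact: opbound_mul_resolvent.
Qed.

Lemma trace_resolvent_norm n (A B : 'M[C]_n) r (c : C) : 0 <= c ->
  opbound (A - B) c ->
  `|\tr (iter r (mulmx (resolvent A)) 1%:M) -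
    \tr (iter r (mulmx (resolvent B)) 1%:M)| <= r%:R * (n%:R * (c + c)).
Proof.
move=> c0 Ec; have cc0 : 0 <= c + c by rewrite addr_ge0.
apply: trace_iter_sub; rewrite ?mulr_ge0//; try exact: opbound_resolvent.
move=> W W1; apply: norm_trace_le => //.
have := opboundM ler01 cc0 W1 (opbound_resolvent_sub c0 Ec).
by rewrite mul1r.
Qed.

End Gram.

(** * Words in the shift and in the sampled coordinate *)

Section Words.
Context {R : realType}.
Implicit Types (w : seq (option bool)) (n i j : nat).

(** A letter is the [n x n] shift ([Some true]), its transpose
    ([Some false]) or the diagonal matrix of the [i/n] ([None]).  Indices are
    naturals, so that a word is evaluated at all sizes at once. *)
Fixpoint wmx n w i j : R :=
  match w with
  | [::] => (i == j)%:R
  | Some true :: w' => if i is i'.+1 then wmx n w' i' j else 0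
  | Some false :: w' => if (i.+1 < n)%N then wmx n w' i.+1 j else 0
  | None :: w' => i.+1%:R / n%:R * wmx n w' i j
  end.

Lemma sum_ord_eq n (F : nat -> R) i : (i < n)%N ->
  \sum_(l < n) (i == l)%:R * F l = F i.
Proof.
move=> lin; rewrite (bigD1 (Ordinal lin)) //= eqxx mul1r big1 ?addr0// => l li.
by rewrite (_ : i == l = false) ?mul0r//; apply/negP => /eqP il; move: li;
   rewrite -val_eqE /= il eqxx.
Qed.

Lemma wmx_cat n w1 w2 i j : (i < n)%N ->
  wmx n (w1 ++ w2) i j = \sum_(l < n) wmx n w1 i l * wmx n w2 l j.
Proof.
elim: w1 i => [|[[]|] w IH] i lin /=; first by rewrite (@sum_ord_eq n (fun l => wmx n w2 l j)).
- case: i lin => [|i] lin; first by rewrite big1 // => l _; rewrite mul0r.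
  by rewrite IH // ltnW.
- case: ifP => lin1; first by rewrite IH.
  by rewrite big1 // => l _; rewrite mul0r.
- by rewrite IH // mulr_sumr; apply: eq_bigr => l _; rewrite mulrA.
Qed.

Definition letter_adj (g : option bool) := omap negb g.
Definition wadj w := rev (map letter_adj w).

Lemma wmx_adj n w i j : (i < n)%N -> (j < n)%N ->
  wmx n (wadj w) i j = wmx n w j i.
Proof.
elim: w i j => [|g w IH] i j lin ljn; first by rewrite /= eq_sym.
rewrite /wadj /= rev_cons -cats1 wmx_cat //.
transitivity (\sum_(l < n) wmx n w l i * wmx n [:: letter_adj g] l j).
  by apply: eq_bigr => l _; rewrite -/(wadj w) IH.
case: g => [[]|] /=.
- case: j ljn => [|j] ljn.
    by rewrite big1 // => l _; case: ifP; rewrite mulr0.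
  rewrite -[RHS](@sum_ord_eq n (fun l => wmx n w l i) j (ltnW ljn)).
  apply: eq_bigr => l _; rewrite mulrC eqSS (eq_sym (l : nat)).
  case: ifP => // lnn; rewrite (_ : (j == l) = false) ?mul0r//.
  by apply/negP => /eqP jl; move: lnn; rewrite -jl ljn.
- case: ifP => [jn|/negbT jn].
    rewrite -[RHS](@sum_ord_eq n (fun l => wmx n w l i) j.+1 jn).
    apply: eq_bigr => l _; rewrite mulrC; case: (l : nat) => [|l'] //=.
    by rewrite eqSS eq_sym.
  rewrite big1 // => l _; case E : (l : nat) => [|l'] //=; first by rewrite mulr0.
  case: eqP => [lj|]; rewrite ?mulr0//.
  by have := ltn_ord l; rewrite E lj (negbTE jn).
- rewrite -(@sum_ord_eq n (fun l => l.+1%:R / n%:R * wmx n w l i)) //.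
  apply: eq_bigr => l _; rewrite eq_sym; ring.
Qed.

Lemma coord_ge0 n i : 0 <= i.+1%:R / n%:R :> R.
Proof. by rewrite divr_ge0. Qed.

Lemma coord_le1 n i : (i < n)%N -> i.+1%:R / n%:R <= 1 :> R.
Proof.
move=> lin; rewrite ler_pdivrMr ?mul1r ?ler_nat// ltr0n; exact: leq_ltn_trans lin.
Qed.

Lemma wmx_ge0 n w i j : 0 <= wmx n w i j.
Proof.
elim: w i => [|[[]|] w IH] i //=; first by case: i.
- by case: ifP.
- by rewrite mulr_ge0 ?coord_ge0.
Qed.

Lemma wmx_row_sum n w i : (i < n)%N -> \sum_(j < n) wmx n w i j <= 1.
Proof.
elim: w i => [|[[]|] w IH] i lin /=.
- rewrite (eq_bigr (fun l : 'I_n => (i == l)%:R * 1)) => [|l _].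
    by rewrite (@sum_ord_eq n (fun=> 1) i lin).
  by rewrite mulr1.
- case: i lin => [|i] lin; last by rewrite IH // ltnW.
  by rewrite big1 ?ler01.
- by case lin1 : (i.+1 < n)%N; rewrite ?IH // big1 ?ler01.
- rewrite -mulr_sumr mulr_ile1 ?IH ?coord_ge0 ?coord_le1 //.
  by apply: sumr_ge0 => l _; exact: wmx_ge0.
Qed.

Lemma wmx_le1 n w i j : (i < n)%N -> (j < n)%N -> wmx n w i j <= 1.
Proof.
move=> lin ljn; apply: le_trans (wmx_row_sum w lin).
rewrite (bigD1 (Ordinal ljn)) //= lerDl; apply: sumr_ge0 => l _; exact: wmx_ge0.
Qed.

(** A path through the letters of [w] moves by [wbal w] in total and picks up
    [wdeg w] factors: these are the frequency and the power of the coordinate in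
    the symbol of the word. *)
Definition letter_bal (g : option bool) : int :=
  match g with Some true => 1 | Some false => -1 | None => 0 end.
Definition wbal w : int := \sum_(g <- w) letter_bal g.
Definition wdeg w : nat := count (pred1 None) w.

(** What the word would be if no path met the border and the coordinate stayed
    constant along a path. *)
Definition wmx_model n w i j : R :=
  ((i%:Z - j%:Z == wbal w)%:R) * (i.+1%:R / n%:R) ^+ wdeg w.

Lemma wbal_cons g w : wbal (g :: w) = letter_bal g + wbal w.
Proof. by rewrite /wbal big_cons. Qed.

Lemma exp_sub_le (x y : R) d : 0 <= x <= 1 -> 0 <= y <= 1 ->
  `|x ^+ d - y ^+ d| <= d%:R * `|x - y|.
Proof.
move=> /andP[x0 x1] /andP[y0 y1]; elim: d => [|d IH].
  by rewrite subrr normr0 mul0r.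
have -> : x ^+ d.+1 - y ^+ d.+1 = x * (x ^+ d - y ^+ d) + (x - y) * y ^+ d.
  by rewrite !exprS; ring.
apply: le_trans (ler_normD _ _) _; rewrite -natr1 [leRHS]mulrDl mul1r.
apply: lerD; rewrite normrM.
  by apply: le_trans IH; rewrite ger0_norm // ler_piMl.
by rewrite ler_piMr // ger0_norm ?exprn_ge0 // exprn_ile1.
Qed.

(** Away from the border a word of length [s] multiplies by [wdeg w] sampled
    coordinates, each within [s/n] of the coordinate of the row. *)
Lemma wmx_interior w : exists c : R, 0 <= c /\ forall n i j,
  (size w <= i)%N -> (i + size w < n)%N ->
  `|wmx n w i j - wmx_model n w i j| <= c / n%:R.
Proof.
elim: w => [|g w [c [c0 IH]]].
  exists 0; split=> // n i j _ _; rewrite /wmx_model /wbal big_nil subr_eq0 /=.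
  by rewrite expr0 mulr1 eqz_nat subrr normr0 mul0r.
exists (c + (wdeg w)%:R); split; first by rewrite addr_ge0.
move=> n i j /= si isn.
have n0 : 0 < n%:R :> R by rewrite ltr0n; exact: leq_ltn_trans isn.
have wn : c / n%:R <= (c + (wdeg w)%:R) / n%:R.
  by rewrite ler_pM2r ?invr_gt0// lerDl.
have step k : (k < n)%N -> (i < n)%N -> `|k%:R - i%:R| <= 1 :> R ->
   wmx_model n w k j = (k%:Z - j%:Z == wbal w)%:R * (k.+1%:R / n%:R) ^+ wdeg w ->
   `|(k%:Z - j%:Z == wbal w)%:R * (k.+1%:R / n%:R) ^+ wdeg w -
     (k%:Z - j%:Z == wbal w)%:R * (i.+1%:R / n%:R) ^+ wdeg w| <=
   (wdeg w)%:R / n%:R :> R.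
  move=> kn lin ki _; rewrite -mulrBr normrM.
  apply: (@le_trans _ _ (1 * ((wdeg w)%:R * `|k.+1%:R / n%:R - i.+1%:R / n%:R|))).
    apply: ler_pM => //; first by case: eqP; rewrite ?normr1 ?normr0.
    by apply: exp_sub_le; rewrite coord_ge0 coord_le1.
  rewrite mul1r ler_wpM2l // -mulrBl normrM normfV (ger0_norm (ltW n0)).
  rewrite ler_piMl ?invr_ge0 ?(ltW n0)//.
  by rewrite -!natr1 opprD addrACA subrr addr0.
have lin : (i < n)%N by lia.
case: g => [[]|] /=.
- case: i si isn step lin => [//|i] si isn step lin.
  have -> : wmx_model n (Some true :: w) i.+1 j =
      (i%:Z - j%:Z == wbal w)%:R * (i.+2%:R / n%:R) ^+ wdeg w.
    rewrite /wmx_model wbal_cons /wdeg /= add0n; congr ((nat_of_bool _)%:R * _).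
    by apply/eqP/eqP; lia.
  apply: le_trans (ler_distD (wmx_model n w i j) _ _) _; rewrite [leRHS]mulrDl; apply: lerD.
    by apply: IH; lia.
  apply: step => //; first by lia.
  by rewrite -natr1 opprD addrA subrr sub0r normrN1.
- rewrite (_ : (i.+1 < n)%N); last by lia.
  have -> : wmx_model n (Some false :: w) i j =
      (i.+1%:Z - j%:Z == wbal w)%:R * (i.+1%:R / n%:R) ^+ wdeg w.
    rewrite /wmx_model wbal_cons /wdeg /= add0n; congr ((nat_of_bool _)%:R * _).
    by apply/eqP/eqP; lia.
  apply: le_trans (ler_distD (wmx_model n w i.+1 j) _ _) _; rewrite [leRHS]mulrDl; apply: lerD.
    by apply: IH; lia.
  apply: step => //; first by lia.
  by rewrite -natr1 addrAC subrr add0r normr1.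
- have -> : wmx_model n (None :: w) i j = i.+1%:R / n%:R * wmx_model n w i j.
    rewrite /wmx_model wbal_cons /wdeg /= add1n exprS add0r; ring.
  rewrite -mulrBr normrM ger0_norm ?coord_ge0//; apply: le_trans wn.
  apply: le_trans (IH n i j _ _); [|by lia..].
  by rewrite ler_piMl // coord_le1.
Qed.

(** The mean over [0, 1] and one period of the symbol of the word. *)
Definition wmoment w : R := (wbal w == 0)%:R / (wdeg w).+1%:R.

Lemma pow_sub_bounds (i d : nat) :
  (i.+1 ^ d.+1 - i ^ d.+1 <= d.+1 * i.+1 ^ d)%N /\
  (d.+1 * i.+1 ^ d <= i.+2 ^ d.+1 - i.+1 ^ d.+1)%N.
Proof.
split; elim: d => [|d IH]; try by rewrite !expn1 expn0; lia.
  have h : (i ^ d.+1 <= i.+1 ^ d.+1)%N by rewrite leq_exp2r.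
  rewrite expnS [(i ^ _)%N]expnS; have e := expnS i.+1 d.
  move: IH h e; set x := (i ^ d.+1)%N; set y := (i.+1 ^ d.+1)%N.
  set z := (i.+1 ^ d)%N => IH /subnKC; set t := (y - x)%N => ty e.
  have a1 : (i * t <= d.+1 * y)%N.
    apply: leq_trans (leq_mul (leqnn i) IH) _.
    by rewrite e mulnCA leq_mul2l; apply/orP; right; rewrite leq_mul2r leqnSn orbT.
  have a2 : (i * y = i * x + i * t)%N by rewrite -mulnDr ty.
  by rewrite mulSn [(d.+2 * y)%N]mulSn a2; lia.
have h : (i.+1 ^ d.+1 <= i.+2 ^ d.+1)%N by rewrite leq_exp2r.
rewrite [(i.+2 ^ _)%N]expnS [(i.+1 ^ d.+2)%N]expnS; have e := expnS i.+1 d.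
move: IH h e; set x := (i.+2 ^ d.+1)%N; set y := (i.+1 ^ d.+1)%N.
set z := (i.+1 ^ d)%N => IH /subnKC; set t := (x - y)%N => ty e.
have a1 : (d.+1 * y <= i.+1 * t)%N.
  by rewrite e mulnCA; exact: leq_mul (leqnn i.+1) IH.
have a2 : (i.+1 * x = i.+1 * y + i.+1 * t)%N by rewrite -mulnDr ty.
by rewrite mulSn [(i.+2 * x)%N]mulSn a2; lia.
Qed.

(** Comparison with the telescoping sum of the differences of [i ^ d.+1], an
    integer form of the integral of [x ^ d]. *)
Lemma sum_pow_bounds (n d : nat) :
  (n ^ d.+1 <= d.+1 * \sum_(i < n) i.+1 ^ d)%N /\
  (d.+1 * \sum_(i < n) i.+1 ^ d <= n.+1 ^ d.+1)%N.
Proof.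
elim: n => [|n [IH1 IH2]]; first by rewrite big_ord0 muln0 exp0n.
rewrite big_ord_recr /= mulnDr.
have [h1 h2] := pow_sub_bounds n d.
have h3 : (n.+1 ^ d.+1 <= n.+2 ^ d.+1)%N by rewrite leq_exp2r.
move: IH1 IH2 h1 h2 h3; move: (n ^ _)%N (n.+1 ^ d.+1)%N (n.+2 ^ _)%N.
move: (d.+1 * n.+1 ^ d)%N (d.+1 * \sum_(i < n) i.+1 ^ d)%N => *; split; lia.
Qed.

Lemma moment_cvg d :
  (fun n => n%:R^-1 * \sum_(i < n) (i.+1%:R / n%:R) ^+ d : R) @ \oo -->
  (d.+1%:R^-1 : R).
Proof.
have e n : (n.+1)%:R^-1 * \sum_(i < n.+1) (i.+1%:R / n.+1%:R) ^+ d =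
    (n.+1%:R ^+ d.+1)^-1 * (\sum_(i < n.+1) i.+1 ^ d)%N%:R :> R.
  rewrite natr_sum !mulr_sumr; apply: eq_bigr => i _.
  by rewrite natrX exprS invfM expr_div_n -mulrA [(_ ^- _) * _]mulrC.
rewrite -cvg_shiftS.
apply: (@squeeze_cvgr _ _ _ _ (fun=> d.+1%:R^-1)
  (fun n => d.+1%:R^-1 * (1 + n.+1%:R^-1) ^+ d.+1)).
- near=> n; rewrite /= e.
  have n0 : 0 < n.+1%:R ^+ d.+1 :> R by rewrite exprn_gt0 // ltr0n.
  have [h1 h2] := sum_pow_bounds n.+1 d.
  rewrite [_^-1 * _%:R]mulrC; apply/andP; split.
    rewrite ler_pdivlMr // mulrC ler_pdivrMr ?ltr0n//.
    by rewrite -natrX -natrM ler_nat mulnC.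
  rewrite ler_pdivrMr // -mulrA -exprMn mulrDl mul1r mulVf ?pnatr_eq0//.
  rewrite natr1 mulrC ler_pdivlMr ?ltr0n// -natrX -natrM ler_nat mulnC //.
- exact: cvg_cst.
- rewrite -[X in _ --> X]mulr1; apply: cvgM; first exact: cvg_cst.
  rewrite -[X in _ --> X](expr1n _ d.+1).
  have H : (fun n => 1 + n.+1%:R^-1 : R) @ \oo --> (1 : R).
    rewrite -[X in _ --> X]addr0; apply: cvgD; first exact: cvg_cst.
    exact: cvg_harmonic.
  have := @continuous_cvg _ _ _ _ _ _ (fun x : R => x ^+ d.+1) 1
    (@exprn_continuous R d.+1 1) H.
  exact.
Unshelve. all: by end_near. Qed.

Lemma wmx_model_bounds w n i j : (i < n)%N -> 0 <= wmx_model n w i j <= 1.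
Proof.
move=> lin; have x0 := coord_ge0 n i; have x1 := coord_le1 lin.
rewrite /wmx_model; case: eqP => _; rewrite ?mul0r ?lexx ?ler01// mul1r.
by rewrite exprn_ge0 // exprn_ile1.
Qed.

Lemma sum_ltn_const n s : (\sum_(i < n) (i < s) = minn n s)%N.
Proof. by elim: n => [|n IH]; rewrite ?big_ord0 ?big_ord_recr /= ?IH; lia. Qed.

(** The normalised traces of a word converge: border rows are a vanishing
    proportion, and unbalanced words have no diagonal in the interior. *)
Lemma wmx_trace_cvg w :
  (fun n => n%:R^-1 * \sum_(i < n) wmx n w i i) @ \oo --> wmoment w.
Proof.
have [c [c0 Hc]] := wmx_interior w; set s := size w.
pose M n : R := n%:R^-1 * \sum_(i < n) wmx_model n w i i.
have Mc : M @ \oo --> wmoment w.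
  rewrite (_ : M = fun n => (wbal w == 0)%:R *
      (n%:R^-1 * \sum_(i < n) (i.+1%:R / n%:R) ^+ wdeg w)).
    rewrite /wmoment; apply: cvgM; first exact: cvg_cst.
    exact: (@moment_cvg (wdeg w)).
  apply/funext => n; rewrite /M mulrCA; congr (_ * _).
  rewrite mulr_sumr; apply: eq_bigr => i _; rewrite /wmx_model subrr eq_sym //.
suff H : (fun n => n%:R^-1 * \sum_(i < n) wmx n w i i - M n) @ \oo --> (0 : R).
  rewrite -[X in _ --> X]add0r (_ : (fun n => n%:R^-1 * \sum_(i < n) wmx n w i i) =
    fun n => (n%:R^-1 * \sum_(i < n) wmx n w i i - M n) + M n).
    by apply: cvgD; [exact: H|exact: Mc].
  by apply/funext => n; rewrite subrK.
apply/cvgr0Pnorm_le => /= eps eps0.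
have step n : (0 < n)%N -> `|n%:R^-1 * \sum_(i < n) wmx n w i i - M n| <=
    (c + s%:R *+ 2) / n%:R.
  move=> n0; have n0' : 0 < n%:R :> R by rewrite ltr0n.
  rewrite /M -mulrBr normrM normfV normr_nat mulrC ler_wpM2r ?invr_ge0//.
  rewrite -sumrB; apply: le_trans (ler_norm_sum _ _ _) _.
  apply: (@le_trans _ _ (\sum_(i < n) (c / n%:R + (i < s)%N%:R +
      (n <= i + s)%N%:R))).
    apply: ler_sum => i _; have lin := ltn_ord i.
    have W1 : `|wmx n w i i - wmx_model n w i i| <= 1.
      have := wmx_ge0 n w i i; have := wmx_le1 w lin lin.
      have /andP[] := wmx_model_bounds w i lin; rewrite ler_norml; lra.
    have cn0 : 0 <= c / n%:R by rewrite divr_ge0.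
    case: (ltnP i s) => si; last case: (leqP n (i + s)) => isn.
    + by apply: le_trans W1 _; rewrite addrAC lerDr addr_ge0.
    + by apply: le_trans W1 _; rewrite lerDr addr_ge0.
    + by rewrite !addr0; exact: Hc.
  rewrite !big_split /= sumr_const card_ord -[_ *+ n]mulr_natr divfK ?gt_eqF//.
  rewrite -addrA lerD2l mulr2n; apply: lerD; rewrite -natr_sum ler_nat.
    by rewrite sum_ltn_const geq_minr.
  rewrite (reindex_inj rev_ord_inj) /=.
  rewrite (eq_bigr (fun i : 'I_n => (i < s)%N : nat)) => [|i _].
    by rewrite sum_ltn_const geq_minr.
  by congr nat_of_bool; have := ltn_ord i; lia.
have /cvgr0Pnorm_le/(_ _ eps0) : (fun n => (c + s%:R *+ 2) / n%:R) @ \oo --> (0 : R).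
  rewrite -cvg_shiftS.
  have := @cvgMl_tmp _ _ _ _ _ (c + s%:R *+ 2) _ (@cvg_harmonic R).
  by rewrite mulr0; exact.
move=> nb; near=> n; apply: le_trans (step n _) _; first by near: n; exact: nbhs_infty_gt.
apply: le_trans (ler_norm _) _; near: n; exact: nb.
Unshelve. all: by end_near. Qed.

End Words.

(** * Complex numbers with real modulus *)

Section ComplexModulus.
Context {R : realType}.
Implicit Types (z : Cx R) (x : R).

Lemma reCD z1 z2 : reC (z1 + z2) = reC z1 + reC z2.
Proof. by case: z1; case: z2. Qed.

Lemma imCD z1 z2 : imC (z1 + z2) = imC z1 + imC z2.
Proof. by case: z1; case: z2. Qed.

Lemma toCD x y : toC (x + y) = toC x + toC y :> Cx R.
Proof. exact: (rmorphD (real_complex R)). Qed.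

Lemma toCB x y : toC (x - y) = toC x - toC y :> Cx R.
Proof. exact: (rmorphB (real_complex R)). Qed.

Lemma toCM x y : toC (x * y) = toC x * toC y :> Cx R.
Proof. exact: (rmorphM (real_complex R)). Qed.

Lemma toC0 : toC 0 = 0 :> Cx R. Proof. by []. Qed.
Lemma toC1 : toC 1 = 1 :> Cx R. Proof. by []. Qed.

Lemma toCX x n : toC (x ^+ n) = toC x ^+ n :> Cx R.
Proof. exact: (rmorphXn (real_complex R)). Qed.

Lemma toCV x : toC x^-1 = (toC x)^-1 :> Cx R.
Proof. exact: (fmorphV (real_complex R)). Qed.

Lemma toC_nat n : toC n%:R = n%:R :> Cx R.
Proof. exact: (rmorph_nat (real_complex R)). Qed.

Lemma toC_sum I (r : seq I) (P : pred I) (F : I -> R) :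
  toC (\sum_(i <- r | P i) F i) = \sum_(i <- r | P i) toC (F i) :> Cx R.
Proof. exact: (rmorph_sum (real_complex R)). Qed.

Lemma le_toC x y : ((toC x : Cx R) <= toC y) = (x <= y).
Proof. exact: lecR. Qed.

Lemma normC_absC z : `|z| = toC (absC z).
Proof. by rewrite /absC normc_def. Qed.

Lemma absC_ge0 z : 0 <= absC z.
Proof. by rewrite -le_toC -normC_absC normr_ge0. Qed.

Lemma toC_inj : injective (@toC R).
Proof. by move=> x y []. Qed.

Lemma absCD z1 z2 : absC (z1 + z2) <= absC z1 + absC z2.
Proof. by rewrite -le_toC toCD -!normC_absC ler_normD. Qed.

Lemma absCM z1 z2 : absC (z1 * z2) = absC z1 * absC z2.
Proof. by apply: toC_inj; rewrite toCM -!normC_absC normrM. Qed.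

Lemma absCN z : absC (- z) = absC z.
Proof. by rewrite /absC normrN. Qed.

Lemma absCB z1 z2 : absC (z1 - z2) = absC (z2 - z1).
Proof. by rewrite -absCN opprB. Qed.

Lemma absC0 : absC (0 : Cx R) = 0. Proof. by rewrite /absC normr0. Qed.
Lemma absC_conj z : absC (z^*)%R = absC z.
Proof. by rewrite /absC norm_conjC. Qed.

Lemma absC_toC x : absC (toC x) = `|x|.
Proof. by rewrite /absC normc_def /= expr0n addr0 sqrtr_sqr. Qed.

Lemma absC_sum I (r : seq I) (P : pred I) (F : I -> Cx R) :
  absC (\sum_(i <- r | P i) F i) <= \sum_(i <- r | P i) absC (F i).
Proof.
elim/big_rec2 : _ => [|i y x _ H]; first by rewrite absC0.
by apply: le_trans (absCD _ _) _; rewrite lerD2l.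
Qed.

Lemma absC_dist z2 z1 z3 : absC (z1 - z3) <= absC (z1 - z2) + absC (z2 - z3).
Proof. by rewrite -[z1 - z3](subrKA z2) absCD. Qed.

Lemma reC_le_absC z : `|reC z| <= absC z.
Proof. by rewrite -le_toC -normC_absC normc_ge_Re. Qed.

Lemma imC_le_absC z : `|imC z| <= absC z.
Proof.
case: z => a b; rewrite /absC normc_def /= -sqrtr_sqr ler_wsqrtr// lerDr.
exact: sqr_ge0.
Qed.

Lemma cis0 : cis 0 = 1 :> Cx R.
Proof. by rewrite /cis cos0 sin0. Qed.

Lemma cisD (s t : R) : cis (s + t) = cis s * cis t :> Cx R.
Proof. by rewrite /cis cosD sinD; simpc; congr (_ +i* _)%C; ring. Qed.

Lemma cisN (t : R) : cis (- t) = (cis t)^* :> Cx R.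
Proof. by rewrite /cis cosN sinN. Qed.

Lemma absC_cis (t : R) : absC (cis t) = 1.
Proof. by rewrite /absC normc_def /= cos2Dsin2 sqrtr1. Qed.

End ComplexModulus.

(** * Formal sums of tensor products of words *)

Section FormalSums.
Context {R : realType}.
Local Notation C := (Cx R).

(** A coefficient and one word for each level, in the order time, [y], [x]; time
    words have shifts only, because the symbol does not depend on the time
    coordinate.  Sums of such terms are closed under products and adjoints, which
    is what the method of moments asks for. *)
Definition term (R : realType) : Type :=
  (Cx R * (seq bool * seq (option bool) * seq (option bool)))%type.

Definition fmul (L L' : seq (term R)) : seq (term R) :=
  [seq (t.1 * t'.1,
        (t.2.1.1 ++ t'.2.1.1, t.2.1.2 ++ t'.2.1.2, t.2.2 ++ t'.2.2))
     | t <- L, t' <- L'].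

Definition fadj (L : seq (term R)) : seq (term R) :=
  [seq ((t.1)^*, (rev (map negb t.2.1.1), wadj t.2.1.2, wadj t.2.2)) | t <- L].

Definition tens3 (N : nat * nat * nat) n (P Q S : nat -> nat -> R) : 'M[C]_n :=
  let: (N1, N2, N3) := N in
  \matrix_(a, b) toC (P (a %/ (N2 * N3))%N (b %/ (N2 * N3))%N
                    * Q (a %/ N3 %% N2)%N (b %/ N3 %% N2)%N
                    * S (a %% N3)%N (b %% N3)%N).

Definition feval (N : nat * nat * nat) n (L : seq (term R)) : 'M[C]_n :=
  \sum_(t <- L) t.1 *: tens3 N n (wmx N.1.1 (map Some t.2.1.1))
                                 (wmx N.1.2 t.2.1.2) (wmx N.2 t.2.2).

Lemma sum_divmod (V : nmodType) m n (F : nat -> nat -> V) :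
  \sum_(a < m * n) F (a %/ n)%N (a %% n)%N = \sum_(i < m) \sum_(j < n) F i j.
Proof.
elim: m F => [|m IH] F; first by rewrite !big_ord0.
rewrite mulSn big_split_ord big_ord_recl /=; congr (_ + _).
  by apply: eq_bigr => j _; rewrite divn_small ?modn_small.
rewrite -(IH (fun i j => F i.+1 j)); apply: eq_bigr => a _.
have n0 : (0 < n)%N.
  by have := leq_ltn_trans (leq0n _) (ltn_ord a); rewrite muln_gt0 => /andP[].
by rewrite divnDl // divnn n0 add1n modnDl.
Qed.

Lemma sum_pos (V : nmodType) N1 N2 N3 (F : nat -> nat -> nat -> V) :
  \sum_(a < N1 * N2 * N3) F (a %/ (N2 * N3))%N (a %/ N3 %% N2)%N (a %% N3)%N =
  \sum_(i < N1) \sum_(j < N2) \sum_(l < N3) F i j l.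
Proof.
rewrite -mulnA.
transitivity (\sum_(i < N1) \sum_(r < N2 * N3) F i (r %/ N3)%N (r %% N3)%N).
  rewrite -(sum_divmod _ _ (fun i r => F i (r %/ N3)%N (r %% N3)%N)).
  by apply: eq_bigr => a _; rewrite -modn_divl modn_dvdm ?dvdn_mull.
by apply: eq_bigr => i _; rewrite (sum_divmod _ _ (F i)).
Qed.

Lemma sum3_prod m n p (f g h : nat -> R) :
  \sum_(i < m) \sum_(j < n) \sum_(l < p) f i * g j * h l =
  (\sum_(i < m) f i) * (\sum_(j < n) g j) * (\sum_(l < p) h l).
Proof.
rewrite !mulr_suml; apply: eq_bigr => i _.
rewrite [f i * _]mulr_sumr mulr_suml; apply: eq_bigr => j _.
by rewrite mulr_sumr.
Qed.

Lemma pos_bounds N1 N2 N3 (a : 'I_(N1 * N2 * N3)) :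
  [/\ a %/ (N2 * N3) < N1, a %/ N3 %% N2 < N2 & a %% N3 < N3]%N.
Proof.
have := ltn_ord a => aN.
have [N1p N2p N3p] : [/\ 0 < N1, 0 < N2 & 0 < N3]%N.
  by have := leq_ltn_trans (leq0n _) aN; rewrite !muln_gt0 => /andP[/andP[]].
by split; rewrite ?ltn_mod // ltn_divLR ?muln_gt0 ?N2p// mulnA.
Qed.

Lemma tens3M N n (P Q S P' Q' S' : nat -> nat -> R) :
  n = (N.1.1 * N.1.2 * N.2)%N ->
  tens3 N n P Q S *m tens3 N n P' Q' S' =
  tens3 N n (fun i j => \sum_(l < N.1.1) P i l * P' l j)
            (fun i j => \sum_(l < N.1.2) Q i l * Q' l j)
            (fun i j => \sum_(l < N.2) S i l * S' l j).
Proof.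
case: N => [[N1 N2] N3] /= ->; apply/matrixP => a b; rewrite !mxE.
set a1 := (a %/ _)%N; set b1 := (b %/ (N2 * N3))%N.
set a2 := (_ %% N2)%N; set b2 := (b %/ N3 %% N2)%N.
set a3 := (_ %% N3)%N; set b3 := (b %% N3)%N.
rewrite -(sum3_prod _ _ _ (fun l => P a1 l * P' l b1)
  (fun l => Q a2 l * Q' l b2) (fun l => S a3 l * S' l b3)).
rewrite -(sum_pos _ _ _ (fun i j l => P a1 i * P' i b1 *
  (Q a2 j * Q' j b2) * (S a3 l * S' l b3))) toC_sum; apply: eq_bigr => l _.
by rewrite !mxE -toCM; congr toC; ring.
Qed.

Lemma eq_tens3 N n (P Q S P' Q' S' : nat -> nat -> R) :
  n = (N.1.1 * N.1.2 * N.2)%N ->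
  (forall i j, (i < N.1.1)%N -> (j < N.1.1)%N -> P i j = P' i j) ->
  (forall i j, (i < N.1.2)%N -> (j < N.1.2)%N -> Q i j = Q' i j) ->
  (forall i j, (i < N.2)%N -> (j < N.2)%N -> S i j = S' i j) ->
  tens3 N n P Q S = tens3 N n P' Q' S'.
Proof.
case: N => [[N1 N2] N3] /= -> hP hQ hS; apply/matrixP => a b; rewrite !mxE.
have [a1 a2 a3] := pos_bounds a; have [b1 b2 b3] := pos_bounds b.
by rewrite hP // hQ // hS.
Qed.

Lemma feval_mul N n L L' : n = (N.1.1 * N.1.2 * N.2)%N ->
  feval N n (fmul L L') = feval N n L *m feval N n L'.
Proof.
move=> nN; rewrite /feval big_allpairs_dep mulmx_suml; apply: eq_bigr => t _.
rewrite mulmx_sumr; apply: eq_bigr => t' _ /=.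
rewrite -scalemxAl -scalemxAr scalerA; congr (_ *: _).
rewrite tens3M //; apply: eq_tens3 => // i j il jl.
- by rewrite map_cat wmx_cat.
- by rewrite wmx_cat.
- by rewrite wmx_cat.
Qed.

Lemma feval_adj N n L : n = (N.1.1 * N.1.2 * N.2)%N ->
  feval N n (fadj L) = (map_mx Num.conj (feval N n L)^T).
Proof.
move=> nN; rewrite /feval /fadj big_map linear_sum /= raddf_sum /=.
apply: eq_bigr => t _; rewrite linearZ /= map_mxZ; congr (_ *: _).
transitivity (tens3 N n (fun i j => wmx N.1.1 (map Some t.2.1.1) j i)
   (fun i j => wmx N.1.2 t.2.1.2 j i) (fun i j => wmx N.2 t.2.2 j i)).
  apply: eq_tens3 => // i j il jl /=; [|exact: wmx_adj|exact: wmx_adj].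
  rewrite -[RHS](wmx_adj _ il jl); congr wmx.
  by rewrite /wadj map_rev -!map_comp.
case: N nN => [[N1 N2] N3] /= nN; apply/matrixP => a b; rewrite !mxE.
by apply/esym/CrealP; rewrite complex_real.
Qed.

Definition fnorm (L : seq (term R)) : R := \sum_(t <- L) absC t.1.

Lemma fnorm_ge0 L : 0 <= fnorm L.
Proof. by apply: sumr_ge0 => t _; exact: absC_ge0. Qed.

(** Each word has row sums at most 1, at every size. *)
Lemma feval_row_sum N n L a : n = (N.1.1 * N.1.2 * N.2)%N ->
  \sum_b absC (feval N n L a b) <= fnorm L.
Proof.
move=> nN; rewrite /feval /fnorm.
under eq_bigr do rewrite summxE.
apply: (@le_trans _ _ (\sum_b \sum_(t <- L) absC t.1 *
   absC (tens3 N n (wmx N.1.1 (map Some t.2.1.1))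
                   (wmx N.1.2 t.2.1.2) (wmx N.2 t.2.2) a b))).
  apply: ler_sum => b _; apply: le_trans (absC_sum _ _ _) _.
  by apply: ler_sum => t _; rewrite mxE absCM.
rewrite exchange_big /=; apply: ler_sum => t _.
rewrite -mulr_sumr ler_piMr ?absC_ge0//.
case: N nN => [[N1 N2] N3] /= nN; subst n.
under eq_bigr do rewrite mxE absC_toC ger0_norm ?mulr_ge0 ?wmx_ge0//.
have [a1 a2 a3] := pos_bounds a.
rewrite (sum_pos _ _ _ (fun i j l =>
  wmx N1 (map Some t.2.1.1) (a %/ (N2 * N3))%N i *
  wmx N2 t.2.1.2 (a %/ N3 %% N2)%N j * wmx N3 t.2.2 (a %% N3)%N l)).
rewrite (sum3_prod _ _ _ (fun i => wmx N1 (map Some t.2.1.1) (a %/ (N2 * N3))%N i)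
  (fun j => wmx N2 t.2.1.2 (a %/ N3 %% N2)%N j)
  (fun l => wmx N3 t.2.2 (a %% N3)%N l)).
have s0 m w i : 0 <= \sum_(j < m) wmx m w i j :> R.
  by apply: sumr_ge0 => ? _; exact: wmx_ge0.
by rewrite !mulr_ile1 ?mulr_ge0 ?s0 ?wmx_row_sum.
Qed.

Lemma fnorm_adj L : fnorm (fadj L) = fnorm L.
Proof. by rewrite /fnorm big_map; apply: eq_bigr => t _; rewrite absC_conj. Qed.

Lemma feval_col_sum N n L b : n = (N.1.1 * N.1.2 * N.2)%N ->
  \sum_a absC (feval N n L a b) <= fnorm L.
Proof.
move=> nN; rewrite -fnorm_adj; apply: le_trans _ (feval_row_sum _ b nN).
by rewrite feval_adj //; apply: ler_sum => a _; rewrite !mxE absC_conj.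
Qed.

(** The limit of the normalised traces, and also the mean of the symbol. *)
Definition fmoment (L : seq (term R)) : C :=
  \sum_(t <- L) t.1 * toC (wmoment (map Some t.2.1.1) * wmoment t.2.1.2 *
                           wmoment t.2.2).

Lemma trace_feval N n L : n = (N.1.1 * N.1.2 * N.2)%N ->
  \tr (feval N n L) = \sum_(t <- L) t.1 *
    toC ((\sum_(i < N.1.1) wmx N.1.1 (map Some t.2.1.1) i i) *
         (\sum_(i < N.1.2) wmx N.1.2 t.2.1.2 i i) *
         (\sum_(i < N.2) wmx N.2 t.2.2 i i)).
Proof.
move=> nN; rewrite /feval raddf_sum /=; apply: eq_bigr => t _.
rewrite mxtraceZ; congr (_ * _).
case: N nN => [[N1 N2] N3] /= ->; rewrite 
  -(sum3_prod _ _ _ (fun i => wmx N1 (map Some t.2.1.1) i i)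
     (fun i => wmx N2 t.2.1.2 i i) (fun i => wmx N3 t.2.2 i i))
  -(sum_pos _ _ _ (fun i j l => wmx N1 (map Some t.2.1.1) i i *
     wmx N2 t.2.1.2 j j * wmx N3 t.2.2 l l)) toC_sum.
by apply: eq_bigr => a _; rewrite mxE.
Qed.

(** The value at a point of the symbol, where a word in the coordinate and the
    shift becomes a monomial in the coordinate times a character. *)
Definition fsymb (L : seq (term R)) (x y t1 t2 t3 : R) : C :=
  \sum_(t <- L) t.1 * toC (y ^+ wdeg t.2.1.2 * x ^+ wdeg t.2.2) *
    cis ((wbal (map Some t.2.1.1))%:~R * t1 + (wbal t.2.2)%:~R * t2 +
         (wbal t.2.1.2)%:~R * t3).

Lemma wbal_cat w w' : wbal (w ++ w') = wbal w + wbal w'.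
Proof. by rewrite /wbal big_cat. Qed.

Lemma wdeg_cat w w' : wdeg (w ++ w') = (wdeg w + wdeg w')%N.
Proof. exact: count_cat. Qed.

Lemma wbal_adj w : wbal (wadj w) = - wbal w.
Proof.
elim: w => [|g w IH]; first by rewrite /wadj /wbal /= !big_nil oppr0.
rewrite /wadj /= rev_cons -cats1 wbal_cat -/(wadj w) IH [wbal (g :: w)]wbal_cons opprD addrC.
by congr (_ + _); rewrite /wbal big_seq1; case: g => [[]|].
Qed.

Lemma wdeg_adj w : wdeg (wadj w) = wdeg w.
Proof.
rewrite /wdeg /wadj count_rev count_map; apply: eq_count => -[[]|] //.
Qed.

Lemma fsymb_mul L L' x y t1 t2 t3 :
  fsymb (fmul L L') x y t1 t2 t3 = fsymb L x y t1 t2 t3 * fsymb L' x y t1 t2 t3.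
Proof.
rewrite /fsymb big_allpairs_dep big_distrlr; apply: eq_bigr => t _ /=.
apply: eq_bigr => t' _ /=.
rewrite map_cat !wbal_cat !wdeg_cat !exprD.
rewrite [RHS]mulrACA -cisD [X in _ = X * _]mulrACA -toCM.
congr (_ * toC _ * cis _); first by ring.
by rewrite !rmorphD /=; ring.
Qed.

Lemma fsymb_adj L x y t1 t2 t3 :
  fsymb (fadj L) x y t1 t2 t3 = (fsymb L x y t1 t2 t3)^*.
Proof.
rewrite /fsymb rmorph_sum big_map /=; apply: eq_bigr => t _.
rewrite !rmorphM /= !wdeg_adj -cisN; congr (_ * _ * cis _).
  by apply/esym/CrealP; rewrite complex_real.
rewrite (_ : map Some (rev (map negb t.2.1.1)) = wadj (map Some t.2.1.1)).
  by rewrite !wbal_adj !rmorphN /=; ring.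
by rewrite /wadj map_rev -!map_comp.
Qed.

Lemma fsymb_bound L x y t1 t2 t3 : 0 <= x <= 1 -> 0 <= y <= 1 ->
  absC (fsymb L x y t1 t2 t3) <= fnorm L.
Proof.
move=> /andP[x0 x1] /andP[y0 y1].
apply: le_trans (absC_sum _ _ _) _; apply: ler_sum => t _.
rewrite !absCM absC_cis mulr1 absC_toC ler_piMr ?absC_ge0//.
rewrite ger0_norm ?mulr_ge0 ?exprn_ge0// mulr_ile1 ?exprn_ge0//;
  exact: exprn_ile1.
Qed.

End FormalSums.

(** * Integrals of complex functions on products *)

Section ComplexIntegral.
Context {R : realType}.

(** Bounded measurable functions on a set of finite measure are closed under
    all the operations needed below and are integrable. *)
Definition bmfun d (X : measurableType d) (D : set X) (f : X -> Cx R) : Prop :=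
  measurable_funC D f /\ exists M : R, forall x, D x -> absC (f x) <= M.

Lemma Rbounded_integrable d (X : measurableType d)
  (mu : {measure set X -> \bar R}) (D : set X) (f : X -> R) (M : R) :
  measurable D -> (mu D < +oo)%E -> measurable_fun D f ->
  (forall x, D x -> `|f x| <= M) -> mu.-integrable D (EFin \o f).
Proof.
move=> mD muD mf fM; apply: measurable_bounded_integrable => //.
exists M; split; first exact: num_real.
by move=> y My x Dx; apply: le_trans (fM x Dx) (ltW My).
Qed.

Lemma bmfun_integrable_re d (X : measurableType d)
  (mu : {measure set X -> \bar R}) (D : set X) (f : X -> Cx R) :
  measurable D -> (mu D < +oo)%E -> bmfun D f ->
  mu.-integrable D (EFin \o (fun x => reC (f x))).
Proof.
move=> mD muD [[mr mi] [M fM]]; apply: (@Rbounded_integrable _ _ mu D _ M) => //.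
by move=> x Dx; apply: le_trans (reC_le_absC _) (fM x Dx).
Qed.

Lemma bmfun_integrable_im d (X : measurableType d)
  (mu : {measure set X -> \bar R}) (D : set X) (f : X -> Cx R) :
  measurable D -> (mu D < +oo)%E -> bmfun D f ->
  mu.-integrable D (EFin \o (fun x => imC (f x))).
Proof.
move=> mD muD [[mr mi] [M fM]]; apply: (@Rbounded_integrable _ _ mu D _ M) => //.
by move=> x Dx; apply: le_trans (imC_le_absC _) (fM x Dx).
Qed.

Lemma reCM (z w : Cx R) : reC (z * w) = reC z * reC w - imC z * imC w.
Proof. by case: z; case: w. Qed.

Lemma imCM (z w : Cx R) : imC (z * w) = reC z * imC w + imC z * reC w.
Proof. by case: z => a b; case: w => a' b' /=; rewrite /imC /= addrC; ring. Qed.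

Lemma bmfun_add d (X : measurableType d) (D : set X) (f g : X -> Cx R) :
  bmfun D f -> bmfun D g -> bmfun D (fun x => f x + g x).
Proof.
move=> [[fr fi] [M fM]] [[gr gi] [K gK]]; split; first split.
- under eq_fun do rewrite reCD; exact: measurable_funD.
- under eq_fun do rewrite imCD; exact: measurable_funD.
- exists (M + K) => x Dx; apply: le_trans (absCD _ _) _.
  by apply: lerD; [exact: fM|exact: gK].
Qed.

Lemma bmfun_mul d (X : measurableType d) (D : set X) (f g : X -> Cx R) :
  bmfun D f -> bmfun D g -> bmfun D (fun x => f x * g x).
Proof.
move=> [[fr fi] [M fM]] [[gr gi] [K gK]]; split; first split.
- under eq_fun do rewrite reCM.
  by apply: measurable_funB; apply: measurable_funM.
- under eq_fun do rewrite imCM.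
  by apply: measurable_funD; apply: measurable_funM.
- exists (M * K) => x Dx; rewrite absCM.
  by apply: ler_pM; rewrite ?absC_ge0// ?fM ?gK.
Qed.

Lemma bmfun_cst d (X : measurableType d) (D : set X) (c : Cx R) :
  bmfun D (fun=> c).
Proof. by split; [split; exact: measurable_cst|exists (absC c)]. Qed.

Lemma bmfun_sum d (X : measurableType d) (D : set X) I (r : seq I)
    (F : I -> X -> Cx R) :
  (forall i, bmfun D (F i)) -> bmfun D (fun x => \sum_(i <- r) F i x).
Proof.
move=> H; elim: r => [|i r IH].
  by under eq_fun do rewrite big_nil; exact: bmfun_cst.
by under eq_fun do rewrite big_cons; exact: bmfun_add.
Qed.

Lemma bmfun_fst d1 d2 (X : measurableType d1) (Y : measurableType d2)
    (A : set X) (B : set Y) (f : X -> Cx R) :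
  measurable A -> measurable B -> bmfun A f ->
  bmfun (A `*` B) (fun z => f z.1).
Proof.
move=> mA mB [[fr fi] [M fM]]; split; last by exists M => z [Az _]; exact: fM.
have mf : measurable_fun (A `*` B) (@fst X Y).
  by apply: measurable_funS measurable_fst; first exact: measurableT.
split.
- apply: (@measurable_comp _ _ _ _ _ _ A (fun x => reC (f x)) _ fst) => //.
  by move=> _ [z [Az _] <-].
- apply: (@measurable_comp _ _ _ _ _ _ A (fun x => imC (f x)) _ fst) => //.
  by move=> _ [z [Az _] <-].
Qed.

Lemma bmfun_snd d1 d2 (X : measurableType d1) (Y : measurableType d2)
    (A : set X) (B : set Y) (f : Y -> Cx R) :
  measurable A -> measurable B -> bmfun B f ->
  bmfun (A `*` B) (fun z => f z.2).
Proof.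
move=> mA mB [[fr fi] [M fM]]; split; last by exists M => z [_ Bz]; exact: fM.
have mf : measurable_fun (A `*` B) (@snd X Y).
  by apply: measurable_funS measurable_snd; first exact: measurableT.
split.
- apply: (@measurable_comp _ _ _ _ _ _ B (fun x => reC (f x)) _ snd) => //.
  by move=> _ [z [_ Bz] <-].
- apply: (@measurable_comp _ _ _ _ _ _ B (fun x => imC (f x)) _ snd) => //.
  by move=> _ [z [_ Bz] <-].
Qed.

Lemma Rintegral_prod d1 d2 (X : measurableType d1) (Y : measurableType d2)
    (m1 : {sigma_finite_measure set X -> \bar R})
    (m2 : {sigma_finite_measure set Y -> \bar R})
    (A : set X) (B : set Y) (f : X -> R) (g : Y -> R) :
  measurable A -> measurable B ->
  m1.-integrable A (EFin \o f) -> m2.-integrable B (EFin \o g) ->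
  (m1 \x m2)%E.-integrable (A `*` B) (EFin \o (fun z => f z.1 * g z.2)) ->
  Rintegral (m1 \x m2)%E (A `*` B) (fun z => f z.1 * g z.2) =
  (\int[m1]_(x in A) f x) * (\int[m2]_(y in B) g y).
Proof.
move=> mA mB fi gi fgi.
rewrite /Rintegral integral_mkcond.
have mAB : measurable (A `*` B) by exact: measurableX.
have /(integrable_mkcond _ mAB) fgi' := fgi.
rewrite -integral12_prod_meas1 //.
have E x : fubini_F m2 ((EFin \o (fun z => f z.1 * g z.2)) \_ (A `*` B)) x =
    ((fun x => (f x)%:E * (\int[m2]_(y in B) (g y)%:E))%E \_ A) x.
  rewrite /fubini_F patchE; case: ifPn => xA.
    rewrite -integralZl //; rewrite [RHS]integral_mkcond.
    apply: eq_integral => y _; rewrite !patchE in_setX /= xA /=.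
    by case: ifP => // _; rewrite EFinM.
  rewrite integral0_eq // => y _.
  by rewrite patchE in_setX /= (negbTE xA).
transitivity (fine (\int[m1]_(x in A) ((f x)%:E * (\int[m2]_(y in B) (g y)%:E)))%E).
  by congr fine; rewrite [RHS]integral_mkcond; apply: eq_integral => x _; exact: E.
have gfin : (\int[m2]_(y in B) (g y)%:E)%E \is a fin_num.
  exact: integrable_fin_num.
rewrite -{1}(fineK gfin) integralZr //= fineM //; exact: integrable_fin_num.
Qed.

(** The real and imaginary parts of the product expand into four products of
    real functions, each of which is integrated by Fubini. *)
Lemma integralC_prod d1 d2 (X : measurableType d1) (Y : measurableType d2)
    (m1 : {sigma_finite_measure set X -> \bar R})
    (m2 : {sigma_finite_measure set Y -> \bar R})
    (A : set X) (B : set Y) (f : X -> Cx R) (g : Y -> Cx R) :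
  measurable A -> measurable B -> (m1 A < +oo)%E -> (m2 B < +oo)%E ->
  bmfun A f -> bmfun B g ->
  integralC (m1 \x m2)%E (A `*` B) (fun z => f z.1 * g z.2) =
  integralC m1 A f * integralC m2 B g.
Proof.
move=> mA mB m1A m2B bf bg.
have mAB : measurable (A `*` B) by exact: measurableX.
have mulAB : ((m1 \x m2)%E (A `*` B) < +oo)%E.
  by rewrite product_measure1E // lte_mul_pinfty // ge0_fin_numE.
have fr := bmfun_integrable_re mA m1A bf.
have fi := bmfun_integrable_im mA m1A bf.
have gr := bmfun_integrable_re mB m2B bg.
have gi := bmfun_integrable_im mB m2B bg.
have [[mfr mfi] [M fM]] := bf.
have [[mgr mgi] [K gK]] := bg.
have key (u : X -> R) (v : Y -> R) : bmfun A (fun x => toC (u x)) ->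
    bmfun B (fun x => toC (v x)) ->
    (m1 \x m2)%E.-integrable (A `*` B) (EFin \o (fun z => u z.1 * v z.2)) /\
    Rintegral (m1 \x m2)%E (A `*` B) (fun z => u z.1 * v z.2) =
    (\int[m1]_(x in A) u x) * (\int[m2]_(y in B) v y).
  move=> bu bv.
  have bw := bmfun_mul (bmfun_fst mA mB bu) (bmfun_snd mA mB bv).
  have := bmfun_integrable_re (mu := (m1 \x m2)%E) mAB mulAB bw.
  under eq_fun do rewrite -toCM.
  move=> H; split => //; apply: Rintegral_prod => //.
    exact: bmfun_integrable_re bu.
  exact: bmfun_integrable_re bv.
have bm_re dd (Z : measurableType dd) (S : set Z) (h : Z -> Cx R) : bmfun S h ->
    bmfun S (fun x => toC (reC (h x))).
  move=> [[hr hi] [P hP]]; split; first by split => //; exact: measurable_cst.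
  by exists P => z Sz; rewrite absC_toC (le_trans (reC_le_absC _)) ?hP.
have bm_im dd (Z : measurableType dd) (S : set Z) (h : Z -> Cx R) : bmfun S h ->
    bmfun S (fun x => toC (imC (h x))).
  move=> [[hr hi] [P hP]]; split; first by split => //; exact: measurable_cst.
  by exists P => z Sz; rewrite absC_toC (le_trans (imC_le_absC _)) ?hP.
have [i1 e1] := key _ _ (bm_re _ _ _ _ bf) (bm_re _ _ _ _ bg).
have [i2 e2] := key _ _ (bm_im _ _ _ _ bf) (bm_im _ _ _ _ bg).
have [i3 e3] := key _ _ (bm_re _ _ _ _ bf) (bm_im _ _ _ _ bg).
have [i4 e4] := key _ _ (bm_im _ _ _ _ bf) (bm_re _ _ _ _ bg).
rewrite /integralC.
rewrite (_ : Rintegral _ _ (fun x => reC (f x.1 * g x.2)) =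
  (\int[m1]_(x in A) reC (f x)) * (\int[m2]_(y in B) reC (g y)) -
  (\int[m1]_(x in A) imC (f x)) * (\int[m2]_(y in B) imC (g y))); last first.
  rewrite -e1 -e2 -RintegralB //; apply: eq_Rintegral => z _.
  by rewrite reCM.
rewrite (_ : Rintegral _ _ (fun x => imC (f x.1 * g x.2)) =
  (\int[m1]_(x in A) reC (f x)) * (\int[m2]_(y in B) imC (g y)) +
  (\int[m1]_(x in A) imC (f x)) * (\int[m2]_(y in B) reC (g y))); last first.
  rewrite -e3 -e4 -RintegralD //; apply: eq_Rintegral => z _.
  by rewrite imCM.
by simpc; congr (_ +i* _)%C; rewrite addrC.
Qed.

Lemma finite_prod d1 d2 (X : measurableType d1) (Y : measurableType d2)
    (m1 : {sigma_finite_measure set X -> \bar R})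
    (m2 : {sigma_finite_measure set Y -> \bar R})
    (A : set X) (B : set Y) :
  measurable A -> measurable B -> (m1 A < +oo)%E -> (m2 B < +oo)%E ->
  ((m1 \x m2)%E (A `*` B) < +oo)%E.
Proof.
by move=> mA mB m1A m2B; rewrite product_measure1E // lte_mul_pinfty // ge0_fin_numE.
Qed.

Lemma bmfun_prod d1 d2 (X : measurableType d1) (Y : measurableType d2)
    (A : set X) (B : set Y) (f : X -> Cx R) (g : Y -> Cx R) :
  measurable A -> measurable B -> bmfun A f -> bmfun B g ->
  bmfun (A `*` B) (fun z => f z.1 * g z.2).
Proof.
by move=> mA mB bf bg; apply: bmfun_mul; [exact: bmfun_fst|exact: bmfun_snd].
Qed.

(** A name for the product measure under which it is known to be sigma-finite,
    so that products can be iterated. *)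
Definition prodm d1 d2 (X : measurableType d1) (Y : measurableType d2)
    (m1 : {sigma_finite_measure set X -> \bar R})
    (m2 : {sigma_finite_measure set Y -> \bar R}) : set (X * Y) -> \bar R :=
  (m1 \x m2)%E.

Section ProductSigmaFinite.
Context d1 d2 (X : measurableType d1) (Y : measurableType d2)
  (m1 : {sigma_finite_measure set X -> \bar R})
  (m2 : {sigma_finite_measure set Y -> \bar R}).

HB.instance Definition _ := Measure.on (prodm m1 m2).

Let prodm_sigma_finite : sigma_finite setT (prodm m1 m2).
Proof.
have /sigma_finiteP[F [TF incF finF]] := sigma_finiteT m1.
have /sigma_finiteP[G [TG incG finG]] := sigma_finiteT m2.
exists (fun n => F n `*` G n) => [|n].
  apply/seteqP; split=> // -[x y] _.
  have [i _ Fx] : (\bigcup_n F n) x by rewrite -TF.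
  have [j _ Gy] : (\bigcup_n G n) y by rewrite -TG.
  exists (maxn i j) => //; split => /=.
    by have /subsetPset := incF _ _ (leq_maxl i j); apply.
  by have /subsetPset := incG _ _ (leq_maxr i j); apply.
have [mF Foo] := finF n; have [mG Goo] := finG n.
by split; [exact: measurableX|exact: finite_prod].
Qed.

HB.instance Definition _ :=
  Measure_isSigmaFinite.Build _ _ _ (prodm m1 m2) prodm_sigma_finite.

End ProductSigmaFinite.

Section ThreeFactors.
Context d1 d2 d3 (X : measurableType d1) (Y : measurableType d2)
  (Z : measurableType d3) (m1 : {sigma_finite_measure set X -> \bar R})
  (m2 : {sigma_finite_measure set Y -> \bar R})
  (m3 : {sigma_finite_measure set Z -> \bar R})
  (A : set X) (B : set Y) (D : set Z)
  (f : X -> Cx R) (g : Y -> Cx R) (h : Z -> Cx R).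
Hypotheses (mA : measurable A) (mB : measurable B) (mD : measurable D)
  (m1A : (m1 A < +oo)%E) (m2B : (m2 B < +oo)%E) (m3D : (m3 D < +oo)%E)
  (bf : bmfun A f) (bg : bmfun B g) (bh : bmfun D h).

Lemma integralC_prod3 :
  integralC (m1 \x m2 \x m3)%E (A `*` B `*` D)
    (fun z => f z.1.1 * g z.1.2 * h z.2) =
  integralC m1 A f * integralC m2 B g * integralC m3 D h.
Proof.
rewrite -(integralC_prod mA mB m1A m2B bf bg).
exact: (@integralC_prod _ _ _ _ (prodm m1 m2) m3 _ _ _ _ (measurableX mA mB) mD
  (finite_prod mA mB m1A m2B) m3D (bmfun_prod mA mB bf bg) bh).
Qed.

Lemma bmfun_prod3 :
  bmfun (A `*` B `*` D) (fun z => f z.1.1 * g z.1.2 * h z.2).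
Proof.
exact: (bmfun_prod (measurableX mA mB) mD (bmfun_prod mA mB bf bg) bh).
Qed.

Lemma finite_prod3 : ((m1 \x m2 \x m3)%E (A `*` B `*` D) < +oo)%E.
Proof.
exact: (@finite_prod _ _ _ _ (prodm m1 m2) m3 _ _ (measurableX mA mB) mD
  (finite_prod mA mB m1A m2B) m3D).
Qed.

End ThreeFactors.

Section FiveFactors.
Context d1 d2 d3 d4 d5 (X : measurableType d1) (Y : measurableType d2)
  (Z : measurableType d3) (V : measurableType d4) (W : measurableType d5)
  (m1 : {sigma_finite_measure set X -> \bar R})
  (m2 : {sigma_finite_measure set Y -> \bar R})
  (m3 : {sigma_finite_measure set Z -> \bar R})
  (m4 : {sigma_finite_measure set V -> \bar R})
  (m5 : {sigma_finite_measure set W -> \bar R})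
  (A : set X) (B : set Y) (D : set Z) (E : set V) (F : set W)
  (f : X -> Cx R) (g : Y -> Cx R) (h : Z -> Cx R) (u : V -> Cx R) (v : W -> Cx R).
Hypotheses (mA : measurable A) (mB : measurable B) (mD : measurable D)
  (mE : measurable E) (mF : measurable F)
  (m1A : (m1 A < +oo)%E) (m2B : (m2 B < +oo)%E) (m3D : (m3 D < +oo)%E)
  (m4E : (m4 E < +oo)%E) (m5F : (m5 F < +oo)%E)
  (bf : bmfun A f) (bg : bmfun B g) (bh : bmfun D h) (bu : bmfun E u)
  (bv : bmfun F v).

Lemma integralC_prod5 :
  integralC (m1 \x m2 \x m3 \x m4 \x m5)%E (A `*` B `*` D `*` E `*` F)
    (fun z => f z.1.1.1.1 * g z.1.1.1.2 * h z.1.1.2 * u z.1.2 * v z.2) =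
  integralC m1 A f * integralC m2 B g * integralC m3 D h * integralC m4 E u *
  integralC m5 F v.
Proof.
rewrite -(integralC_prod3 mA mB mD m1A m2B m3D bf bg bh).
exact: (@integralC_prod3 _ _ _ _ _ _ (prodm (prodm m1 m2) m3) m4 m5 _ _ _ _ _ _
  (measurableX (measurableX mA mB) mD) mE mF (finite_prod3 mA mB mD m1A m2B m3D) m4E m5F (bmfun_prod3 mA mB mD bf bg bh) bu bv).
Qed.

Lemma bmfun_prod5 :
  bmfun (A `*` B `*` D `*` E `*` F)
    (fun z => f z.1.1.1.1 * g z.1.1.1.2 * h z.1.1.2 * u z.1.2 * v z.2).
Proof.
exact: (bmfun_prod3 (measurableX (measurableX mA mB) mD) mE mF
  (bmfun_prod3 mA mB mD bf bg bh) bu bv).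
Qed.

Lemma finite_prod5 :
  ((m1 \x m2 \x m3 \x m4 \x m5)%E (A `*` B `*` D `*` E `*` F) < +oo)%E.
Proof.
exact: (@finite_prod3 _ _ _ _ _ _ (prodm (prodm m1 m2) m3) m4 m5 _ _ _
  (measurableX (measurableX mA mB) mD) mE mF (finite_prod3 mA mB mD m1A m2B m3D) m4E m5F).
Qed.

End FiveFactors.

Lemma integralCD d (X : measurableType d) (mu : {measure set X -> \bar R})
    (D : set X) (f g : X -> Cx R) :
  measurable D -> (mu D < +oo)%E -> bmfun D f -> bmfun D g ->
  integralC mu D (fun x => f x + g x) = integralC mu D f + integralC mu D g.
Proof.
move=> mD muD bf bg; rewrite /integralC; simpc; congr (_ +i* _)%C.
  rewrite -RintegralD//; try exact: bmfun_integrable_re.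
  by apply: eq_Rintegral => x _; rewrite reCD.
rewrite -RintegralD//; try exact: bmfun_integrable_im.
by apply: eq_Rintegral => x _; rewrite imCD.
Qed.

Lemma integralCZ d (X : measurableType d) (mu : {measure set X -> \bar R})
    (D : set X) (c : Cx R) (f : X -> Cx R) :
  measurable D -> (mu D < +oo)%E -> bmfun D f ->
  integralC mu D (fun x => c * f x) = c * integralC mu D f.
Proof.
move=> mD muD bf; have ir := bmfun_integrable_re mD muD bf.
have ii := bmfun_integrable_im mD muD bf.
have iZ k (u : X -> R) : mu.-integrable D (EFin \o u) ->
    mu.-integrable D (EFin \o (fun x => k * u x)).
  by move=> /(@integrableZl _ _ _ mu D mD k); apply: eq_integrable => // x _.
rewrite /integralC; case: c => a b; simpc; congr (_ +i* _)%C.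
  rewrite -!RintegralZl// -RintegralB//; try exact: iZ.
  by apply: eq_Rintegral => x _; rewrite reCM.
rewrite -!RintegralZl// -RintegralD//; try exact: iZ.
by apply: eq_Rintegral => x _; rewrite imCM.
Qed.

Lemma integralC_cst d (X : measurableType d) (mu : {measure set X -> \bar R})
    (D : set X) (c : Cx R) : measurable D ->
  integralC mu D (fun=> c) = toC (fine (mu D)) * c.
Proof.
move=> mD; rewrite /integralC !Rintegral_cst//; case: c => a b; simpc.
by congr (_ +i* _)%C; rewrite mulrC.
Qed.

Lemma integralC_sum d (X : measurableType d) (mu : {measure set X -> \bar R})
    (D : set X) I (r : seq I) (F : I -> X -> Cx R) :
  measurable D -> (mu D < +oo)%E -> (forall i, bmfun D (F i)) ->
  integralC mu D (fun x => \sum_(i <- r) F i x) =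
  \sum_(i <- r) integralC mu D (F i).
Proof.
move=> mD muD bF; elim: r => [|i r IH].
  under eq_fun do rewrite big_nil.
  by rewrite big_nil integralC_cst // mulr0.
under eq_fun do rewrite big_cons.
by rewrite big_cons integralCD ?IH//; exact: bmfun_sum.
Qed.

End ComplexIntegral.

(** * Moments of monomials and characters *)

Section Moments.
Context {R : realType}.
Local Notation leb := (@lebesgue_measure R).
Local Notation mR := (measurableTypeR R).

Lemma Rintegral_FTC (f F : R -> R) (a b : R) : a < b ->
  continuous f -> (forall x : R, is_derive x 1 F (f x)) ->
  Rintegral leb `[a, b] f = F b - F a.
Proof.
move=> ab cf dF; rewrite /Rintegral (@continuous_FTC2 _ _ F)//.
- exact: continuous_subspaceT.
- have dF' x : derivable F x 1 by have [] := dF x.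
  have cF : continuous F.
    by move=> x; apply/differentiable_continuous/derivable1_diffP.
  by split=> [x _ //||]; [exact/cvg_at_right_filter/cF|exact/cvg_at_left_filter/cF].
- by move=> x _; rewrite derive1E; have [_ ->] := dF x.
Qed.

Lemma continuous_cos_scale (c : R) : continuous (fun t : R => cos (c * t)).
Proof.
move=> t; apply: (@continuous_comp _ _ _ (fun t => c * t) cos).
  exact: mulrl_continuous.
exact: continuous_cos.
Qed.

Lemma continuous_sin_scale (c : R) : continuous (fun t : R => sin (c * t)).
Proof.
move=> t; apply: (@continuous_comp _ _ _ (fun t => c * t) sin).
  exact: mulrl_continuous.
exact: continuous_sin.
Qed.

Lemma sin_intpi (k : int) : sin (k%:~R * pi) = 0 :> R.
Proof.
have nat_case (n : nat) : sin (n%:R * pi) = 0 :> R.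
  elim: n => [|n IH]; first by rewrite mul0r sin0.
  by rewrite -natr1 mulrDl mul1r sinD IH sinpi mul0r mulr0 addr0.
case: k => n; first exact: nat_case.
by rewrite NegzE mulrNz mulNr sinN -pmulrn nat_case oppr0.
Qed.

Lemma finite_itv (a b : R) : (leb `[a, b] < +oo)%E.
Proof. by rewrite lebesgue_measure_itv; case: ifP => _; rewrite -?EFinB ltry. Qed.

Lemma measurable_itvR (a b : R) : measurable (`[a, b]%classic : set mR).
Proof. exact: measurable_itv. Qed.

Lemma bmfun_cis (c : R) (D : set mR) : measurable D ->
  bmfun D (fun t => cis (c * t) : Cx R).
Proof.
move=> mD; split; last by exists 1 => t _; rewrite absC_cis.
by split; apply: (@measurable_funS _ _ _ _ setT) => //;
  apply: continuous_measurable_fun;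
  [exact: continuous_cos_scale|exact: continuous_sin_scale].
Qed.

Lemma bmfun_exp n : bmfun (`[0, 1]%classic : set mR) (fun x : mR => toC ((x : R) ^+ n)).
Proof.
split.
  split; last exact: measurable_cst.
  apply: (@measurable_funS _ _ _ _ setT) => //.
  apply: continuous_measurable_fun; exact: exprn_continuous.
exists 1 => x /=; rewrite in_itv /= => /andP[x0 x1].
by rewrite absC_toC ger0_norm ?exprn_ge0// exprn_ile1.
Qed.

Lemma integralC_exp n :
  integralC leb (`[0, 1]%classic : set mR) (fun x : mR => toC ((x : R) ^+ n)) =
  toC (n.+1%:R^-1).
Proof.
rewrite /integralC; congr (_ +i* _)%C; last first.
  rewrite -[RHS](mul0r (fine (leb `[0, 1]%classic))) -Rintegral_cst //.
rewrite (@Rintegration_by_substitution_onem _ (fun x => x ^+ n) 1) ?lexx ?ler01//.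
  by rewrite /unstable.onem subrr Rintegral_onemXn.
apply: continuous_subspaceT; exact: exprn_continuous.
Qed.

Lemma pi2_gt0 : 0 < 2 * pi :> R.
Proof. by rewrite mulr_gt0 ?pi_gt0. Qed.

Lemma lebesgue_measure_itv_pi :
  leb (`[- pi, pi]%classic : set mR) = (2 * pi)%:E.
Proof.
rewrite lebesgue_measure_itv /= lte_fin gtrN ?pi_gt0// -EFinB opprK.
by rewrite mulr_natl mulr2n.
Qed.

(** Over a period the characters other than the trivial one average to zero. *)
Lemma integralC_cis (k : int) :
  integralC leb (`[- pi, pi]%classic : set mR) (fun t : mR => cis (k%:~R * (t : R))) =
  toC (2 * pi * (k == 0)%:R).
Proof.
have lt_pi : - pi < pi :> R by rewrite gtrN ?pi_gt0.
have [->|k0] := eqVneq k 0.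
  rewrite (_ : (fun t : mR => _) = fun=> 1); last first.
    by apply/funext => t; rewrite mul0r cis0.
  rewrite integralC_cst; last exact: measurable_itv.
  by rewrite !mulr1 [X in fine X](@lebesgue_measure_itv_pi).
have c0 : k%:~R != 0 :> R by rewrite intr_eq0.
set c : R := k%:~R.
have lin (x : R) : is_derive x 1 (fun t : R => c * t) c.
  have := @is_deriveZ _ _ _ id c x 1 1 (is_derive_id _ _).
  by rewrite /GRing.scale /= mulr1.
rewrite mulr0 toC0 /integralC /=.
have d1 (x : R) : is_derive x 1 (fun t : R => c^-1 * sin (c * t)) (cos (c * x)).
  have := is_derive1_comp (is_derive_sin (c * x)) (lin x).
  move=> /(@is_deriveZ _ _ _ (sin \o _) c^-1); rewrite /GRing.scale /=.
  by rewrite [cos _ * c]mulrC mulKf.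
have d2 (x : R) : is_derive x 1 (fun t : R => - c^-1 * cos (c * t)) (sin (c * x)).
  have := is_derive1_comp (is_derive_cos (c * x)) (lin x).
  move=> /(@is_deriveZ _ _ _ (cos \o _) (- c^-1)); rewrite /GRing.scale /=.
  by rewrite mulNr mulNr mulrN opprK [sin _ * c]mulrC mulKf.
rewrite (Rintegral_FTC lt_pi (@continuous_cos_scale c) d1).
rewrite (Rintegral_FTC lt_pi (@continuous_sin_scale c) d2).
by rewrite !mulrN sinN cosN /c sin_intpi !(mulr0, oppr0, subrr).
Qed.

Local Notation unit_itv := (`[0, 1]%classic : set mR).
Local Notation period := (`[- pi, pi]%classic : set mR).

Lemma bmfun_cis_period (c : R) : bmfun period (fun t => cis (c * t) : Cx R).
Proof. by apply: bmfun_cis; exact: measurable_itv. Qed.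

Lemma dot3_cis k : (fun t : R3 R => cis (dot3 k t)) =
  fun t : mR * mR * mR =>
  (cis (k.1.1%:~R * t.1.1) * cis (k.1.2%:~R * t.1.2)) * cis (k.2%:~R * t.2).
Proof. by case: k => [[k1 k2] k3]; apply/funext => -[[t1 t2] t3] /=; rewrite -!cisD. Qed.

Lemma measurable_torus3 : measurable (@torus3 R : set (mR * mR * mR)).
Proof.
have mI := measurable_itvR (- pi) pi.
exact: (measurableX (measurableX mI mI) mI).
Qed.

Lemma finite_torus3 : (@leb3 R (@torus3 R) < +oo)%E.
Proof.
have mI := measurable_itvR (- pi) pi; have fI := finite_itv (- pi) pi.
exact: (finite_prod3 mI mI mI fI fI fI).
Qed.

Lemma bmfun_dot3 k : bmfun (@torus3 R : set (mR * mR * mR)) (fun t => cis (dot3 k t) : Cx R).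
Proof.
have mI := measurable_itvR (- pi) pi; have b (k : int) := bmfun_cis_period k%:~R.
by rewrite dot3_cis; exact: (bmfun_prod3 mI mI mI (b _) (b _) (b _)).
Qed.

Lemma integralC_torus3 k :
  integralC (@leb3 R) (@torus3 R) (fun t => cis (dot3 k t)) =
  toC ((2 * pi) ^+ 3 * (k == 0)%:R).
Proof.
rewrite dot3_cis.
have mI := measurable_itvR (- pi) pi; have fI := finite_itv (- pi) pi.
have b (k : int) := bmfun_cis_period k%:~R.
have := integralC_prod3 mI mI mI fI fI fI (b k.1.1) (b k.1.2) (b k.2).
rewrite /leb3 /torus3 => ->.
rewrite !integralC_cis -!toCM; congr toC.
rewrite (_ : (k == 0) = (k.1.1 == 0) && (k.1.2 == 0) && (k.2 == 0)); last first.
  by case: k => [[k1 k2] k3].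
by case: (k.1.1 == 0); case: (k.1.2 == 0); case: (k.2 == 0) => /=; ring.
Qed.

(** Orthogonality of the characters of the torus. *)
Lemma fourier3_sum I (r : seq I) (c : I -> Cx R) (v : I -> int * int * int) k :
  fourier3 (fun t => \sum_(i <- r) c i * cis (dot3 (v i) t)) k =
  \sum_(i <- r) c i * (v i == k)%:R.
Proof.
rewrite /fourier3.
have -> : (fun t : R3 R => (\sum_(i <- r) c i * cis (dot3 (v i) t)) * cis (- dot3 k t)) =
    fun t => \sum_(i <- r) c i * cis (dot3 (v i - k) t).
  apply/funext => t; rewrite mulr_suml; apply: eq_bigr => i _.
  rewrite -mulrA -cisD; congr (_ * cis _).
  case: (v i) k t => [[v1 v2] v3] [[k1 k2] k3] [[t1 t2] t3] /=.
  by rewrite !intrD !rmorphN /=; ring.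
have bm i : bmfun (@torus3 R : set (mR * mR * mR))
    (fun t => c i * cis (dot3 (v i - k) t)).
  by apply: bmfun_mul; [exact: bmfun_cst|exact: bmfun_dot3].
rewrite (integralC_sum r measurable_torus3 finite_torus3 bm) mulr_sumr.
apply: eq_bigr => i _.
rewrite (integralCZ (c i) measurable_torus3 finite_torus3 (bmfun_dot3 _)).
rewrite integralC_torus3 subr_eq0 mulrCA toCM toC_nat; congr (_ * _).
rewrite mulrA -toCM mulVf ?mul1r// expf_neq0 // gt_eqF ?pi2_gt0//.
Qed.

Definition box5 : set (mR * mR * mR * mR * mR) :=
  unit_itv `*` unit_itv `*` period `*` period `*` period.

Definition fsymb5 (L : seq (term R)) (z : mR * mR * mR * mR * mR) : Cx R :=
  fsymb L z.1.1.1.1 z.1.1.1.2 z.1.1.2 z.1.2 z.2.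

Lemma measurable_box5 : measurable box5.
Proof.
have mU := measurable_itvR 0 1; have mI := measurable_itvR (- pi) pi.
exact: (measurableX (measurableX (measurableX (measurableX mU mU) mI) mI) mI).
Qed.

Lemma finite_box5 : (@leb5 R box5 < +oo)%E.
Proof.
have mU := measurable_itvR 0 1; have mI := measurable_itvR (- pi) pi.
have fU := finite_itv 0 1; have fI := finite_itv (- pi) pi.
exact: (finite_prod5 mU mU mI mI mI fU fU fI fI fI).
Qed.

Definition monom5 (t : term R) (z : mR * mR * mR * mR * mR) : Cx R :=
  toC ((z.1.1.1.1 : R) ^+ wdeg t.2.2) * toC ((z.1.1.1.2 : R) ^+ wdeg t.2.1.2) *
  cis ((wbal (map Some t.2.1.1))%:~R * z.1.1.2) *
  cis ((wbal t.2.2)%:~R * z.1.2) * cis ((wbal t.2.1.2)%:~R * z.2).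

Lemma fsymb5_monom L : fsymb5 L = fun z => \sum_(t <- L) t.1 * monom5 t z.
Proof.
apply/funext => z; apply: eq_bigr => t _.
by rewrite /monom5 toCM !cisD [toC (_ ^+ _) * toC _]mulrC -!mulrA.
Qed.

Lemma bmfun_monom5 t : bmfun box5 (monom5 t).
Proof.
have mU := measurable_itvR 0 1; have mI := measurable_itvR (- pi) pi.
have b (k : int) := bmfun_cis_period k%:~R.
exact: (bmfun_prod5 mU mU mI mI mI (bmfun_exp _) (bmfun_exp _) (b _) (b _) (b _)).
Qed.

Lemma bmfun_fsymb5 L : bmfun box5 (fsymb5 L).
Proof.
rewrite fsymb5_monom; apply: bmfun_sum => t.
by apply: bmfun_mul; [exact: bmfun_cst|exact: bmfun_monom5].
Qed.

Lemma integralC_monom5 t : integralC (@leb5 R) box5 (monom5 t) =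
  toC ((2 * pi) ^+ 3 * (wmoment (map Some t.2.1.1) * wmoment t.2.1.2 * wmoment t.2.2)).
Proof.
have mU := measurable_itvR 0 1; have mI := measurable_itvR (- pi) pi.
have fU := finite_itv 0 1; have fI := finite_itv (- pi) pi.
have b (k : int) := bmfun_cis_period k%:~R.
have := integralC_prod5 mU mU mI mI mI fU fU fI fI fI
  (bmfun_exp (wdeg t.2.2)) (bmfun_exp (wdeg t.2.1.2))
  (b (wbal (map Some t.2.1.1))) (b (wbal t.2.2)) (b (wbal t.2.1.2)).
rewrite /leb5 /box5 /monom5 => ->.
rewrite !integralC_exp !integralC_cis -!toCM; congr toC.
rewrite /wmoment (_ : wdeg (map Some _) = 0%N); last first.
  by rewrite /wdeg count_map; apply/eqP; rewrite -leqn0 leqNgt -has_count; apply/hasPn.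
by rewrite invr1; ring.
Qed.

Lemma integralC_fsymb5 L : integralC (@leb5 R) box5 (fsymb5 L) =
  toC ((2 * pi) ^+ 3) * fmoment L.
Proof.
rewrite fsymb5_monom (integralC_sum L measurable_box5 finite_box5); last first.
  by move=> t; apply: bmfun_mul; [exact: bmfun_cst|exact: bmfun_monom5].
rewrite /fmoment mulr_sumr; apply: eq_bigr => t _.
rewrite (integralCZ _ measurable_box5 finite_box5 (bmfun_monom5 t)).
by rewrite integralC_monom5 toCM mulrCA.
Qed.

Lemma leb5_box5 : fine (@leb5 R box5) = (2 * pi) ^+ 3.
Proof.
have := integralC_fsymb5 [:: (1, ([::], [::], [::]))].
rewrite (_ : fsymb5 _ = fun=> 1); last first.
  apply/funext => z; rewrite /fsymb5 /fsymb big_seq1 /= /wbal !big_nil /wdeg /=.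
  by rewrite !expr0 mulr1 !mul0r !addr0 cis0 !mulr1.
rewrite integralC_cst; last exact: measurable_box5.
rewrite /fmoment big_seq1 /= /wmoment /wbal !big_nil eqxx /wdeg /=.
by rewrite divr1 !mulr1 => /toC_inj.
Qed.

End Moments.

(** * Uniform approximation by polynomials on the square *)

Section Bernstein.
Context {R : realType}.
Implicit Types (x y : R) (f g : nat -> R).

(** The expectation of [f] under the binomial law of parameters [n] and [x],
    the Bernstein polynomial of [f]; the recursion on the last trial makes
    positivity, linearity and the variance immediate. *)
Fixpoint bern x n f : R :=
  if n is n'.+1 then (1 - x) * bern x n' f + x * bern x n' (f \o succn) else f 0%N.

Lemma bernD x n f g : bern x n (fun i => f i + g i) = bern x n f + bern x n g.
Proof.
elim: n f g => [//|n IH] f g /=.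
by rewrite IH (IH (f \o succn) (g \o succn)); ring.
Qed.

Lemma bernZ x n c f : bern x n (fun i => c * f i) = c * bern x n f.
Proof.
elim: n f => [//|n IH] f /=.
by rewrite IH (IH (f \o succn)); ring.
Qed.

Lemma bern_cst x n c : bern x n (fun=> c) = c.
Proof. by elim: n => [//|n IH] /=; rewrite IH; ring. Qed.

Lemma eq_bern x n f g : (forall i, f i = g i) -> bern x n f = bern x n g.
Proof. by move=> fg; congr bern; apply/funext. Qed.

Lemma le_bern x n f g : 0 <= x <= 1 ->
  (forall i, (i <= n)%N -> f i <= g i) -> bern x n f <= bern x n g.
Proof.
move=> /andP[x0 x1]; elim: n f g => [|n IH] f g fg /=; first exact: fg.
apply: lerD; apply: ler_wpM2l; rewrite ?subr_ge0//; apply: IH => i ni /=.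
  by apply: fg; exact: leqW.
exact: fg.
Qed.

Lemma bern_mean x n : bern x n (fun i => i%:R - n%:R * x) = 0.
Proof.
elim: n => [|n IH] /=; first by rewrite mul0r subrr.
rewrite (eq_bern _ _ (g := fun i => (i%:R - n%:R * x) + - x)); last first.
  by move=> i; rewrite -natr1; ring.
rewrite [X in x * X](eq_bern _ _ (g := fun i => (i%:R - n%:R * x) + (1 - x))); last first.
  by move=> i; rewrite /= -!natr1; ring.
by rewrite !(bernD _ _ (fun i => i%:R - n%:R * x)) IH !bern_cst; ring.
Qed.

Lemma bern_variance x n :
  bern x n (fun i => (i%:R - n%:R * x) ^+ 2) = n%:R * (x * (1 - x)).
Proof.
elim: n => [|n IH] /=; first by rewrite !mul0r subrr expr0n.
rewrite (eq_bern _ _ (g := fun i => (i%:R - n%:R * x) ^+ 2 +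
   ((- 2 * x) * (i%:R - n%:R * x) + x ^+ 2))); last first.
  by move=> i; rewrite -natr1; ring.
rewrite [X in x * X](eq_bern _ _ (g := fun i => (i%:R - n%:R * x) ^+ 2 +
   ((2 * (1 - x)) * (i%:R - n%:R * x) + (1 - x) ^+ 2))); last first.
  by move=> i; rewrite /= -!natr1; ring.
by rewrite !bernD !bernZ bern_mean IH !bern_cst -natr1; ring.
Qed.

Definition poly2 (s : seq (R * (nat * nat))) x y : R :=
  \sum_(t <- s) t.1 * (x ^+ t.2.1 * y ^+ t.2.2).

Definition is_poly2 (F : R -> R -> R) := exists s, forall x y, F x y = poly2 s x y.

Lemma is_poly2D F G : is_poly2 F -> is_poly2 G -> is_poly2 (fun x y => F x y + G x y).
Proof.
by move=> [s sF] [t tG]; exists (s ++ t) => x y; rewrite sF tG /poly2 big_cat.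
Qed.

Lemma is_poly2M F G : is_poly2 F -> is_poly2 G -> is_poly2 (fun x y => F x y * G x y).
Proof.
move=> [s sF] [t tG].
exists [seq (u.1 * v.1, (u.2.1 + v.2.1, u.2.2 + v.2.2)%N) | u <- s, v <- t] => x y.
rewrite sF tG /poly2 big_allpairs_dep big_distrlr; apply: eq_bigr => u _ /=.
by apply: eq_bigr => v _; rewrite !exprD; ring.
Qed.

Lemma is_poly2_cst c : is_poly2 (fun _ _ => c).
Proof. by exists [:: (c, (0, 0)%N)] => x y; rewrite /poly2 big_seq1 /= !mulr1. Qed.

Lemma is_poly2_x : is_poly2 (fun x _ => x).
Proof. by exists [:: (1, (1, 0)%N)] => x y; rewrite /poly2 big_seq1 /= mulr1 mul1r. Qed.

Lemma is_poly2_y : is_poly2 (fun _ y => y).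
Proof. by exists [:: (1, (0, 1)%N)] => x y; rewrite /poly2 big_seq1 /= !mul1r. Qed.

Lemma is_poly2_bern (V : R -> R -> R) n (f : nat -> R -> R -> R) : is_poly2 V ->
  (forall i, is_poly2 (f i)) -> is_poly2 (fun x y => bern (V x y) n (fun i => f i x y)).
Proof.
move=> hV; elim: n f => [|n IH] f hf /=; first exact: hf.
apply: is_poly2D; apply: is_poly2M => //.
- apply: (is_poly2D (is_poly2_cst 1)).
  have [s sV] := is_poly2M (is_poly2_cst (-1)) hV.
  by exists s => x y; rewrite -sV mulN1r.
- exact: IH.
- by apply: (IH (fun i => f i.+1)) => i.
Qed.

Local Notation square := (`[0, 1]%classic `*` `[0, 1]%classic : set (R * R)).

Lemma compact_square : compact square.
Proof. by apply: compact_setX; exact: segment_compact. Qed.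

Lemma square_unif_continuous (a : R * R -> R) (e : R) :
  {within square, continuous a} -> 0 < e ->
  exists2 d : R, 0 < d & forall p q, square p -> square q ->
    `|p.1 - q.1| < d -> `|p.2 - q.2| < d -> `|a p - a q| <= e.
Proof.
move=> ca e0.
have /compact_near_coveringP/near_covering_withinP nc := compact_square.
have e20 : 0 < e / 2 by rewrite divr_gt0.
pose P (d : R) (p : R * R) := forall q, square q ->
    `|p.1 - q.1| < d -> `|p.2 - q.2| < d -> `|a p - a q| <= e.
have step : \forall d \near 0^'+, square `<=` P d.
  apply: (nc R (0^'+) P) => p sp.
  have /subspace_continuousP/(_ p sp)/cvgrPdist_le/(_ _ e20) := ca.
  move=> /nbhs_ballP[r /= r0 Hr].
  have r20 : 0 < r / 2 by rewrite divr_gt0.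
  exists (ball p (r / 2), [set d | d < r / 2]) => /=.
    split; [exact: nbhsx_ballx|exact: nbhs_right_lt].
  move=> [p' d] [/= [bp1 bp2] dr] sp' q sq pq1 pq2.
  have hp' : `|a p - a p'| <= e / 2.
    have rr : r / 2 <= r by lra.
    by apply: Hr => //; split; [exact: le_ball rr _ bp1|exact: le_ball rr _ bp2].
  have hq : `|a p - a q| <= e / 2.
    apply: Hr => //; split; rewrite /ball /= ; rewrite /ball /= in bp1 bp2.
      by have := ler_distD p'.1 p.1 q.1; lra.
    by have := ler_distD p'.2 p.2 q.2; lra.
  have := ler_distD (a p) (a p') (a q); rewrite (distrC (a p') (a p)); lra.
have [d [d0 Hd]] := filter_ex (filterI (nbhs_right_gt 0) step).
by exists d => // p q sp sq; exact: Hd.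
Qed.

Lemma square_bounded (a : R * R -> R) :
  {within square, continuous a} -> exists M : R, forall p, square p -> `|a p| <= M.
Proof.
move=> ca; have := continuous_compact ca compact_square.
move=> /compact_bounded[M [_ HM]]; exists (M + 1) => p sp.
by apply: (HM (M + 1)); [rewrite ltrDl|exists p].
Qed.

Lemma bern_norm x n f c : 0 <= x <= 1 ->
  (forall i, (i <= n)%N -> `|f i| <= c i) -> `|bern x n f| <= bern x n c.
Proof.
move=> x01 fc; rewrite ler_norml; apply/andP; split.
  rewrite -mulN1r -bernZ; apply: le_bern => // i ni.
  by have := fc i ni; rewrite mulN1r ler_norml => /andP[].
by apply: le_bern => // i ni; apply: le_trans (ler_norm _) (fc i ni).
Qed.

(** Chebyshev's inequality, in the form used by Bernstein: far from the mean
    the variance pays for the oscillation of the function. *)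
Theorem weierstrass_square (a : R * R -> R) (e : R) :
  {within square, continuous a} -> 0 < e ->
  exists s, forall x y, 0 <= x <= 1 -> 0 <= y <= 1 ->
    `|a (x, y) - poly2 s x y| <= e.
Proof.
move=> ca e0.
have e20 : 0 < e / 2 by rewrite divr_gt0.
have [d d0 Hd] := square_unif_continuous ca e20.
have [M HM] := square_bounded ca.
pose M' := Num.max M 0.
have M0 : 0 <= M' by rewrite le_max lexx orbT.
have HM' p : square p -> `|a p| <= M' by move=> /HM h; rewrite le_max h.
pose K : R := 2 * M' / d ^+ 2.
have K0 : (0 <= K)%R by rewrite divr_ge0 ?mulr_ge0 ?exprn_ge0 ?(ltW d0).
have [n Hn] : exists n : nat, K * 2 * 2 / e < n%:R by exists (Num.truncn (K * 2 * 2 / e)).+1; exact: truncnS_gt.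
pose N : R := n.+1%:R.
have N0 : 0 < N by rewrite ltr0n.
pose F x y := bern x n.+1 (fun i => bern y n.+1 (fun j => a (i%:R / N, j%:R / N))).
have [s sF] : is_poly2 F.
  apply: (is_poly2_bern (V := fun x _ => x)) => [|i]; first exact: is_poly2_x.
  apply: (is_poly2_bern (V := fun _ y => y)) => [|j]; first exact: is_poly2_y.
  exact: is_poly2_cst.
exists s => x y x01 y01; rewrite -sF /F distrC.
have -> : a (x, y) = bern x n.+1 (fun i => bern y n.+1 (fun j => a (x, y))).
  by rewrite bern_cst bern_cst.
have grid i : (i <= n.+1)%N -> 0 <= i%:R / N <= 1.
  by move=> ni; rewrite divr_ge0 //= ler_pdivrMr // mul1r ler_nat.
have dist_sq z i : (i%:R / N - z) ^+ 2 = N^-1 ^+ 2 * (i%:R - N * z) ^+ 2.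
  by rewrite -exprMn; congr (_ ^+ _); field; rewrite gt_eqF.
have pt i j : (i <= n.+1)%N -> (j <= n.+1)%N ->
    `|a (i%:R / N, j%:R / N) - a (x, y)| <=
    e / 2 + (K * (i%:R / N - x) ^+ 2 + K * (j%:R / N - y) ^+ 2).
  move=> ni nj.
  have sq1 : square (i%:R / N, j%:R / N).
    by split; rewrite /= in_itv /= ?grid.
  have sq2 : square (x, y) by split; rewrite /= in_itv.
  have bd : `|a (i%:R / N, j%:R / N) - a (x, y)| <= 2 * M'.
    have := ler_normB (a (i%:R / N, j%:R / N)) (a (x, y)).
    by have := HM' _ sq1; have := HM' _ sq2; lra.
  have far (z : R) : d <= `|z| -> 2 * M' <= K * z ^+ 2.
    move=> dz; rewrite -[z ^+ 2]real_normK ?num_real// /K mulrAC.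
    rewrite ler_pdivlMr ?exprn_gt0// ler_wpM2l ?mulr_ge0//.
    by rewrite ler_pXn2r ?nnegrE// ltW.
  have KX := mulr_ge0 K0 (sqr_ge0 (i%:R / N - x)).
  have KY := mulr_ge0 K0 (sqr_ge0 (j%:R / N - y)).
  have [hx|/far hx] := ltP `|i%:R / N - x| d; last first.
    by apply: le_trans bd (le_trans hx _); rewrite addrCA lerDl addr_ge0 // ltW.
  have [hy|/far hy] := ltP `|j%:R / N - y| d; last first.
    by apply: le_trans bd (le_trans hy _); rewrite addrA lerDr addr_ge0 // ltW.
  by apply: le_trans (Hd _ _ sq1 sq2 hx hy) _; rewrite lerDl addr_ge0.
have inner i : (i <= n.+1)%N ->
    `|bern y n.+1 (fun j => a (i%:R / N, j%:R / N) - a (x, y))| <=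
    e / 2 + (K * (i%:R / N - x) ^+ 2 + K * (y * (1 - y) / N)).
  move=> ni; apply: le_trans (bern_norm y01 (fun j nj => pt i j ni nj)) _.
  rewrite !bernD !bern_cst bernZ (eq_bern _ _ (dist_sq y)) bernZ bern_variance.
  rewrite -/N le_eqVlt; apply/orP; left; apply/eqP; congr (_ + (_ + K * _)); field; rewrite gt_eqF//.
have -> : bern x n.+1 (fun i => bern y n.+1 (fun j => a (i%:R / N, j%:R / N))) -
    bern x n.+1 (fun i => bern y n.+1 (fun j => a (x, y))) =
    bern x n.+1 (fun i => bern y n.+1 (fun j => a (i%:R / N, j%:R / N) - a (x, y))).
  rewrite -mulN1r -bernZ -bernD; apply: eq_bern => i.
  rewrite -bernZ -bernD; apply: eq_bern => j; by rewrite mulN1r.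
apply: le_trans (bern_norm x01 inner) _.
rewrite !bernD !bern_cst bernZ (eq_bern _ _ (dist_sq x)) bernZ bern_variance -/N.
have -> : N^-1 ^+ 2 * (N * (x * (1 - x))) = x * (1 - x) / N by field; rewrite gt_eqF.
have var z : 0 <= z <= 1 -> K * (z * (1 - z) / N) <= e / 4.
  move=> /andP[z0 z1]; rewrite mulrA ler_pdivrMr//.
  have zz : z * (1 - z) <= 1 by nra.
  have kz : K * (z * (1 - z)) <= K by rewrite ler_piMr.
  apply: le_trans kz _; move: Hn; rewrite ltr_pdivrMr// => Hn.
  have : n%:R * e <= N * e by rewrite ler_wpM2r ?(ltW e0)// ler_nat.
  lra.
apply: le_trans (lerD (lexx (e / 2)) (lerD (var x x01) (var y y01))) _.
lra.
Qed.

End Bernstein.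

(** * Averages determined by moments *)

Section MomentDensity.
Context {R : realType}.

Definition poly1 (s : seq (R * nat)) (x : R) : R := \sum_(t <- s) t.1 * x ^+ t.2.

(** The case of functions that are constant in the second variable. *)
Lemma weierstrass_unit (phi : R -> R) (e : R) : continuous phi -> 0 < e ->
  exists s, forall x, 0 <= x <= 1 -> `|phi x - poly1 s x| <= e.
Proof.
move=> cphi e0.
have ca : {within `[0, 1] `*` `[0, 1], continuous (fun p : R * R => phi p.1)}.
  apply: continuous_subspaceT => p; apply: (@continuous_comp _ _ _ fst phi).
    exact: cvg_fst.
  exact: cphi.
have [s Hs] := weierstrass_square ca e0.
exists [seq (t.1 * 0 ^+ t.2.2, t.2.1) | t <- s] => x x01.
have := Hs x 0 x01; rewrite lexx ler01 => /(_ isT) /=.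
rewrite /poly2 /poly1 big_map /=.
by under eq_bigr do rewrite [_ ^+ _ * 0 ^+ _]mulrC mulrA.
Qed.

Definition average n (F : 'I_n -> R) : R := n%:R^-1 * \sum_i F i.

Lemma average_dist n (F G : 'I_n -> R) (e : R) : 0 <= e ->
  (forall i, `|F i - G i| <= e) -> `|average F - average G| <= e.
Proof.
move=> e0 FG; rewrite /average -mulrBr -sumrB normrM ger0_norm ?invr_ge0//.
have [n0|n0] := posnP n; first by rewrite [n%:R](_ : _ = 0) ?invr0 ?mul0r// n0.
rewrite mulrC ler_pdivrMr ?ltr0n// mulrC; apply: le_trans (ler_norm_sum _ _ _) _.
have : \sum_(i < n) e = n%:R * e by rewrite sumr_const card_ord mulr_natl.
by move=> <-; apply: ler_sum => i _; exact: FG.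
Qed.

Lemma average_poly1 n (x : 'I_n -> R) s :
  average (fun i => poly1 s (x i)) = \sum_(t <- s) t.1 * average (fun i => x i ^+ t.2).
Proof.
rewrite /average /poly1 exchange_big /= mulr_sumr; apply: eq_bigr => t _.
by rewrite -mulr_sumr mulrCA.
Qed.

Section Space.
Context d (X : measurableType d) (mu : {measure set X -> \bar R}) (D : set X).
Hypotheses (mD : measurable D) (muD : (mu D < +oo)%E) (muD0 : 0 < fine (mu D)).

Definition mean (f : X -> R) : R := (fine (mu D))^-1 * \int[mu]_(z in D) f z.

Definition bm (f : X -> R) :=
  measurable_fun D f /\ exists M : R, forall z, D z -> `|f z| <= M.

Lemma bm_integrable f : bm f -> mu.-integrable D (EFin \o f).
Proof. by move=> [mf [M fM]]; exact: Rbounded_integrable fM. Qed.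

Lemma mean_dist f g (e : R) : bm f -> bm g ->
  (forall z, D z -> `|f z - g z| <= e) -> `|mean f - mean g| <= e.
Proof.
move=> bf bg fg; have [mf [M fM]] := bf; have [mg [K gK]] := bg.
rewrite /mean -mulrBr -RintegralB//; try exact: bm_integrable.
rewrite normrM ger0_norm ?invr_ge0 ?(ltW muD0)// mulrC ler_pdivrMr//.
have ifg : mu.-integrable D (EFin \o (fun z => f z - g z)).
  apply: (@Rbounded_integrable _ _ _ mu D _ e) => //; exact: measurable_funB.
apply: le_trans (le_normr_Rintegral mD ifg) _.
rewrite -Rintegral_cst //; apply: le_Rintegral => //.
  exact: (integrable_norm ifg).
by apply: (@Rbounded_integrable _ _ _ mu D _ `|e|).
Qed.

Variable u : X -> R.
Hypotheses (mu_u : measurable_fun D u) (u01 : forall z, D z -> 0 <= u z <= 1).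

Lemma bm_exp j : bm (fun z => u z ^+ j).
Proof.
split; first exact: measurable_funX.
exists 1 => z Dz; have /andP[u0 u1] := u01 Dz.
by rewrite ger0_norm ?exprn_ge0// exprn_ile1.
Qed.

Lemma bmZ c f : bm f -> bm (fun z => c * f z).
Proof.
move=> [mf [M fM]]; split; first by apply: measurable_funM => //; exact: measurable_cst.
by exists (`|c| * M) => z Dz; rewrite normrM ler_wpM2l ?fM.
Qed.

Lemma bmD f g : bm f -> bm g -> bm (fun z => f z + g z).
Proof.
move=> [mf [M fM]] [mg [K gK]]; split; first exact: measurable_funD.
exists (M + K) => z Dz; apply: le_trans (ler_normD _ _) _.
by apply: lerD; [exact: fM|exact: gK].
Qed.

Lemma bm_poly1 s : bm (fun z => poly1 s (u z)).
Proof.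
elim: s => [|t s IH].
  rewrite /poly1; under eq_fun do rewrite big_nil.
  by split; [exact: measurable_cst|exists 0 => z _; rewrite normr0].
rewrite /poly1; under eq_fun do rewrite big_cons.
by apply: bmD => //; apply: bmZ; exact: bm_exp.
Qed.

Lemma mean_poly1 s :
  mean (fun z => poly1 s (u z)) = \sum_(t <- s) t.1 * mean (fun z => u z ^+ t.2).
Proof.
rewrite /mean; elim: s => [|t s IH].
  rewrite big_nil /poly1; under eq_Rintegral do rewrite big_nil.
  by rewrite Rintegral_cst // mul0r mulr0.
rewrite big_cons -IH /poly1; under eq_Rintegral do rewrite big_cons.
rewrite RintegralD//.
- rewrite RintegralZl//; first by rewrite mulrDr mulrCA.
  exact/bm_integrable/bm_exp.
- by apply: bm_integrable; apply: bmZ; exact: bm_exp.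
- exact: (bm_integrable (bm_poly1 s)).
Qed.

Lemma bm_continuous psi : continuous psi -> bm (fun z => psi (u z)).
Proof.
move=> cpsi; split.
  apply: (@measurableT_comp _ _ _ _ _ _ psi) => //.
  exact: continuous_measurable_fun.
have [s Hs] := weierstrass_unit cpsi ltr01.
have [_ [M HM]] := bm_poly1 s; exists (1 + M) => z Dz.
rewrite -[psi _](subrK (poly1 s (u z))); apply: le_trans (ler_normD _ _) _.
by apply: lerD; [apply: Hs; exact: u01|exact: HM].
Qed.

(** By Weierstrass, averages over points of [0, 1] converge to a mean for
    every continuous function as soon as they do for the powers. *)
Lemma moment_density (sz : nat -> nat) (x : forall k, 'I_(sz k) -> R) :
  (forall k i, 0 <= x k i <= 1) ->
  (forall j, average (fun i => x k i ^+ j) @[k --> \oo] --> mean (fun z => u z ^+ j)) ->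
  forall psi, continuous psi ->
  average (fun i => psi (x k i)) @[k --> \oo] --> mean (fun z => psi (u z)).
Proof.
move=> x01 Hj psi cpsi.
apply/cvgrPdist_le => e e0; have e30 : 0 < e / 3 by rewrite divr_gt0.
have [s Hs] := weierstrass_unit cpsi e30.
have : average (fun i => poly1 s (x k i)) @[k --> \oo] -->
       mean (fun z => poly1 s (u z)).
  rewrite mean_poly1.
  rewrite (_ : (fun k => average _) =
    fun k => \sum_(t <- s) t.1 * average (fun i => x k i ^+ t.2)); last first.
    by apply/funext => k; rewrite average_poly1.
  elim: s {Hs} => [|t s IH].
    rewrite big_nil (_ : (fun k => _) = fun=> 0); first exact: cvg_cst.
    by apply/funext => k; rewrite big_nil.
  rewrite big_cons (_ : (fun k => _) = fun k => t.1 * average (fun i => x k i ^+ t.2) +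
    \sum_(t <- s) t.1 * average (fun i => x k i ^+ t.2)); last first.
    by apply/funext => k; rewrite big_cons.
  by apply: cvgD; [apply: cvgMl_tmp; exact: Hj|exact: IH].
move=> /cvgrPdist_le/(_ _ e30); apply: filterS => k Hk.
have h1 : `|mean (fun z => psi (u z)) - mean (fun z => poly1 s (u z))| <= e / 3.
  apply: mean_dist; [exact: bm_continuous|exact: bm_poly1|].
  by move=> z Dz; apply: Hs; exact: u01.
have h2 : `|average (fun i => poly1 s (x k i)) - average (fun i => psi (x k i))| <= e / 3.
  apply: average_dist; first exact: ltW.
  by move=> i; rewrite distrC; apply: Hs; exact: x01.
apply: le_trans (ler_distD (mean (fun z => poly1 s (u z))) _ _) _.
have h3 := ler_distD (average (fun i => poly1 s (x k i)))
  (mean (fun z => poly1 s (u z))) (average (fun i => psi (x k i))).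
have -> : e = e / 3 + (e / 3 + e / 3) by field.
by apply: lerD => //; apply: le_trans h3 _; exact: lerD.
Qed.

End Space.
End MomentDensity.

(** * Singular values of formal sums and of their perturbations *)

Section SingularValues.
Context {R : realType}.
Local Open Scope sesquilinear_scope.

Lemma cvgC_absC (v : nat -> Cx R) (l : Cx R) :
  (forall e : R, 0 < e -> \forall k \near \oo, absC (v k - l) <= e) <->
  v @ \oo --> l.
Proof.
split=> [H|/cvgrPdist_le H].
  apply/cvgrPdist_le => e e0.
  have eE : e = toC (reC e).
    by case: e e0 => a b; rewrite ltcE /= => /andP[/eqP -> _].
  have /H : 0 < reC e by case: e e0 {eE} => a b; rewrite ltcE /= => /andP[_].
  by apply: filterS => k; rewrite absCB -le_toC -normC_absC -eE.
move=> e e0; have /H : (0 : Cx R) < toC e by rewrite ltcR.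
by apply: filterS => k; rewrite normC_absC le_toC absCB.
Qed.

Lemma cvg_toC (v : nat -> R) (l : R) :
  v @ \oo --> l -> (fun k => toC (v k)) @ \oo --> (toC l : Cx R).
Proof.
move=> /cvgrPdist_le H; apply/cvgC_absC => e e0; have := H e e0.
by apply: filterS => k; rewrite -toCB absC_toC distrC.
Qed.

Lemma cvg_of_toC (v : nat -> R) (l : R) :
  (fun k => toC (v k)) @ \oo --> (toC l : Cx R) -> v @ \oo --> l.
Proof.
move=> /cvgC_absC H; apply/cvgrPdist_le => e e0; have := H e e0.
by apply: filterS => k; rewrite -toCB absC_toC distrC.
Qed.

Lemma geig_singval n (A : 'M[Cx R]_n) i : geig A i = toC (singval A i ^+ 2).
Proof.
have g0 := geig_ge0 A i.
have gE : geig A i = toC (reC (geig A i)).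
  by move: g0; case: (geig A i) => a b; rewrite lecE /= => /andP[/eqP -> _].
by rewrite {1}gE; congr toC; rewrite sqr_sqrtr // -le_toC -gE.
Qed.

Lemma singval_ge0 n (A : 'M[Cx R]_n) i : 0 <= singval A i.
Proof. exact: sqrtr_ge0. Qed.

Definition schur_le n (E : 'M[Cx R]_n) (e : R) :=
  (forall i, \sum_j absC (E i j) <= e) /\ (forall j, \sum_i absC (E i j) <= e).

Lemma geig_schur n (E : 'M[Cx R]_n) (e : R) : 0 <= e -> schur_le E e ->
  forall i, geig E i <= toC e ^+ 2.
Proof.
move=> e0 [Er Ec]; apply: geig_le_schur; first by rewrite -toC0 le_toC.
  by move=> i; under eq_bigr do rewrite normC_absC; rewrite -toC_sum le_toC.
by move=> i; under eq_bigr do rewrite normC_absC; rewrite -toC_sum le_toC.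
Qed.

Lemma singval_schur n (E : 'M[Cx R]_n) (e : R) : 0 <= e -> schur_le E e ->
  forall i, singval E i <= e.
Proof.
move=> e0 Es i; have := geig_schur e0 Es i.
by rewrite geig_singval -toCX le_toC ler_pXn2r ?nnegrE ?singval_ge0.
Qed.

Lemma specnorm_schur n (E : 'M[Cx R]_n) (e : R) : 0 <= e -> schur_le E e ->
  specnorm E <= e.
Proof.
move=> e0 Es; rewrite /specnorm; elim/big_ind : _ => // [x y xe ye|i _].
  by rewrite ge_max xe ye.
exact: singval_schur.
Qed.

(** The normalised trace of the [r]-th power of the resolvent. *)
Definition ravg r n (A : 'M[Cx R]_n) : R :=
  average (fun i => (1 + singval A i ^+ 2)^-1 ^+ r).

Lemma ravg_trace r n (A : 'M[Cx R]_n) :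
  toC (ravg r A) = toC n%:R^-1 * \tr (iter r (mulmx (resolvent A)) 1%:M).
Proof.
rewrite /resolvent gfunX trace_gfun /ravg /average toCM toC_sum; congr (_ * _).
by apply: eq_bigr => i _; rewrite geig_singval !(toCX, toCV, toCD).
Qed.

(** The constant is 4 for the rank and 2 for the norm. *)
Lemma ravg_perturb r n (A B E : 'M[Cx R]_n) (e : R) : 0 <= e ->
  schur_le E e -> (\rank (A - (B + E)))%:R <= e * n%:R ->
  `|ravg r A - ravg r B| <= r%:R * (6 * e).
Proof.
move=> e0 Es rk.
have te0 : (0 : Cx R) <= toC e by rewrite -toC0 le_toC.
have [n0|n0] := posnP n.
  subst n; rewrite /ravg /average !big_ord0 subrr normr0.
  by rewrite !mulr_ge0.
have h1 := trace_resolvent_rank A (B + E) r.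
have Eop : opbound (B + E - B) (toC e).
  rewrite addrC addKr; apply: opbound_geig => //; exact: geig_schur.
have h2 := trace_resolvent_norm r te0 Eop.
rewrite -absC_toC toCB !ravg_trace -mulrBr absCM absC_toC.
rewrite ger0_norm ?invr_ge0// mulrC ler_pdivrMr ?ltr0n//.
rewrite -le_toC -normC_absC.
apply: le_trans (ler_distD (\tr (iter r (mulmx (resolvent (B + E))) 1%:M)) _ _) _.
apply: le_trans (lerD h1 h2) _.
rewrite -!toC_nat -toCD -!toCM -toCD le_toC -mulrDr -mulrA ler_wpM2l//.
lra.
Qed.

(** [fpow L j] is the formal counterpart of the powers of [A^* A]. *)
Definition fone : seq (term R) := [:: (1, ([::], [::], [::]))].
Definition fpow (L : seq (term R)) j := iter j (fmul (fmul (fadj L) L)) fone.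

Lemma feval_one N n : n = (N.1.1 * N.1.2 * N.2)%N -> feval N n fone = 1%:M :> 'M[Cx R]_n.
Proof.
case: N => [[N1 N2] N3] /= ->; apply/matrixP => a b.
rewrite /feval big_seq1 scale1r /tens3 !mxE /= -!natrM -toC_nat; congr toC.
congr (_%:R); have [->|ab] := eqVneq a b; first by rewrite !eqxx.
apply/eqP; rewrite !mulnb eqb0; apply: contra ab => /andP[/andP[/eqP h1 /eqP h2] /eqP h3].
apply/eqP/val_inj => /=; rewrite (divn_eq a N3) (divn_eq b N3) h3.
rewrite (divn_eq (a %/ N3) N2) (divn_eq (b %/ N3) N2) h2.
by rewrite -!divnMA ![(N3 * N2)%N]mulnC h1.
Qed.

Lemma feval_pow N n L j : n = (N.1.1 * N.1.2 * N.2)%N ->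
  feval N n (fpow L j) = iter j (mulmx (gram (feval N n L))) 1%:M.
Proof.
move=> nN; elim: j => [|j IH]; first exact: feval_one.
rewrite /fpow !iterS -/(fpow L j) feval_mul // IH; congr (_ *m _).
by rewrite feval_mul // feval_adj.
Qed.

Lemma fsymb_one x y t1 t2 t3 : fsymb fone x y t1 t2 t3 = 1 :> Cx R.
Proof.
rewrite /fsymb big_seq1 /= /wbal !big_nil /wdeg /=.
by rewrite !expr0 mulr1 !mul0r !addr0 cis0 !mulr1.
Qed.

Lemma fsymb_pow L j x y t1 t2 t3 :
  fsymb (fpow L j) x y t1 t2 t3 = toC ((absC (fsymb L x y t1 t2 t3) ^+ 2) ^+ j).
Proof.
elim: j => [|j IH]; first by rewrite fsymb_one.
rewrite /fpow iterS -/(fpow L j) !fsymb_mul IH fsymb_adj [_ ^+ j.+1]exprS toCM; congr (_ * _).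
by rewrite mulrC -normCK normC_absC toCX.
Qed.

Lemma trace_gram_pow n (A : 'M[Cx R]_n) j :
  \tr (iter j (mulmx (gram A)) 1%:M) = toC (\sum_i (singval A i ^+ 2) ^+ j).
Proof.
rewrite -{1}gfun_id gfunX trace_gfun toC_sum; apply: eq_bigr => i _.
by rewrite geig_singval [RHS]toCX.
Qed.

Section Asymptotics.
Variables (N : nat -> nat * nat * nat) (sz : nat -> nat).
Hypotheses (N1oo : (fun k => (N k).1.1) @ \oo --> \oo)
  (N2oo : (fun k => (N k).1.2) @ \oo --> \oo)
  (N3oo : (fun k => (N k).2) @ \oo --> \oo)
  (szE : forall k, sz k = ((N k).1.1 * (N k).1.2 * (N k).2)%N).

Lemma trace_feval_cvg L :
  (fun k => toC (sz k)%:R^-1 * \tr (feval (N k) (sz k) L)) @ \oo --> (fmoment L : Cx R).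
Proof.
rewrite /fmoment (_ : (fun k => _) = fun k => \sum_(t <- L) t.1 * toC (
   (((N k).1.1)%:R^-1 * \sum_(i < (N k).1.1) wmx (N k).1.1 (map Some t.2.1.1) i i) *
   (((N k).1.2)%:R^-1 * \sum_(i < (N k).1.2) wmx (N k).1.2 t.2.1.2 i i) *
   (((N k).2)%:R^-1 * \sum_(i < (N k).2) wmx (N k).2 t.2.2 i i))); last first.
  apply/funext => k; rewrite (trace_feval _ (szE k)) mulr_sumr.
  apply: eq_bigr => t _; rewrite mulrCA -toCM; congr (_ * toC _).
  by rewrite szE !natrM !invfM; ring.
elim: L => [|t L IH].
  rewrite big_nil (_ : (fun k => _) = fun=> 0); first exact: cvg_cst.
  by apply/funext => k; rewrite big_nil.
rewrite big_cons; under eq_fun do rewrite big_cons.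
apply: cvgD; last exact: IH.
apply: cvgMl_tmp; apply: cvg_toC.
apply: cvgM; first apply: cvgM.
- exact: (cvg_comp _ _ N1oo (wmx_trace_cvg (w := map Some t.2.1.1))).
- exact: (cvg_comp _ _ N2oo (wmx_trace_cvg (w := t.2.1.2))).
- exact: (cvg_comp _ _ N3oo (wmx_trace_cvg (w := t.2.2))).
Qed.

End Asymptotics.

End SingularValues.

(** * Singular value distribution of approximated sequences *)

Section Distribution.
Context {R : realType}.
Local Notation mR := (measurableTypeR R).
Local Notation mR5 := (mR * mR * mR * mR * mR)%type.
Implicit Types (L : seq (term R)).
Local Notation mean5 := (mean (@leb5 R) (@box5 R)).

Lemma fine_leb5_gt0 : 0 < fine (@leb5 R (@box5 R)).
Proof. by rewrite leb5_box5 exprn_gt0 // pi2_gt0. Qed.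

Lemma leb5_box5E : @leb5 R (@box5 R) = ((2 * pi) ^+ 3)%:E.
Proof.
rewrite -leb5_box5 fineK // ge0_fin_numE ?measure_ge0 //; exact: finite_box5.
Qed.

Lemma measurable_continuous_comp d (X : measurableType d) (D : set X)
    (f : R -> R) (g : X -> R) :
  continuous f -> measurable_fun D g -> measurable_fun D (fun z => f (g z)).
Proof.
move=> cf mg; apply: (@measurableT_comp _ _ _ _ _ _ f) => //.
exact: continuous_measurable_fun.
Qed.

Lemma measurable_absC (kap : mR5 -> Cx R) : measurable_funC (@box5 R) kap ->
  measurable_fun (@box5 R) (fun z => absC (kap z)).
Proof.
move=> [mr mi].
have -> : (fun z => absC (kap z)) =
    fun z => Num.sqrt (reC (kap z) ^+ 2 + imC (kap z) ^+ 2).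
  by apply/funext => z; rewrite /absC normc_def.
apply: (measurable_continuous_comp (f := fun t : R => Num.sqrt t)).
  exact: sqrt_continuous.
by apply: measurable_funD; apply: measurable_funX.
Qed.

Lemma integralC_toC (f : mR5 -> R) :
  integralC (@leb5 R) (@box5 R) (fun z => toC (f z)) =
  toC (\int[@leb5 R]_(z in @box5 R) f z).
Proof.
rewrite /integralC; congr (_ +i* _)%C.
by rewrite /= Rintegral_cst ?mul0r//; exact: measurable_box5.
Qed.

Lemma mean_fsymb_pow L j :
  toC (mean5 (fun z => (absC (fsymb5 L z) ^+ 2) ^+ j)) = fmoment (fpow L j).
Proof.
have := integralC_fsymb5 (fpow L j).
rewrite (_ : fsymb5 (fpow L j) =
  fun z => toC ((absC (fsymb5 L z) ^+ 2) ^+ j)); last first.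
  by apply/funext => z; rewrite /fsymb5 fsymb_pow.
rewrite integralC_toC => H; rewrite /mean toCM.
transitivity (toC ((2 * pi) ^+ 3)^-1 * (toC ((2 * pi) ^+ 3) * fmoment (fpow L j))).
  by congr (_ * _); [rewrite -leb5_box5|exact: H].
by rewrite mulrA -toCM mulVf ?mul1r// expf_neq0// gt_eqF ?pi2_gt0.
Qed.

Lemma inv1sq_bounds (s : R) : 0 <= (1 + s ^+ 2)^-1 <= 1.
Proof.
have s0 := sqr_ge0 s; have s1 : 0 < 1 + s ^+ 2 by lra.
by rewrite invr_ge0 (ltW s1) /= invf_le1 // lerDl.
Qed.

Lemma inv1sq_lip (s t : R) :
  `|(1 + s ^+ 2)^-1 - (1 + t ^+ 2)^-1| <= `|s - t|.
Proof.
have s1 : 0 < 1 + s ^+ 2 by have := sqr_ge0 s; lra.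
have t1 : 0 < 1 + t ^+ 2 by have := sqr_ge0 t; lra.
have -> : (1 + s ^+ 2)^-1 - (1 + t ^+ 2)^-1 =
    (t - s) * ((t + s) / ((1 + s ^+ 2) * (1 + t ^+ 2))).
  by field; rewrite !gt_eqF.
rewrite normrM distrC ler_piMr// normrM normfV.
rewrite (ger0_norm (mulr_ge0 (ltW s1) (ltW t1))) ler_pdivrMr ?mulr_gt0// mul1r.
have -> : (1 + s ^+ 2) * (1 + t ^+ 2) = 1 + s ^+ 2 + t ^+ 2 + s ^+ 2 * t ^+ 2 by ring.
have st := mulr_ge0 (sqr_ge0 s) (sqr_ge0 t).
have half (x : R) : `|x| <= x ^+ 2 + 1 / 4.
  rewrite -[x ^+ 2]real_normK ?num_real//.
  by have := sqr_ge0 (`|x| - 1 / 2); rewrite sqrrB; lra.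
by apply: le_trans (ler_normD _ _) _; have := half s; have := half t; lra.
Qed.

Section Sequence.
Variables (N : nat -> nat * nat * nat) (sz : nat -> nat).
Hypotheses (N1oo : (fun k => (N k).1.1) @ \oo --> \oo)
  (N2oo : (fun k => (N k).1.2) @ \oo --> \oo)
  (N3oo : (fun k => (N k).2) @ \oo --> \oo)
  (szE : forall k, sz k = ((N k).1.1 * (N k).1.2 * (N k).2)%N).

Lemma singval_feval_moment L j :
  average (fun i => (singval (feval (N k) (sz k) L) i ^+ 2) ^+ j) @[k --> \oo] -->
  mean5 (fun z => (absC (fsymb5 L z) ^+ 2) ^+ j).
Proof.
apply: cvg_of_toC; rewrite mean_fsymb_pow.
rewrite (_ : (fun k => _) = fun k => toC (sz k)%:R^-1 *
  \tr (feval (N k) (sz k) (fpow L j))); first exact: trace_feval_cvg.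
by apply/funext => k; rewrite /average toCM -trace_gram_pow feval_pow.
Qed.

Lemma schur_feval k L : schur_le (feval (N k) (sz k) L) (fnorm L).
Proof.
by split=> i; [exact: feval_row_sum (szE k)|exact: feval_col_sum (szE k)].
Qed.

Lemma fsymb5_bound L z : box5 z -> absC (fsymb5 L z) <= fnorm L.
Proof.
move=> [[[[/= x01 y01] _] _] _]; apply: fsymb_bound.
  by move: x01; rewrite in_itv.
by move: y01; rewrite in_itv.
Qed.

Lemma measurable_fsymb5 L : measurable_fun (@box5 R) (fun z => absC (fsymb5 L z)).
Proof. by apply: measurable_absC; have [] := @bmfun_fsymb5 R L. Qed.

(** The spectra stay in [0, fnorm L ^+ 2], where moments determine the limit;
    dividing by [c] brings them into the unit interval. *)
Lemma ravg_feval_cvg r L :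
  ravg r (feval (N k) (sz k) L) @[k --> \oo] -->
  mean5 (fun z => (1 + absC (fsymb5 L z) ^+ 2)^-1 ^+ r).
Proof.
have f0 := fnorm_ge0 L.
pose c : R := 1 + fnorm L ^+ 2.
have c0 : 0 < c by rewrite /c; have := sqr_ge0 (fnorm L); lra.
have sq_le (s : R) : 0 <= s <= fnorm L -> 0 <= s ^+ 2 / c <= 1.
  move=> /andP[s0 s1]; rewrite divr_ge0 ?sqr_ge0 ?(ltW c0)//=.
  by rewrite ler_pdivrMr// mul1r /c; nra.
have x01 k i : 0 <= singval (feval (N k) (sz k) L) i ^+ 2 / c <= 1.
  by apply: sq_le; rewrite singval_ge0 (singval_schur f0 (schur_feval k L)).
have u01 z : box5 z -> 0 <= absC (fsymb5 L z) ^+ 2 / c <= 1.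
  by move=> bz; apply: sq_le; rewrite absC_ge0 fsymb5_bound.
have mu_u : measurable_fun (@box5 R) (fun z => absC (fsymb5 L z) ^+ 2 / c).
  apply: measurable_funM; last exact: measurable_cst.
  by apply: measurable_funX; exact: measurable_fsymb5.
have mom j : average (fun i => (singval (feval (N k) (sz k) L) i ^+ 2 / c) ^+ j)
    @[k --> \oo] --> mean5 (fun z => (absC (fsymb5 L z) ^+ 2 / c) ^+ j).
  have e1 k : average (fun i => (singval (feval (N k) (sz k) L) i ^+ 2 / c) ^+ j) =
      c^-1 ^+ j * average (fun i => (singval (feval (N k) (sz k) L) i ^+ 2) ^+ j).
    rewrite /average mulrCA; congr (_ * _); rewrite mulr_sumr; apply: eq_bigr => i _.
    by rewrite exprMn mulrC.
  have e2 : mean5 (fun z => (absC (fsymb5 L z) ^+ 2 / c) ^+ j) =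
      c^-1 ^+ j * mean5 (fun z => (absC (fsymb5 L z) ^+ 2) ^+ j).
    have ij : (@leb5 R).-integrable (@box5 R)
        (EFin \o (fun z => (absC (fsymb5 L z) ^+ 2) ^+ j)).
      apply: (Rbounded_integrable (M := (fnorm L ^+ 2) ^+ j) measurable_box5 finite_box5).
        by apply: measurable_funX; apply: measurable_funX; exact: measurable_fsymb5.
      move=> z bz; rewrite ger0_norm ?exprn_ge0 ?absC_ge0//.
      apply: lerXn2r; rewrite ?nnegrE ?sqr_ge0//.
      by apply: lerXn2r; rewrite ?nnegrE ?absC_ge0// fsymb5_bound.
    rewrite /mean.
    rewrite mulrCA; congr (_ * _).
    rewrite -[RHS](RintegralZl _ measurable_box5 ij).
    by apply: eq_Rintegral => z _; rewrite exprMn mulrC.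
  rewrite e2 (_ : (fun k => average _) = fun k => c^-1 ^+ j *
    average (fun i => (singval (feval (N k) (sz k) L) i ^+ 2) ^+ j)); last first.
    by apply/funext => k; exact: e1.
  by apply: cvgMl_tmp; exact: (@singval_feval_moment L j).
pose psi (x : R) := (1 + c * `|x|)^-1 ^+ r.
have cpsi : continuous psi.
  move=> x; apply: (@continuous_comp _ _ _ (fun x : R => (1 + c * `|x|)^-1)
    (fun y : R => y ^+ r)); last exact: exprn_continuous.
  apply: cvgV; first by rewrite gt_eqF // ltr_pwDl ?mulr_ge0 ?(ltW c0).
  by apply: cvgD; [exact: cvg_cst|apply: cvgMl_tmp; exact: norm_continuous].
have := moment_density measurable_box5 finite_box5 fine_leb5_gt0 mu_u u01 x01 mom cpsi.
have psiE (s : R) : psi (s ^+ 2 / c) = (1 + s ^+ 2)^-1 ^+ r.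
  rewrite /psi ger0_norm ?divr_ge0 ?sqr_ge0 ?(ltW c0)// mulrC divfK//.
  by rewrite gt_eqF.
rewrite /mean /average.
under eq_fun do under eq_bigr do rewrite psiE.
by under eq_Rintegral do rewrite psiE.
Qed.

(** The approximation scheme: up to a small proportion of the rank and a small
    operator norm, [A k] is a formal sum whose symbol is close to [kap]. *)
Variables (A : forall k, 'M[Cx R]_(sz k)) (kap : mR5 -> Cx R).
Hypotheses (kap_meas : measurable_funC (@box5 R) kap)
  (approx : forall e : R, 0 < e -> exists L,
    (forall z, box5 z -> absC (fsymb5 L z - kap z) <= e) /\
    \forall k \near \oo, exists Rk E : 'M[Cx R]_(sz k),
      [/\ A k = feval (N k) (sz k) L + Rk + E,
          (\rank Rk)%:R <= e * (sz k)%:R & schur_le E e]).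

Let u z := (1 + absC (kap z) ^+ 2)^-1.

Lemma measurable_inv1sq (f : mR5 -> R) : measurable_fun (@box5 R) f ->
  measurable_fun (@box5 R) (fun z => (1 + f z ^+ 2)^-1).
Proof.
move=> mf; apply: (measurable_continuous_comp (f := fun x : R => (1 + x ^+ 2)^-1)) => //.
move=> x; apply: cvgV; first by rewrite gt_eqF // ltr_pwDl ?sqr_ge0.
by apply: cvgD; [exact: cvg_cst|exact: exprn_continuous].
Qed.

Lemma bm_inv1sq r (f : mR5 -> R) : measurable_fun (@box5 R) f ->
  bm (@box5 R) (fun z => (1 + f z ^+ 2)^-1 ^+ r).
Proof.
move=> mf; have mi := measurable_inv1sq mf.
by apply: (bm_exp mi) => z _; exact: inv1sq_bounds.
Qed.

(** Resolvent averages react to the rank and norm errors and to the distance of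
    the symbols by amounts proportional to [r]; the constant 7 is 6 for
    [ravg_perturb] and 1 for the symbols. *)
Lemma ravg_cvg r : ravg r (A k) @[k --> \oo] --> mean5 (fun z => u z ^+ r).
Proof.
apply/cvgrPdist_le => e e0.
have r0 : 0 < r%:R * 7 + 2 :> R by rewrite ltr_wpDl ?mulr_ge0.
pose d := e / (r%:R * 7 + 2).
have d0 : 0 < d by rewrite divr_gt0.
have [L [Lkap LA]] := approx d0.
have /cvgrPdist_le/(_ _ d0) HL := @ravg_feval_cvg r L.
near=> k.
have h1 : `|mean5 (fun z => u z ^+ r) -
    mean5 (fun z => (1 + absC (fsymb5 L z) ^+ 2)^-1 ^+ r)| <= r%:R * d.
  apply: (mean_dist measurable_box5 finite_box5 fine_leb5_gt0).
  - by apply: bm_inv1sq; exact: measurable_absC.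
  - by apply: bm_inv1sq; exact: measurable_fsymb5.
  - move=> z bz; apply: le_trans (exp_sub_le _ (inv1sq_bounds _) (inv1sq_bounds _)) _.
    rewrite ler_wpM2l//; apply: le_trans (inv1sq_lip _ _) _.
    apply: le_trans (Lkap z bz); rewrite absCB ler_norml; apply/andP; split.
      have := absCD (fsymb5 L z - kap z) (kap z); rewrite subrK absCB; lra.
    have := absCD (kap z - fsymb5 L z) (fsymb5 L z); rewrite subrK; lra.
have h2 : `|mean5 (fun z => (1 + absC (fsymb5 L z) ^+ 2)^-1 ^+ r) -
    ravg r (feval (N k) (sz k) L)| <= d by near: k; exact: HL.
have h3 : `|ravg r (A k) - ravg r (feval (N k) (sz k) L)| <= r%:R * (6 * d).
  have [Rk [E [AE rk Es]]] : exists Rk E : 'M[Cx R]_(sz k),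
      [/\ A k = feval (N k) (sz k) L + Rk + E,
          (\rank Rk)%:R <= d * (sz k)%:R & schur_le E d] by near: k; exact: LA.
  apply: (ravg_perturb r (ltW d0) Es).
  by rewrite AE (addrC _ Rk) -(addrA Rk) addrK.
have -> : e = (r%:R * d + d) + (r%:R * (6 * d) + d).
  rewrite (_ : r%:R * d + d + (r%:R * (6 * d) + d) = (r%:R * 7 + 2) * d); last by ring.
  by rewrite /d mulrCA mulfV ?mulr1// gt_eqF.
have t1 := ler_distD (mean5 (fun z => (1 + absC (fsymb5 L z) ^+ 2)^-1 ^+ r))
  (mean5 (fun z => u z ^+ r)) (ravg r (A k)).
have t2 := ler_distD (ravg r (feval (N k) (sz k) L))
  (mean5 (fun z => (1 + absC (fsymb5 L z) ^+ 2)^-1 ^+ r)) (ravg r (A k)).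
rewrite distrC in h3.
apply: le_trans t1 (le_trans (lerD h1 (le_trans t2 (lerD h2 h3))) _).
by rewrite addrA lerD2l lerDl ltW.
Unshelve. all: by end_near. Qed.

(** A test function vanishing far away is a continuous function of
    [(1 + s ^+ 2)^-1]; clipping the latter from below keeps it continuous. *)
Lemma average_singval_cvg (f : R -> R) (M : R) : continuous f ->
  (forall s, M <= s -> f s = 0) ->
  average (fun i => f (singval (A k) i)) @[k --> \oo] -->
  mean5 (fun z => f (absC (kap z))).
Proof.
move=> cf fM.
pose M' := Num.max M 0.
have M0 : 0 <= M' by rewrite le_max lexx orbT.
have fM' s : M' <= s -> f s = 0 by rewrite ge_max => /andP[/fM].
pose d := (1 + M' ^+ 2)^-1.
have d0 : 0 < d by rewrite invr_gt0 ltr_pwDl ?sqr_ge0.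
pose w (x : R) := (x + d + `|x - d|) / 2.
have wge x : d <= w x.
  by rewrite /w; have := ler_norm (d - x); rewrite distrC; lra.
pose psi (x : R) := f (Num.sqrt ((w x)^-1 - 1)).
have cw : continuous w.
  move=> x; apply: cvgMr_tmp; apply: cvgD; first by apply: cvgD; [exact: cvg_id|exact: cvg_cst].
  apply: (@continuous_comp _ _ _ (fun x : R => x - d) (fun y : R => `|y|)).
    by apply: cvgB; [exact: cvg_id|exact: cvg_cst].
  exact: norm_continuous.
have cpsi : continuous psi.
  move=> x; apply: (@continuous_comp _ _ _ (fun x : R => (w x)^-1 - 1) (fun y => f (Num.sqrt y))).
    apply: cvgB; last exact: cvg_cst.
    by apply: cvgV; [rewrite gt_eqF // (lt_le_trans d0)|exact: cw].
  by apply: (@continuous_comp _ _ _ (fun y : R => Num.sqrt y) f);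
    [exact: sqrt_continuous|exact: cf].
have psiE s : 0 <= s -> psi ((1 + s ^+ 2)^-1) = f s.
  move=> s0; have s1 : 0 < 1 + s ^+ 2 by rewrite ltr_pwDl ?sqr_ge0.
  have m1 : 0 < 1 + M' ^+ 2 by rewrite ltr_pwDl ?sqr_ge0.
  rewrite /psi /w; have [sM|/ltW Ms] := leP s M'.
    rewrite ger0_norm ?subr_ge0; last first.
      by rewrite /d lef_pV2 ?posrE// lerD2l ler_pXn2r.
    rewrite (_ : _ / 2 = (1 + s ^+ 2)^-1); last by field; rewrite gt_eqF.
    by rewrite invrK addrC addKr sqrtr_sqr ger0_norm.
  rewrite ler0_norm ?subr_le0; last first.
    by rewrite /d lef_pV2 ?posrE// lerD2l ler_pXn2r.
  rewrite (_ : _ / 2 = d); last by field; rewrite gt_eqF.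
  by rewrite /d invrK addrC addKr sqrtr_sqr ger0_norm// (fM' s Ms) fM'.
have x01 k i : 0 <= (1 + singval (A k) i ^+ 2)^-1 <= 1 by exact: inv1sq_bounds.
have u01 z : box5 z -> 0 <= u z <= 1 by move=> _; exact: inv1sq_bounds.
have mu_u : measurable_fun (@box5 R) u.
  by apply: measurable_inv1sq; exact: measurable_absC.
have := moment_density measurable_box5 finite_box5 fine_leb5_gt0 mu_u u01 x01
  ravg_cvg cpsi.
rewrite /mean /average.
under eq_fun do under eq_bigr do rewrite psiE ?singval_ge0//.
by under eq_Rintegral do rewrite psiE ?absC_ge0//.
Qed.

Theorem sv_distributed_of_approx : sv_distributed (@leb5 R) (@box5 R) kap A.
Proof.
split => //.
- rewrite (_ : sz = fun k => ((N k).1.1 * (N k).1.2 * (N k).2)%N); last exact/funext.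
  apply/cvgnyPge => P.
  have /cvgnyPge/(_ P) h1 := N1oo; have /cvgnyPge/(_ 1%N) h2 := N2oo.
  have /cvgnyPge/(_ 1%N) h3 := N3oo.
  near=> k; have a1 : (P <= (N k).1.1)%N by near: k.
  have a2 : (1 <= (N k).1.2)%N by near: k.
  have a3 : (1 <= (N k).2)%N by near: k.
  by rewrite (leq_trans a1)// -mulnA leq_pmulr // muln_gt0 a2.
- exact: measurable_box5.
- by rewrite leb5_box5E lte_fin ltry exprn_gt0 ?pi2_gt0.
move=> F cF /compact_bounded[M0 [_ HM0]].
pose M := Num.max M0 0 + 1.
have FM s : M <= s -> F s = 0.
  move=> Ms; apply/eqP/negPn/negP => Fs.
  have Mp : 0 <= Num.max M0 0 by rewrite le_max lexx orbT.
  have Mh : M0 < Num.max M0 0 + 1 / 2.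
    have hM : M0 <= Num.max M0 0 by rewrite le_max lexx.
    by rewrite (le_lt_trans hM) // ltrDl.
  have cs : closure [set t | F t != 0] s by apply: subset_closure; exact: Fs.
  have := HM0 _ Mh s cs.
  have s0 : 0 <= s by apply: le_trans Ms; rewrite addr_ge0.
  rewrite /= ger0_norm // => sM; have := le_trans Ms sM.
  by rewrite lerD2l; lra.
have cre : continuous (fun s => reC (F s)).
  move=> s; apply/cvgrPdist_le => e e0.
  have /cvgrPdist_le/(_ (toC e)) := cF s; rewrite ltcR => /(_ e0).
  apply: filterS => t; rewrite normC_absC le_toC; apply: le_trans.
  have -> : reC (F s) - reC (F t) = reC (F s - F t) by case: (F s); case: (F t).
  exact: reC_le_absC.
have cim : continuous (fun s => imC (F s)).
  move=> s; apply/cvgrPdist_le => e e0.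
  have /cvgrPdist_le/(_ (toC e)) := cF s; rewrite ltcR => /(_ e0).
  apply: filterS => t; rewrite normC_absC le_toC; apply: le_trans.
  have -> : imC (F s) - imC (F t) = imC (F s - F t) by case: (F s); case: (F t).
  exact: imC_le_absC.
have hre := average_singval_cvg (M := M) cre (fun s Ms => congr1 (@reC R) (FM s Ms)).
have him := average_singval_cvg (M := M) cim (fun s Ms => congr1 (@imC R) (FM s Ms)).
have split_re_im (z : Cx R) : z = toC (reC z) + 'i%C * toC (imC z).
  by case: z => a b; simpc.
rewrite (_ : (fun k => _) = fun k =>
  toC (average (fun i => reC (F (singval (A k) i)))) +
  'i%C * toC (average (fun i => imC (F (singval (A k) i))))); last first.
  apply/funext => k; rewrite /average !toCM !toC_sum -toC_nat -toCV mulrCA -mulrDr.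
  congr (_ * _); rewrite mulr_sumr -big_split; apply: eq_bigr => i _.
  exact: split_re_im.
rewrite (_ : toC _ * integralC _ _ _ =
  toC (mean5 (fun z => reC (F (absC (kap z))))) +
  'i%C * toC (mean5 (fun z => imC (F (absC (kap z)))))); last first.
  rewrite /mean !toCM mulrCA -mulrDr; congr (_ * _).
  exact: split_re_im.
apply: cvgD; first exact: cvg_toC.
by apply: cvgMl_tmp; exact: cvg_toC.
Unshelve. all: by end_near. Qed.

End Sequence.
End Distribution.

(** * The coefficients of the fractional difference and their symbol *)

Section Coefficients.
Context {R : realType}.

(** Bernoulli's inequality, from the tangent to the exponential at
    [s * ln a]. *)
Lemma powR_le_tangent (a s : R) : 0 <= a -> 0 < s < 1 -> a `^ s <= 1 + s * (a - 1).
Proof.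
move=> a0 /andP[s0 s1]; have [->|nz] := eqVneq a 0.
  by rewrite powR0 ?gt_eqF//; lra.
have ap : 0 < a by rewrite lt_def nz.
have -> : a `^ s = expR (s * ln a) by rewrite /powR (negbTE nz).
set y := ln a; have aE : a = expR (s * y) * expR ((1 - s) * y).
  by rewrite -expRD -mulrDl addrC subrK mul1r lnK.
have e1 := expR_ge1Dx ((1 - s) * y); have e2 := expR_ge1Dx (- (s * y)).
have p := expR_gt0 (s * y).
have h1 : expR (s * y) * (1 + (1 - s) * y) <= a by rewrite [leRHS]aE ler_pM2l.
have h2 : expR (s * y) * (1 - s * y) <= 1.
  by rewrite -[leRHS](expRxMexpNx_1 (s * y)) ler_pM2l.
have := lerD (ler_wpM2l (ltW s0) h1)
  (@ler_wpM2l _ (1 - s) _ _ _ h2); rewrite subr_ge0 => /(_ (ltW s1)).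
by rewrite (_ : s * _ + _ = expR (s * y)); [lra|ring].
Qed.

Lemma powR_concave_nat (k : nat) (s : R) : 0 < s < 1 ->
  k.+2%:R `^ s - 2 * k.+1%:R `^ s + k%:R `^ s <= 0 :> R.
Proof.
move=> s01; have k0 : 0 < k.+1%:R :> R by rewrite ltr0n.
have split_pow (j : nat) : j%:R `^ s = k.+1%:R `^ s * (j%:R / k.+1%:R) `^ s :> R.
  by rewrite -powRM ?divr_ge0// mulrC divfK // gt_eqF.
have pk : 0 <= k.+1%:R `^ s :> R by exact: powR_ge0.
have h1 : (k.+2%:R / k.+1%:R) `^ s <= 1 + s * (k.+2%:R / k.+1%:R - 1) :> R.
  by apply: powR_le_tangent => //; rewrite divr_ge0.
have h2 : (k%:R / k.+1%:R) `^ s <= 1 + s * (k%:R / k.+1%:R - 1) :> R.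
  by apply: powR_le_tangent => //; rewrite divr_ge0.
rewrite (split_pow k.+2) (split_pow k).
have -> : k.+1%:R `^ s * (k.+2%:R / k.+1%:R) `^ s - 2 * k.+1%:R `^ s +
   k.+1%:R `^ s * (k%:R / k.+1%:R) `^ s =
   k.+1%:R `^ s * ((k.+2%:R / k.+1%:R) `^ s + (k%:R / k.+1%:R) `^ s - 2) by ring.
rewrite pmulr_rle0 ?powR_gt0// subr_le0.
apply: le_trans (lerD h1 h2) _.
rewrite (_ : _ + _ = 2) //; rewrite -[k.+2%:R]natr1 -[k.+1%:R]natr1; field.
by rewrite natr1 gt_eqF.
Qed.

Section OneCoefficient.
Variable z : R.
Hypothesis z01 : 0 < z < 1.

Let s01 : 0 < 1 - z < 1. Proof. by move: z01 => /andP[z0 z1]; apply/andP; split; lra. Qed.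

Lemma wcoef_le0 k : wcoef z k.+1 <= 0.
Proof. exact: powR_concave_nat. Qed.

(** Increments of a concave power, hence nonincreasing in [k]. *)
Definition wincr k : R := k.+1%:R `^ (1 - z) - k%:R `^ (1 - z).

Lemma wincr_ge0 k : 0 <= wincr k.
Proof.
rewrite subr_ge0; have /andP[s0 _] := s01.
by apply: ge0_ler_powR; rewrite ?nnegrE ?(ltW s0)// ler_nat.
Qed.

(** The coefficients are the decrements of [wincr], so their absolute values
    telescope. *)
Lemma sum_abs_wcoef_lt n : \sum_(0 <= k < n) `|wcoef z k| <= 2.
Proof.
case: n => [|n]; first by rewrite big_geq.
rewrite big_nat_recl //= normr1.
have -> : \sum_(0 <= k < n) `|wcoef z k.+1| = wincr 0 - wincr n.
  elim: n => [|n IH]; first by rewrite big_geq // subrr.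
  rewrite big_nat_recr //= IH ler0_norm ?wcoef_le0//.
  by rewrite /wcoef /wincr; ring.
rewrite /wincr powR1 powR0 ?subr0; last by have /andP[s0 _] := s01; rewrite gt_eqF.
by have := wincr_ge0 n; rewrite /wincr; lra.
Qed.

Lemma abs_wcoef_tail (e : R) : 0 < e ->
  exists p, forall q n, (p <= q)%N -> \sum_(q <= k < n) `|wcoef z k| <= e.
Proof.
move=> e0; pose v n := \sum_(0 <= k < n) `|wcoef z k|.
have nv : nondecreasing_seq v.
  by apply/nondecreasing_seqP => n; rewrite /v big_nat_recr //= lerDl.
have cv : cvgn v.
  by apply: nondecreasing_is_cvgn => //; exists 2 => _ [n _ <-]; exact: sum_abs_wcoef_lt.
have /cvgrPdist_le/(_ _ e0)[p _ Hp] := cv.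
exists p => q n pq; have [nq|/ltnW qn] := leqP n q; first by rewrite big_geq // ltW.
have -> : \sum_(q <= k < n) `|wcoef z k| = v n - v q.
  by rewrite /v [X in X - _](big_cat_nat (leq0n q) qn) //= addrAC subrr add0r.
have := Hp q pq; have := nondecreasing_cvgn_le nv cv n.
have := nondecreasing_cvgn_le nv cv q => h1 h2.
by rewrite ger0_norm ?subr_ge0//; lra.
Qed.

Definition wpartial p (t : R) : Cx R := \sum_(k < p) toC (wcoef z k) * cis (k%:R * t).

Lemma wpartial_dist p n t : (p <= n)%N ->
  absC (wpartial n t - wpartial p t) <= \sum_(p <= k < n) `|wcoef z k|.
Proof.
move=> pn; rewrite /wpartial -!(big_mkord xpredT (fun k => toC (wcoef z k) * cis (k%:R * t))).
rewrite [X in X - _](big_cat_nat (leq0n p) pn) //= addrAC subrr add0r.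
apply: le_trans (absC_sum _ _ _) _; apply: ler_sum => k _.
by rewrite absCM absC_cis mulr1 absC_toC.
Qed.

Lemma absC_wpartial p t : absC (wpartial p t) <= 2.
Proof.
apply: le_trans (sum_abs_wcoef_lt p); rewrite big_mkord.
apply: le_trans (absC_sum _ _ _) _; apply: ler_sum => k _.
by rewrite absCM absC_cis mulr1 absC_toC.
Qed.

Lemma wsymbol_cvg t : wpartial p t @[p --> \oo] --> wsymbol z t.
Proof.
have real_cvg (c : nat -> R) : (forall k, `|c k| <= `|wcoef z k|) -> cvgn (series c).
  move=> cw; apply: normed_cvg.
  apply: nondecreasing_is_cvgn.
    by apply: nondecreasing_series => k _ _; exact: normr_ge0.
  exists 2 => _ [n _ <-]; apply: le_trans (sum_abs_wcoef_lt n).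
  by rewrite /series /=; apply: ler_sum => k _; exact: cw.
have c1 : cvgn (series (fun k => wcoef z k * cos (k%:R * t))).
  apply: real_cvg => k; rewrite normrM ler_piMr//.
  by have := reC_le_absC (cis (k%:R * t) : Cx R); rewrite absC_cis.
have c2 : cvgn (series (fun k => wcoef z k * sin (k%:R * t))).
  apply: real_cvg => k; rewrite normrM ler_piMr//.
  by have := imC_le_absC (cis (k%:R * t) : Cx R); rewrite absC_cis.
have serE : (fun p => wpartial p t) =
   series (fun k => toC (wcoef z k) * cis (k%:R * t) : Cx R).
  by apply/funext => p; rewrite /wpartial /series /= big_mkord.
have H : cvgn (series (fun k => toC (wcoef z k) * cis (k%:R * t) : Cx R)).
  have E : series (fun k => toC (wcoef z k) * cis (k%:R * t) : Cx R) =
      fun p => toC (series (fun k => wcoef z k * cos (k%:R * t)) p) +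
        'i%C * toC (series (fun k => wcoef z k * sin (k%:R * t)) p).
    apply/funext => p; rewrite /series /= !toC_sum mulr_sumr -big_split.
    apply: eq_bigr => k _ /=; rewrite !toCM.
    have -> : cis (k%:R * t) = toC (cos (k%:R * t)) + 'i%C * toC (sin (k%:R * t)).
      by rewrite /cis /toC; simpc.
    by ring.
  rewrite E; apply/cvg_ex.
  exists (toC (limn (series (fun k => wcoef z k * cos (k%:R * t)))) +
    'i%C * toC (limn (series (fun k => wcoef z k * sin (k%:R * t))))).
  by apply: cvgD; [exact: cvg_toC|apply: cvgMl_tmp; exact: cvg_toC].
by rewrite serE; exact: H.
Qed.

Lemma absC_lim_le (v : nat -> Cx R) (l c : Cx R) (e : R) : v @ \oo --> l ->
  (\forall n \near \oo, absC (v n - c) <= e) -> absC (l - c) <= e.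
Proof.
move=> vl ve; apply/ler_addgt0Pr => d d0.
have /cvgC_absC/(_ _ d0) vd := vl.
have [n [h1 h2]] := filter_ex (filterI ve vd).
by apply: le_trans (absC_dist (v n) _ _) _; rewrite addrC lerD // absCB.
Qed.

Lemma wsymbol_dist p t (e : R) :
  (forall n, \sum_(p <= k < n) `|wcoef z k| <= e) ->
  absC (wsymbol z t - wpartial p t) <= e.
Proof.
move=> He; apply: (@absC_lim_le (fun n => wpartial n t) _ _ _ (@wsymbol_cvg t)); near=> n.
apply: le_trans (wpartial_dist t _) (He n).
by near: n; exact: nbhs_infty_ge.
Unshelve. all: by end_near. Qed.

End OneCoefficient.

End Coefficients.

(** * Polynomial functions are smooth *)

Section Smooth.
Context {R : realType}.

Inductive polyfun : (R * R * R -> R) -> Prop :=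
| polyfun_cst c : polyfun (fun=> c)
| polyfun_x2 : polyfun (fun z => z.1.2)
| polyfun_x3 : polyfun (fun z => z.2)
| polyfun_add f g : polyfun f -> polyfun g -> polyfun (fun z => f z + g z)
| polyfun_mul f g : polyfun f -> polyfun g -> polyfun (fun z => f z * g z).

Lemma continuous_polyfun f : polyfun f -> continuous f.
Proof.
elim=> [c|||g h _ cg _ ch|g h _ cg _ ch] x.
- exact: cvg_cst.
- apply: (@continuous_comp _ _ _ (fun z : R * R * R => z.1) (fun y : R * R => y.2)).
    exact: cvg_fst.
  exact: cvg_snd.
- exact: cvg_snd.
- exact: cvgD (cg x) (ch x).
- exact: cvgM (cg x) (ch x).
Qed.

Lemma is_derive_additive (f : R * R * R -> R) (x v : R * R * R) :
  (forall (h : R) y, f (h *: v + y) = h * f v + f y) -> is_derive x v f (f v).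
Proof.
move=> fl.
have H : (fun h : R => h^-1 *: ((f \o shift x) (h *: v) - f x)) @ 0^' --> f v.
  apply: cvg_near_cst; near=> h.
  rewrite /= fl addrK /GRing.scale /= mulrA mulVf ?mul1r//.
  by near: h; exact: nbhs_dnbhs_neq.
by split; [apply/cvg_ex; exists (f v)|exact: cvg_lim H].
Unshelve. all: by end_near. Qed.

Lemma polyfun_derive f v : polyfun f ->
  exists2 g, polyfun g & forall x, is_derive x v f (g x).
Proof.
elim=> [c|||g h pg [dg pdg Hg] ph [dh pdh Hh]|g h pg [dg pdg Hg] ph [dh pdh Hh]].
- by exists (fun=> 0); [exact: polyfun_cst|move=> x; exact: is_derive_cst].
- exists (fun=> v.1.2); first exact: polyfun_cst.
  by move=> x; apply: (is_derive_additive (f := fun z => z.1.2)).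
- exists (fun=> v.2); first exact: polyfun_cst.
  by move=> x; apply: (is_derive_additive (f := fun z => z.2)).
- exists (fun x => dg x + dh x); first exact: polyfun_add.
  by move=> x; apply: is_deriveD.
- exists (fun x => g x * dh x + h x * dg x).
    by apply: polyfun_add; apply: polyfun_mul.
  by move=> x; have := @is_deriveM _ _ g h x v _ _ (Hg x) (Hh x).
Qed.

Lemma smooth_polyfun f : polyfun f -> smooth3 f.
Proof.
move=> pf s.
have : polyfun (foldr (fun v h => 'D_v h) f s).
  elim: s => [//|v s IH] /=.
  have [g pg Hg] := polyfun_derive v IH.
  rewrite (_ : 'D_v _ = g) //; apply/funext => x; have [_ <-] := Hg x.
  by [].
move=> pg; split; first exact: continuous_polyfun.
by move=> x v; have [g _ Hg] := polyfun_derive v pg; have [] := Hg x.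
Qed.

Lemma polyfun_exp f n : polyfun f -> polyfun (fun z => f z ^+ n).
Proof.
move=> pf; elim: n => [|n IH]; first exact: (polyfun_cst 1).
by under eq_fun do rewrite exprS; exact: polyfun_mul.
Qed.

Lemma polyfun_poly2 s : polyfun (fun z => poly2 s z.2 z.1.2).
Proof.
rewrite /poly2; elim: s => [|t s IH].
  by under eq_fun do rewrite big_nil; exact: polyfun_cst.
under eq_fun do rewrite big_cons.
apply: polyfun_add => //; apply: polyfun_mul; first exact: polyfun_cst.
apply: polyfun_mul; apply: polyfun_exp; [exact: polyfun_x3|exact: polyfun_x2].
Qed.

End Smooth.

(** * The approximating formal sums *)

Section Model.
Context {R : realType}.
Variables (xi eta1 eta2 nu1 nu2 : R) (p : nat) (s : seq (R * (nat * nat))).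

(** The symbol truncated to [p] frequencies, with the coefficient replaced by
    the polynomial [poly2 s], read as a formal sum of words. *)
Definition model : seq (term R) :=
  [seq (toC (wcoef xi t), (nseq t true, [::], [::])) | t <- index_iota 0 p] ++
  [seq (toC (nu1 * wcoef eta1 t * u.1),
        ([::], nseq u.2.2 None, nseq u.2.1 None ++ nseq t (Some true)))
     | t <- index_iota 0 p, u <- s] ++
  [seq (toC (nu2 * wcoef eta2 t * u.1),
        ([::], nseq u.2.2 None ++ nseq t (Some true), nseq u.2.1 None))
     | t <- index_iota 0 p, u <- s].

Definition lower (z : R) (a b : nat) : R :=
  \sum_(0 <= t < p) wcoef z t * (a == b + t)%N%:R.

Lemma lowerE z a b :
  lower z a b = if (b <= a)%N && (a - b < p)%N then wcoef z (a - b) else 0.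
Proof.
rewrite /lower big_mkord; case: ifP => [/andP[ba abp]|nab].
  rewrite (bigD1 (Ordinal abp)) //= subnKC // eqxx mulr1 big1 ?addr0// => t tn.
  case: eqP => [E|]; rewrite ?mulr0//.
  by case/eqP: tn; apply: val_inj; rewrite /= E addKn.
rewrite big1 // => t _; case: eqP => [E|]; rewrite ?mulr0//.
by move: nab; rewrite E leq_addr addKn ltn_ord.
Qed.

Lemma wmx_shift n t a b : wmx n (nseq t (Some true)) a b = (a == b + t)%N%:R :> R.
Proof.
elim: t a => [|t IH] a /=; first by rewrite addn0.
by case: a => [|a]; rewrite addnS //= IH eqSS.
Qed.

Lemma wmx_coord n i w a b :
  wmx n (nseq i None ++ w) a b = (a.+1%:R / n%:R) ^+ i * wmx n w a b :> R.
Proof. by elim: i => [|i IH] /=; rewrite ?mul1r// IH exprS mulrA. Qed.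

Lemma wmx_coord0 n i a b :
  wmx n (nseq i None) a b = (a.+1%:R / n%:R) ^+ i * (a == b)%:R :> R.
Proof. by rewrite -[nseq i None]cats0 wmx_coord. Qed.

Lemma wbal_shift t : wbal (nseq t (Some true)) = t%:Z.
Proof. by elim: t => [|t IH]; [rewrite /wbal big_nil|rewrite /= wbal_cons IH]. Qed.

Lemma wbal_coord i : wbal (nseq i None) = 0.
Proof. by elim: i => [|i IH]; [rewrite /wbal big_nil|rewrite /= wbal_cons IH]. Qed.

Lemma wdeg_shift t : wdeg (nseq t (Some true)) = 0%N.
Proof. by rewrite /wdeg count_nseq. Qed.

Lemma wdeg_coord i : wdeg (nseq i None) = i.
Proof. by rewrite /wdeg count_nseq mul1n. Qed.

Lemma fsymb_model x y t1 t2 t3 :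
  fsymb model x y t1 t2 t3 = wpartial xi p t1 + toC (poly2 s x y) *
    (toC nu1 * wpartial eta1 p t2 + toC nu2 * wpartial eta2 p t3).
Proof.
have map_shift t : map Some (nseq t true) = nseq t (Some true) by rewrite map_nseq.
rewrite /fsymb /model !big_cat /= big_map !big_allpairs_dep /=.
congr (_ + _).
  rewrite /wpartial big_mkord; apply: eq_bigr => t _ /=.
  rewrite map_shift wbal_shift /wbal !big_nil /wdeg /= !expr0 mulr1 toC1 mulr1.
  by rewrite !mul0r !addr0.
rewrite mulrDr; congr (_ + _).
- rewrite /wpartial /poly2 toC_sum mulr_suml.
  rewrite exchange_big /=; apply: eq_bigr => u _.
  rewrite !mulr_sumr big_mkord; apply: eq_bigr => t _ /=.
  rewrite wbal_cat wbal_shift !wbal_coord wdeg_cat wdeg_shift !wdeg_coord addn0.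
  rewrite /wbal big_nil add0r !mul0r add0r addr0 !toCM; ring.
- rewrite /wpartial /poly2 toC_sum mulr_suml.
  rewrite exchange_big /=; apply: eq_bigr => u _.
  rewrite !mulr_sumr big_mkord; apply: eq_bigr => t _ /=.
  rewrite wbal_cat wbal_shift !wbal_coord wdeg_cat wdeg_shift !wdeg_coord addn0.
  rewrite /wbal big_nil add0r !mul0r !add0r !toCM; ring.
Qed.

Definition model_entry (N2 N3 : nat) (a1 a2 a3 b1 b2 b3 : nat) : R :=
  lower xi a1 b1 * (a2 == b2)%:R * (a3 == b3)%:R +
  poly2 s (a3.+1%:R / N3%:R) (a2.+1%:R / N2%:R) *
    ((a1 == b1)%:R * (nu1 * ((a2 == b2)%:R * lower eta1 a3 b3) +
                      nu2 * (lower eta2 a2 b2 * (a3 == b3)%:R))).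

Lemma feval_model N1 N2 N3 n (a b : 'I_n) :
  feval (N1, N2, N3) n model a b =
  toC (model_entry N2 N3 (a %/ (N2 * N3))%N (a %/ N3 %% N2)%N (a %% N3)%N
                         (b %/ (N2 * N3))%N (b %/ N3 %% N2)%N (b %% N3)%N).
Proof.
rewrite /feval summxE /model !big_cat /= big_map !big_allpairs_dep /=.
rewrite /model_entry !toCD; congr (_ + _).
  rewrite /lower !mulr_suml toC_sum; apply: eq_bigr => t _.
  by rewrite !mxE map_nseq wmx_shift -toCM /= !mulrA.
rewrite !mulrDr toCD; congr (_ + _).
- rewrite exchange_big /= /poly2 mulr_suml toC_sum; apply: eq_bigr => u _.
  rewrite /lower !mulr_sumr toC_sum; apply: eq_bigr => t _.
  rewrite !mxE wmx_coord wmx_coord0 wmx_shift -toCM /=; congr toC; ring.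
- rewrite exchange_big /= /poly2 mulr_suml toC_sum; apply: eq_bigr => u _.
  rewrite /lower mulr_suml !mulr_sumr toC_sum; apply: eq_bigr => t _.
  rewrite !mxE wmx_coord wmx_coord0 wmx_shift -toCM /=; congr toC; ring.
Qed.

(** The same matrices in the form required of an approximating sequence: the
    time part, the part in [x] (last level) and the part in [y]. *)
Definition glt_freq (j : nat) (k : int) : int * int * int :=
  match j with 0 => (k, 0, 0) | 1 => (0, 0, k) | _ => (0, k, 0) end.

Definition glt_coef (j k : nat) : R :=
  match j with
  | 0 => wcoef xi k | 1 => nu1 * wcoef eta1 k | _ => nu2 * wcoef eta2 k
  end.

Definition glt_b (j : nat) (x : R3 R) : Cx R :=
  if j is 0 then 1 else toC (poly2 s x.2 x.1.2).

Definition glt_f (j : nat) (t : R3 R) : Cx R :=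
  \sum_(k <- index_iota 0 p) toC (glt_coef j k) * cis (dot3 (glt_freq j k%:Z) t).

Lemma smooth_glt_b j : smooth_cube3 (glt_b j).
Proof.
have sm0 : smooth3 (fun=> 0 : R) by apply: smooth_polyfun; exact: polyfun_cst.
case: j => [|j].
  exists (fun=> 1), (fun=> 0); split; [|exact: sm0|by []].
  by apply: smooth_polyfun; exact: polyfun_cst.
exists (fun z => poly2 s z.2 z.1.2), (fun=> 0); split; [|exact: sm0|by []].
exact/smooth_polyfun/polyfun_poly2.
Qed.

Lemma trig_glt_f j : trig_poly3 (glt_f j).
Proof.
exists [seq glt_freq j k%:Z | k <- index_iota 0 p].
exists (fun v => toC (glt_coef j (absz v.1.1 + absz v.1.2 + absz v.2)%N)) => t.
rewrite big_map; apply: eq_bigr => k _.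
by case: j => [|[|j]] /=; rewrite ?addn0 ?add0n.
Qed.

Lemma sum_ord3 (V : nmodType) (F : nat -> V) :
  \sum_(j < 3) F j = F 0%N + (F 1%N + F 2%N).
Proof. by rewrite !big_ord_recl big_ord0 addr0. Qed.

Lemma glt_symbol (x t : R3 R) :
  \sum_(j < 3) glt_b j x * glt_f j t =
  fsymb model x.2 x.1.2 t.1.1 t.2 t.1.2.
Proof.
rewrite fsymb_model (sum_ord3 (fun j => glt_b j x * glt_f j t)) /= mul1r -mulrDr.
case: x => [[x1 x2] x3]; case: t => [[t1 t2] t3] /=.
rewrite /glt_f /wpartial !big_mkord !mulr_sumr; congr (_ + _ * (_ + _)).
- by apply: eq_bigr => k _ /=; rewrite !mul0r !addr0.
- by apply: eq_bigr => k _ /=; rewrite !mul0r !add0r toCM mulrA.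
- by apply: eq_bigr => k _ /=; rewrite !mul0r add0r addr0 toCM mulrA.
Qed.

Lemma diffk_eq (i j k : nat) : (k%:Z == i.+1%:Z - j.+1%:Z) = (i == j + k)%N.
Proof. by apply/eqP/eqP; lia. Qed.

Lemma diff0_eq (i j : nat) : (0 == i.+1%:Z - j.+1%:Z) = (i == j)%N.
Proof. by apply/eqP/eqP; lia. Qed.

(** The Toeplitz matrix of a character is a tensor product of powers of shifts. *)
Lemma glt_matrix N1 N2 N3 n (a b : 'I_n) :
  (\sum_(j < 3) diag3 (N1, N2, N3) n (glt_b j) *m
     toeplitz3 (N1, N2, N3) n (glt_f j)) a b =
  feval (N1, N2, N3) n model a b.
Proof.
rewrite feval_model.
set a1 := (a %/ _)%N; set a2 := (_ %% N2)%N; set a3 := (_ %% N3)%N.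
set b1 := (b %/ _)%N; set b2 := (b %/ N3 %% N2)%N; set b3 := (b %% N3)%N.
pose G j := glt_b j (a1.+1%:R / N1%:R, a2.+1%:R / N2%:R, a3.+1%:R / N3%:R) *
    \sum_(k <- index_iota 0 p) toC (glt_coef j k) *
      (glt_freq j k%:Z == (a1.+1%:Z - b1.+1%:Z, a2.+1%:Z - b2.+1%:Z,
                           a3.+1%:Z - b3.+1%:Z))%:R.
have ent j : (diag3 (N1, N2, N3) n (glt_b j) *m
     toeplitz3 (N1, N2, N3) n (glt_f j)) a b = G j.
  rewrite /G -(fourier3_sum (index_iota 0 p) (fun k => toC (glt_coef j k))
    (fun k => glt_freq j k%:Z)).
  by rewrite /diag3 mul_diag_mx mxE mxE [X in _ * X]mxE.
transitivity (\sum_(j < 3) G j).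
  rewrite summxE.
  apply: eq_bigr => j _.
  exact: ent.
rewrite sum_ord3 /G /glt_b mul1r -mulrDr /=.
rewrite /model_entry toCD [toC (poly2 _ _ _ * _)]toCM; congr (_ + _ * _).
  rewrite /lower !mulr_suml toC_sum; apply: eq_bigr => k _ /=.
  rewrite !xpair_eqE diffk_eq !diff0_eq !toCM !toC_nat -!mulrA; congr (_ * _).
  by rewrite -!natrM !mulnb andbA.
rewrite mulrDr toCD /lower; congr (_ + _).
  rewrite !mulr_sumr toC_sum; apply: eq_bigr => k _ /=.
  rewrite !xpair_eqE diffk_eq !diff0_eq !toCM !toC_nat -andbA -!mulnb !natrM; ring.
rewrite mulr_suml !mulr_sumr toC_sum; apply: eq_bigr => k _ /=.
rewrite !xpair_eqE diffk_eq !diff0_eq !toCM !toC_nat -andbA -!mulnb !natrM; ring.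
Qed.

End Model.

(** * The space-time matrix near its model *)

Section Kernels.
Context {R : realType}.

Definition toepl (e : nat -> R) (a b : nat) : R := if (b <= a)%N then e (a - b)%N else 0.

Lemma toepl_ge0 e a b : (forall d, 0 <= e d) -> 0 <= toepl e a b.
Proof. by move=> e0; rewrite /toepl; case: ifP. Qed.

Lemma sum_toepl_row e n i S : (i < n)%N ->
  (forall n, \sum_(0 <= d < n) e d <= S) -> \sum_(j < n) toepl e i j <= S.
Proof.
move=> lin eS; rewrite -(big_mkord xpredT (toepl e i)) (big_cat_nat (leq0n i.+1) lin) /=.
rewrite [X in _ + X]big_nat_cond [X in _ + X]big1 ?addr0; last first.
  by move=> j /andP[/andP[ij _] _]; rewrite /toepl leqNgt ij.
apply: le_trans (eS i.+1); rewrite big_nat_rev big_nat_cond [leRHS]big_nat_cond.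
rewrite le_eqVlt; apply/orP; left; apply/eqP; apply: eq_bigr => j /andP[/andP[_ ji] _].
by rewrite /toepl add0n subSS leq_subr subKn.
Qed.

Lemma sum_toepl_col e n j S : (j < n)%N ->
  (forall n, \sum_(0 <= d < n) e d <= S) -> \sum_(i < n) toepl e i j <= S.
Proof.
move=> ljn eS; rewrite -(big_mkord xpredT (fun i => toepl e i j)).
rewrite (big_cat_nat (leq0n j) (ltnW ljn)) /= [X in X + _]big_nat_cond.
rewrite [X in X + _]big1 ?add0r; last first.
  by move=> i /andP[/andP[_ ij] _]; rewrite /toepl leqNgt ij.
apply: le_trans (eS (n - j)%N); rewrite -{1}[j]add0n big_addn.
rewrite le_eqVlt; apply/orP; left; apply/eqP; apply: eq_bigr => i _.
by rewrite /toepl leq_addl addnK.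
Qed.

Lemma sum_eq_row n i : (i < n)%N -> \sum_(j < n) (i == j)%:R = 1 :> R.
Proof.
move=> lin; rewrite -[RHS](@sum_ord_eq R n (fun=> 1) i lin).
by apply: eq_bigr => j _; rewrite mulr1.
Qed.

Lemma sum_eq_col n j : (j < n)%N -> \sum_(i < n) ((i : nat) == j)%:R = 1 :> R.
Proof. by move=> ljn; under eq_bigr do rewrite eq_sym; exact: sum_eq_row. Qed.

(** Weights of the error in a banded approximation: [tau] on the band of width
    [p], and [K] outside, where only the tail of the coefficients counts. *)
Definition band (p : nat) (tau K z : R) (d : nat) : R :=
  `|wcoef z d| * (if (d < p)%N then tau else K).

Lemma band_ge0 p tau K z d : 0 <= tau -> 0 <= K -> 0 <= band p tau K z d.
Proof. by move=> t0 K0; rewrite mulr_ge0 //; case: ifP. Qed.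

Lemma sum_band_le p tau K z tl n : 0 < z < 1 -> 0 <= tau -> 0 <= K ->
  (forall q n, (p <= q)%N -> \sum_(q <= k < n) `|wcoef z k| <= tl) ->
  \sum_(0 <= d < n) band p tau K z d <= 2 * tau + K * tl.
Proof.
move=> z01 t0 K0 Htl.
apply: (@le_trans _ _ (\sum_(0 <= d < n + p) band p tau K z d)).
  rewrite [leRHS](big_cat_nat (leq0n n) (leq_addr p n)) /= lerDl.
  by apply: sumr_ge0 => d _; exact: band_ge0.
rewrite (big_cat_nat (leq0n p) (leq_addl n p)) /=; apply: lerD.
  rewrite big_nat_cond (eq_bigr (fun d => tau * `|wcoef z d|)); last first.
    by move=> d /andP[/andP[_ dp] _]; rewrite /band dp mulrC.
  rewrite -big_nat_cond -mulr_sumr mulrC ler_wpM2r //; exact: sum_abs_wcoef_lt.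
rewrite big_nat_cond (eq_bigr (fun d => K * `|wcoef z d|)); last first.
  by move=> d /andP[/andP[pd _] _]; rewrite /band ltnNge pd mulrC.
by rewrite -big_nat_cond -mulr_sumr ler_wpM2l // Htl.
Qed.

Lemma kernel_dist p tau K z (c : R) (u : nat -> R) a b :
  (forall d, (d < p)%N -> `|u d - c| <= tau) -> (forall d, `|u d| <= K) ->
  `|toepl (fun d => u d * wcoef z d) a b - c * lower p z a b| <=
  toepl (band p tau K z) a b.
Proof.
move=> ht hK; rewrite /toepl lowerE /band; case: (leqP b a) => _ /=; last first.
  by rewrite mulr0 subrr normr0.
case: ifP => dp; last by rewrite mulr0 subr0 normrM mulrC ler_wpM2l.
by rewrite -mulrBl normrM mulrC ler_wpM2l // ht.
Qed.

End Kernels.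

Section Entries.
Context {R : realType}.
Variables (xi eta1 eta2 rho T lambda : R) (a : R * R -> R) (q : R -> R).
Variables (m n1 n2 : nat).

Let r1 := alpha_ xi T m / beta_ eta1 n1.
Let r2 := alpha_ xi T m / beta_ eta2 n2.

Definition Amx_entry (a1 a2 a3 b1 b2 b3 : nat) : R :=
  toepl (fun d => expR (- rho * d%:R * dt T m) * wcoef xi d) a1 b1 *
    (a2 == b2)%:R * (a3 == b3)%:R +
  (a1 == b1)%:R *
    ((a2 == b2)%:R *
       toepl (fun d => a (a3.+1%:R / n1.+1%:R, a2.+1%:R / n2.+1%:R) * r1 * wcoef eta1 d) a3 b3 +
     toepl (fun d => a (a3.+1%:R / n1.+1%:R, a2.+1%:R / n2.+1%:R) * r2 * wcoef eta2 d) a2 b2 *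
       (a3 == b3)%:R).

Lemma eq_divmod (r r' n : nat) :
  (r == r') = (r %/ n == r' %/ n)%N && (r %% n == r' %% n)%N.
Proof.
apply/eqP/andP => [->//|[/eqP h1 /eqP h2]].
by rewrite (divn_eq r n) (divn_eq r' n) h1 h2.
Qed.

Lemma Amx_ulE (i j : 'I_(m * (n2 * n1))) :
  Amx xi eta1 eta2 rho T lambda a q m n1 n2
    (lshift (1 * (n2 * n1)) i) (lshift (1 * (n2 * n1)) j) =
  Amx_entry (i %/ (n2 * n1)) (i %/ n1 %% n2) (i %% n1)
            (j %/ (n2 * n1)) (j %/ n1 %% n2) (j %% n1).
Proof.
have dm (k : nat) : (k %% (n2 * n1) %/ n1 = k %/ n1 %% n2)%N by rewrite modn_divl.
have mm (k : nat) : (k %% (n2 * n1) %% n1 = k %% n1)%N by rewrite modn_dvdm ?dvdn_mull.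
have GE (k l : 'I_(n2 * n1)) : Gmx xi eta1 eta2 T a m n1 n2 k l =
    a ((k %% n1).+1%:R / n1.+1%:R, (k %/ n1).+1%:R / n2.+1%:R) *
    (r1 * (((k %/ n1)%N == (l %/ n1)%N)%:R *
       (if (l %% n1 <= k %% n1)%N then wcoef eta1 (k %% n1 - l %% n1) else 0)) +
     r2 * ((if (l %/ n1 <= k %/ n1)%N then wcoef eta2 (k %/ n1 - l %/ n1) else 0) *
       ((k %% n1)%N == (l %% n1)%N)%:R)).
  by rewrite /Gmx /Dmx mul_diag_mx /tensmx !mxE /=.
rewrite /Amx block_mxEul mxE /tensmx [X in X + _]mxE [X in _ + X]mxE GE !mxE /=.
rewrite -!val_eqE /= (eq_divmod (i %% (n2 * n1)) _ n1) !dm !mm.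
rewrite /Amx_entry /toepl -mulnb natrM; congr (_ + _ * _).
  by rewrite mulrA; congr (_ * _ * _); case: ifP => // _; rewrite mulrC.
case: ifP => _; case: ifP => _; ring.
Qed.

Variables (nu1 nu2 : R) (p : nat) (s : seq (R * (nat * nat))) (tau tau' K : R).

Definition bound_entry (a1 a2 a3 b1 b2 b3 : nat) : R :=
  toepl (band p tau 1 xi) a1 b1 * (a2 == b2)%:R * (a3 == b3)%:R +
  ((a1 == b1)%:R * (a2 == b2)%:R * toepl (band p tau' K eta1) a3 b3 +
   (a1 == b1)%:R * toepl (band p tau' K eta2) a2 b2 * (a3 == b3)%:R).

Hypotheses (rho0 : 0 < rho) (T0 : 0 < T) (tau0 : 0 <= tau) (tau'0 : 0 <= tau') (K0 : 0 <= K).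
Hypothesis dt_small : rho * p%:R * dt T m <= tau.
Let PXY a2 a3 := poly2 s (a3.+1%:R / n1%:R) (a2.+1%:R / n2%:R).
Let aXY a2 a3 := a (a3.+1%:R / n1.+1%:R, a2.+1%:R / n2.+1%:R).
Hypothesis coef1 : forall a2 a3, (a2 < n2)%N -> (a3 < n1)%N ->
  `|aXY a2 a3 * r1 - PXY a2 a3 * nu1| <= tau' /\ `|aXY a2 a3 * r1| <= K.
Hypothesis coef2 : forall a2 a3, (a2 < n2)%N -> (a3 < n1)%N ->
  `|aXY a2 a3 * r2 - PXY a2 a3 * nu2| <= tau' /\ `|aXY a2 a3 * r2| <= K.

Lemma dt_ge0 : 0 <= dt T m.
Proof. by rewrite divr_ge0 // ltW. Qed.

(** The model differs from the matrix in three ways: the damping factor is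
    replaced by 1, the coefficient by a polynomial at the nodes [i / n], and the
    kernels are truncated to the band. *)
Lemma entry_dist a1 a2 a3 b1 b2 b3 : (a2 < n2)%N -> (a3 < n1)%N ->
  `|Amx_entry a1 a2 a3 b1 b2 b3 -
    model_entry xi eta1 eta2 nu1 nu2 p s n2 n1 a1 a2 a3 b1 b2 b3| <=
  bound_entry a1 a2 a3 b1 b2 b3.
Proof.
move=> l2 l3; rewrite /Amx_entry /model_entry.
have [h1 k1] := coef1 l2 l3; have [h2 k2] := coef2 l2 l3.
have b0 (b : bool) : `|b%:R : R| = b%:R by rewrite normr_nat.
have e1 : `|toepl (fun d => expR (- rho * d%:R * dt T m) * wcoef xi d) a1 b1 -
   1 * lower p xi a1 b1| <= toepl (band p tau 1 xi) a1 b1.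
  have x0 d : 0 <= rho * d%:R * dt T m by rewrite !mulr_ge0 ?dt_ge0 // ltW.
  apply: kernel_dist => [d dp|d]; last first.
    by rewrite ger0_norm ?expR_ge0// !mulNr -[leRHS]expR0 ler_expR oppr_le0.
  rewrite distrC ger0_norm; last first.
    by rewrite subr_ge0 !mulNr -[leRHS]expR0 ler_expR oppr_le0.
  rewrite !mulNr; have := expR_ge1Dx (- (rho * d%:R * dt T m)).
  suff : rho * d%:R * dt T m <= tau by lra.
  apply: le_trans dt_small; rewrite ler_wpM2r ?dt_ge0// ler_wpM2l ?(ltW rho0)//.
  by rewrite ler_nat ltnW.
have e2 : `|toepl (fun d => aXY a2 a3 * r1 * wcoef eta1 d) a3 b3 -
    PXY a2 a3 * nu1 * lower p eta1 a3 b3| <= toepl (band p tau' K eta1) a3 b3.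
  by apply: kernel_dist.
have e3 : `|toepl (fun d => aXY a2 a3 * r2 * wcoef eta2 d) a2 b2 -
    PXY a2 a3 * nu2 * lower p eta2 a2 b2| <= toepl (band p tau' K eta2) a2 b2.
  by apply: kernel_dist.
rewrite -/(aXY a2 a3) -/(PXY a2 a3).
set x1 := toepl _ a1 b1 in e1 *; set x2 := toepl _ a3 b3 in e2 *.
set x3 := toepl _ a2 b2 in e3 *.
rewrite (_ : _ - _ = (x1 - 1 * lower p xi a1 b1) * (a2 == b2)%:R * (a3 == b3)%:R +
  ((a1 == b1)%:R * (a2 == b2)%:R * (x2 - PXY a2 a3 * nu1 * lower p eta1 a3 b3) +
   (a1 == b1)%:R * (x3 - PXY a2 a3 * nu2 * lower p eta2 a2 b2) * (a3 == b3)%:R)); last by ring.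
apply: le_trans (ler_normD _ _) _; apply: lerD.
  by rewrite !normrM !b0 !ler_wpM2r.
apply: le_trans (ler_normD _ _) _; apply: lerD; rewrite !normrM !b0.
  by rewrite ler_wpM2l // mulr_ge0.
by rewrite ler_wpM2r // ler_wpM2l.
Qed.

End Entries.

Section Splitting.

(** What is left lives on the last [b] rows and columns. *)
Lemma rank_border (F : fieldType) a b (D : 'M[F]_(a + b)) :
  (\rank (D - block_mx (ulsubmx D) 0 0 0)%R <= 2 * b)%N.
Proof.
have -> : D - block_mx (ulsubmx D) 0 0 0 =
    col_mx 0 (dsubmx D) + row_mx 0 (col_mx (ursubmx D) 0).
  apply/matrixP => i j; rewrite !mxE.
  case: (split_ordP i) => i' ->; rewrite !mxE ?(unsplitK (inl _)) ?(unsplitK (inr _));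
    case: (split_ordP j) => j' ->; rewrite !mxE ?(unsplitK (inl _)) ?(unsplitK (inr _)) ?mxE
      ?subrr ?oppr0 ?addr0 ?add0r //.
apply: leq_trans (mxrank_add _ _) _; rewrite mul2n -addnn; apply: leq_add.
  by rewrite rank_col_0mx rank_leq_row.
by rewrite rank_row_0mx rank_leq_col.
Qed.

End Splitting.

Section Approximation.
Context {R : realType}.

Lemma schur_bound_entry N2 N3 m n (E : 'M[Cx R]_n) (e1 e2 e3 : nat -> R) (S1 S2 S3 : R) :
  n = (m.+1 * N2 * N3)%N ->
  (forall d, 0 <= e1 d) -> (forall d, 0 <= e2 d) -> (forall d, 0 <= e3 d) ->
  (forall k, \sum_(0 <= d < k) e1 d <= S1) ->
  (forall k, \sum_(0 <= d < k) e2 d <= S2) ->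
  (forall k, \sum_(0 <= d < k) e3 d <= S3) ->
  (forall i j, absC (E i j) <=
    toepl e1 (i %/ (N2 * N3))%N (j %/ (N2 * N3))%N *
      (i %/ N3 %% N2 == j %/ N3 %% N2)%N%:R * (i %% N3 == j %% N3)%N%:R +
    ((i %/ (N2 * N3) == j %/ (N2 * N3))%N%:R * (i %/ N3 %% N2 == j %/ N3 %% N2)%N%:R *
      toepl e3 (i %% N3)%N (j %% N3)%N +
     (i %/ (N2 * N3) == j %/ (N2 * N3))%N%:R *
      toepl e2 (i %/ N3 %% N2)%N (j %/ N3 %% N2)%N * (i %% N3 == j %% N3)%N%:R)) ->
  schur_le E (S1 + (S3 + S2)).
Proof.
move=> nE p1 p2 p3 s1 s2 s3 HE; subst n; split=> [i|j].
  have [i1 i2 i3] := pos_bounds i.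
  apply: le_trans (ler_sum _ (fun j _ => HE i j)) _.
  set x1 := (i %/ _)%N; set x2 := (_ %% N2)%N; set x3 := (_ %% N3)%N.
  rewrite !big_split /=; apply: lerD; [|apply: lerD].
  - rewrite (sum_pos _ _ _ (fun a b c => toepl e1 x1 a * (x2 == b)%:R * (x3 == c)%:R)).
    rewrite (sum3_prod _ _ _ (toepl e1 x1) (fun b => (x2 == b)%:R) (fun c => (x3 == c)%:R)).
    by rewrite !sum_eq_row // !mulr1; exact: sum_toepl_row.
  - rewrite (sum_pos _ _ _ (fun a b c => (x1 == a)%:R * (x2 == b)%:R * toepl e3 x3 c)).
    rewrite (sum3_prod _ _ _ (fun a => (x1 == a)%:R) (fun b => (x2 == b)%:R) (toepl e3 x3)).
    by rewrite !sum_eq_row // !mul1r; exact: sum_toepl_row.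
  - rewrite (sum_pos _ _ _ (fun a b c => (x1 == a)%:R * toepl e2 x2 b * (x3 == c)%:R)).
    rewrite (sum3_prod _ _ _ (fun a => (x1 == a)%:R) (toepl e2 x2) (fun c => (x3 == c)%:R)).
    by rewrite !sum_eq_row // mul1r mulr1; exact: sum_toepl_row.
have [j1 j2 j3] := pos_bounds j.
apply: le_trans (ler_sum _ (fun i _ => HE i j)) _.
set x1 := (j %/ _)%N; set x2 := (j %/ N3 %% N2)%N; set x3 := (j %% N3)%N.
rewrite !big_split /=; apply: lerD; [|apply: lerD].
- rewrite (sum_pos _ _ _ (fun a b c => toepl e1 a x1 * (b == x2)%:R * (c == x3)%:R)).
  rewrite (sum3_prod _ _ _ (toepl e1^~ x1) (fun b => (b == x2)%:R) (fun c => (c == x3)%:R)).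
  by rewrite !sum_eq_col // !mulr1; exact: sum_toepl_col.
- rewrite (sum_pos _ _ _ (fun a b c => (a == x1)%:R * (b == x2)%:R * toepl e3 c x3)).
  rewrite (sum3_prod _ _ _ (fun a => (a == x1)%:R) (fun b => (b == x2)%:R) (toepl e3^~ x3)).
  by rewrite !sum_eq_col // !mul1r; exact: sum_toepl_col.
- rewrite (sum_pos _ _ _ (fun a b c => (a == x1)%:R * toepl e2 b x2 * (c == x3)%:R)).
  rewrite (sum3_prod _ _ _ (fun a => (a == x1)%:R) (toepl e2^~ x2) (fun c => (c == x3)%:R)).
  by rewrite !sum_eq_col // mul1r mulr1; exact: sum_toepl_col.
Qed.

Local Notation square := (`[0, 1]%classic `*` `[0, 1]%classic : set (R * R)).

Section Scheme.
Variables (xi eta1 eta2 rho T lambda : R) (q : R -> R) (a : R * R -> R).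
Variables (nu1 nu2 : R) (m n1 n2 : nat -> nat).
Hypotheses (hxi : 0 < xi < 1) (heta1 : 0 < eta1 < 1) (heta2 : 0 < eta2 < 1)
  (hrho : 0 < rho) (hT : 0 < T)
  (a_cont : {within square, continuous a})
  (n1_gt0 : forall k, (0 < n1 k)%N) (n2_gt0 : forall k, (0 < n2 k)%N)
  (m_oo : m @ \oo --> \oo) (n1_oo : n1 @ \oo --> \oo) (n2_oo : n2 @ \oo --> \oo)
  (hnu1 : alpha_ xi T (m k) / beta_ eta1 (n1 k) @[k --> \oo] --> nu1)
  (hnu2 : alpha_ xi T (m k) / beta_ eta2 (n2 k) @[k --> \oo] --> nu2).

Let sz k := Asize (m k) (n1 k) (n2 k).
Let N k := ((m k).+1, n2 k, n1 k).
Let A k : 'M[Cx R]_(sz k) := map_mx (@toC R)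
  (Amx xi eta1 eta2 rho T lambda a q (m k) (n1 k) (n2 k)).

Lemma sizeE k : sz k = ((N k).1.1 * (N k).1.2 * (N k).2)%N.
Proof. by rewrite /sz /Asize /N /= -mulnDl addn1 mulnA. Qed.

(** The nodes [i / (n + 1)] of the grid and [i / n] of the sampling grid. *)
Lemma grid_dist (i n : nat) : (i < n)%N ->
  `|i.+1%:R / n.+1%:R - i.+1%:R / n%:R| <= n%:R^-1 :> R.
Proof.
move=> lin; have n0 : (0 < n%:R :> R) by rewrite ltr0n; exact: leq_ltn_trans lin.
have n1' : 0 < n.+1%:R :> R by rewrite ltr0n.
have le1 : i.+1%:R <= n.+1%:R :> R by rewrite ler_nat; exact: ltnW.
rewrite distrC ger0_norm; last first.
  by rewrite subr_ge0 ler_wpM2l // lef_pV2 ?posrE// ler_nat.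
have -> : i.+1%:R / n%:R - i.+1%:R / n.+1%:R = (i.+1%:R / n.+1%:R) / n%:R :> R.
  by rewrite -[n.+1%:R]natr1; field; rewrite natr1 !gt_eqF.
by rewrite ler_piMl ?invr_ge0 ?(ltW n0)// ler_pdivrMr // mul1r.
Qed.

Lemma grid_in (i n d : nat) : (i < n)%N -> (n <= d)%N ->
  0 <= (i.+1%:R / d%:R : R) <= 1.
Proof.
move=> lin nd; rewrite divr_ge0 //= ler_pdivrMr ?mul1r ?ler_nat; first exact: leq_trans nd.
by rewrite ltr0n (leq_trans _ nd)// (leq_ltn_trans _ lin).
Qed.

(** The last block row and column, which contain all that depends on [q] and
    [lambda], have rank at most [2 * n1 * n2] out of [(m + 1) * n1 * n2]; in the
    main block the entrywise bound and the Schur test apply. *)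
Lemma approx_scheme (e : R) : 0 < e -> exists p s,
  (forall x y t1 t2 t3 : R, 0 <= x <= 1 -> 0 <= y <= 1 ->
    absC (fsymb (model xi eta1 eta2 nu1 nu2 p s) x y t1 t2 t3 -
          kappa_ xi eta1 eta2 nu1 nu2 a x y t1 t2 t3) <= e) /\
  \forall k \near \oo, exists Rk E : 'M[Cx R]_(sz k),
    [/\ A k = feval (N k) (sz k) (model xi eta1 eta2 nu1 nu2 p s) + Rk + E,
        (\rank Rk)%:R <= e * (sz k)%:R & schur_le E e].
Proof.
move=> e0.
have [M0 HM0] := square_bounded a_cont.
pose M := Num.max M0 0.
have M_ge0 : 0 <= M by rewrite le_max lexx orbT.
have HM z : square z -> `|a z| <= M by move=> /HM0 h; rewrite le_max h.
pose V := `|nu1| + `|nu2| + 1.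
have V1 : 1 <= V by rewrite lerDr addr_ge0.
pose K := (M + 1) * V.
have K1 : 1 <= K by rewrite mulr_ege1 // lerDr.
have MV : M * V + V = K by rewrite /K mulrDl mul1r.
have MV0 : 0 <= M * V by rewrite mulr_ge0 // (le_trans ler01).
(* [K] bounds the products of coefficients; all errors below are multiples of
   [K * t], with a total factor of at most 20. *)
pose t := Num.min 1 (e / (20 * K)).
have K20 : 0 < 20 * K by rewrite mulr_gt0 // (lt_le_trans ltr01).
have t0 : 0 < t by rewrite lt_min ltr01 divr_gt0.
have t1 : t <= 1 by rewrite ge_min lexx.
have tK : 20 * (K * t) <= e.
  rewrite mulrA mulrC -ler_pdivlMr //; by rewrite ge_min lexx orbT.
have tKt : t <= K * t by rewrite ler_peMl // ltW.
have VE : V = `|nu1| + `|nu2| + 1 by [].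
have KtE : K * t = M * V * t + V * t by rewrite -MV mulrDl.
have Vt0 : 0 <= V * t by rewrite mulr_ge0 ?(ltW t0)// (le_trans ler01).
have MVt0 : 0 <= M * V * t by rewrite mulr_ge0 ?(ltW t0).
clearbody t K V M.
have [p1 Hp1] := abs_wcoef_tail hxi t0.
have [p2 Hp2] := abs_wcoef_tail heta1 t0.
have [p3 Hp3] := abs_wcoef_tail heta2 t0.
pose p := maxn p1 (maxn p2 p3).
have tl1 r n : (p <= r)%N -> \sum_(r <= k < n) `|wcoef xi k| <= t.
  by move=> pr; apply: Hp1; apply: leq_trans pr; rewrite leq_maxl.
have tl2 r n : (p <= r)%N -> \sum_(r <= k < n) `|wcoef eta1 k| <= t.
  by move=> pr; apply: Hp2; apply: leq_trans pr; rewrite /p maxnCA leq_maxl.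
have tl3 r n : (p <= r)%N -> \sum_(r <= k < n) `|wcoef eta2 k| <= t.
  by move=> pr; apply: Hp3; apply: leq_trans pr; rewrite /p maxnA leq_maxr.
have [s Hs] := weierstrass_square a_cont t0.
have [d d0 Hd] := square_unif_continuous a_cont t0.
exists p, s; split.
  move=> x y th1 th2 th3 x01 y01; rewrite fsymb_model /kappa_.
  have sq : square (x, y) by split; rewrite /= in_itv.
  set w1 := wpartial xi p th1; set w2 := wpartial eta1 p th2.
  set w3 := wpartial eta2 p th3.
  set v1 := wsymbol xi th1; set v2 := wsymbol eta1 th2; set v3 := wsymbol eta2 th3.
  have d1 : absC (w1 - v1) <= t.
    by rewrite absCB; apply: wsymbol_dist => // n; exact: tl1.
  have d2 : absC (w2 - v2) <= t.
    by rewrite absCB; apply: wsymbol_dist => // n; exact: tl2.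
  have d3 : absC (w3 - v3) <= t.
    by rewrite absCB; apply: wsymbol_dist => // n; exact: tl3.
  rewrite (_ : _ - _ = (w1 - v1) +
     (toC (poly2 s x y - a (x, y)) * (toC nu1 * w2 + toC nu2 * w3) +
      toC (a (x, y)) * (toC nu1 * (w2 - v2) + toC nu2 * (w3 - v3)))); last first.
    by rewrite toCB; ring.
  have b2 : absC (toC nu1 * w2 + toC nu2 * w3) <= 2 * V.
    apply: le_trans (absCD _ _) _; rewrite !absCM !absC_toC.
    have := ler_wpM2l (normr_ge0 nu1) (absC_wpartial heta1 p th2).
    have := ler_wpM2l (normr_ge0 nu2) (absC_wpartial heta2 p th3).
    rewrite -/w2 -/w3 VE; lra.
  have b3 : absC (toC nu1 * (w2 - v2) + toC nu2 * (w3 - v3)) <= V * t.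
    apply: le_trans (absCD _ _) _; rewrite !absCM !absC_toC VE !mulrDl.
    rewrite -addrA; apply: lerD; first by rewrite ler_wpM2l.
    by rewrite mul1r; apply: ler_wpDr; [exact: ltW|rewrite ler_wpM2l].
  have b1 : absC (toC (poly2 s x y - a (x, y))) <= t.
    by rewrite absC_toC distrC Hs.
  have ba : absC (toC (a (x, y))) <= M by rewrite absC_toC HM.
  apply: le_trans (absCD _ _) _; apply: le_trans (lerD d1 (absCD _ _)) _.
  rewrite !absCM.
  apply: le_trans (lerD (lexx t) (lerD (ler_pM (absC_ge0 _) (absC_ge0 _) b1 b2)
    (ler_pM (absC_ge0 _) (absC_ge0 _) ba b3))) _.
  rewrite (_ : t * (2 * V) = 2 * (V * t)); last by ring.
  rewrite [M * _]mulrA; move: tK tKt MVt0 Vt0; rewrite KtE.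
  move: (M * V * t) (V * t) => c1 c2; lra.
have inv_oo (u : nat -> nat) : u @ \oo --> \oo -> (fun k => (u k)%:R^-1 : R) @ \oo --> (0 : R).
  move=> uoo; have H : (fun n : nat => n%:R^-1 : R) @ \oo --> (0 : R).
    by rewrite -cvg_shiftS; exact: cvg_harmonic.
  exact: (cvg_comp _ _ uoo H).
have dt0 : (fun k => rho * p%:R * dt T (m k)) @ \oo --> (0 : R).
  rewrite (_ : (fun k => _) = (fun k => rho * p%:R * T * (m k)%:R^-1)); last first.
    by apply/funext => k; rewrite /dt mulrA.
  rewrite -[X in _ --> X](mulr0 (rho * p%:R * T)).
  by apply: cvgM; [exact: cvg_cst|exact: inv_oo].
have /cvgr0Pnorm_lt/(_ _ t0) hdt := dt0.
have /cvgr0Pnorm_lt/(_ _ d0) hn1 := inv_oo _ n1_oo.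
have /cvgr0Pnorm_lt/(_ _ d0) hn2 := inv_oo _ n2_oo.
have e20 : 0 < e / 2 by rewrite divr_gt0.
have /cvgr0Pnorm_lt/(_ _ e20) hm := inv_oo _ m_oo.
have /cvgrPdist_le/(_ _ t0) hr1 := hnu1.
have /cvgrPdist_le/(_ _ t0) hr2 := hnu2.
have hm1 : \forall k \near \oo, (1 <= m k)%N by move/cvgnyPge : m_oo; apply.
near=> k.
have kdt : rho * p%:R * dt T (m k) <= t.
  by apply: le_trans (ler_norm _) (ltW _); near: k; exact: hdt.
have kn1 : (n1 k)%:R^-1 < d.
  by apply: le_lt_trans (ler_norm _) _; near: k; exact: hn1.
have kn2 : (n2 k)%:R^-1 < d.
  by apply: le_lt_trans (ler_norm _) _; near: k; exact: hn2.
have km : (m k)%:R^-1 < e / 2.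
  by apply: le_lt_trans (ler_norm _) _; near: k; exact: hm.
have km1 : (1 <= m k)%N by near: k; exact: hm1.
have kr1 : `|nu1 - alpha_ xi T (m k) / beta_ eta1 (n1 k)| <= t by near: k; exact: hr1.
have kr2 : `|nu2 - alpha_ xi T (m k) / beta_ eta2 (n2 k)| <= t by near: k; exact: hr2.
pose D := A k - feval (N k) (sz k) (model xi eta1 eta2 nu1 nu2 p s).
pose D' : 'M[Cx R]_(m k * (n2 k * n1 k) + 1 * (n2 k * n1 k)) := D.
pose E : 'M[Cx R]_(m k * (n2 k * n1 k) + 1 * (n2 k * n1 k)) := block_mx (ulsubmx D') 0 0 0.
exists (D' - E), E; split.
- by rewrite -addrA subrK /D' /D addrC subrK.
- apply: (@le_trans _ _ (2 * (n2 k * n1 k))%N%:R).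
    by rewrite ler_nat; apply: leq_trans (rank_border D') _; rewrite mul1n.
  rewrite /sz /Asize -mulnDl; move: (n2 k * n1 k)%N => M2.
  rewrite !natrM mulrA ler_wpM2r //.
  move: km; rewrite ltr_pdivlMr// mulrC ltr_pdivrMr ?ltr0n// => km.
  by rewrite natrD; lra.
have coef (r nu : R) (a2 a3 : nat) : `|nu| + 1 <= V -> `|nu - r| <= t ->
   (a2 < n2 k)%N -> (a3 < n1 k)%N ->
   `|a (a3.+1%:R / (n1 k).+1%:R, a2.+1%:R / (n2 k).+1%:R) * r -
     poly2 s (a3.+1%:R / (n1 k)%:R) (a2.+1%:R / (n2 k)%:R) * nu| <= 2 * (K * t) /\
   `|a (a3.+1%:R / (n1 k).+1%:R, a2.+1%:R / (n2 k).+1%:R) * r| <= K.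
  move=> nuV nur l2 l3.
  set X := a3.+1%:R / (n1 k)%:R; set Y := a2.+1%:R / (n2 k)%:R.
  set X' := a3.+1%:R / (n1 k).+1%:R; set Y' := a2.+1%:R / (n2 k).+1%:R.
  have X01 : 0 <= X <= 1 by apply: grid_in l3 (leqnn _).
  have Y01 : 0 <= Y <= 1 by apply: grid_in l2 (leqnn _).
  have sqXY : square (X, Y) by split; rewrite /= in_itv.
  have sqXY' : square (X', Y').
    by split; rewrite /= in_itv /=; [apply: grid_in l3 _|apply: grid_in l2 _].
  have h1 : `|a (X', Y') - a (X, Y)| <= t.
    apply: Hd => //=.
      by apply: le_lt_trans kn1; exact: grid_dist.
    by apply: le_lt_trans kn2; exact: grid_dist.
  have h2 : `|a (X, Y) - poly2 s X Y| <= t by exact: Hs.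
  have h3 := HM _ sqXY'.
  have nu0 := normr_ge0 nu.
  split.
    rewrite (_ : _ - _ = a (X', Y') * (r - nu) + ((a (X', Y') - a (X, Y)) * nu +
       (a (X, Y) - poly2 s X Y) * nu)); last by ring.
    apply: le_trans (ler_normD _ _) _.
    apply: le_trans (lerD (lexx _) (ler_normD _ _)) _; rewrite !normrM.
    rewrite distrC in nur.
    apply: le_trans (lerD (ler_pM (normr_ge0 _) (normr_ge0 _) h3 nur)
      (lerD (ler_wpM2r nu0 h1) (ler_wpM2r nu0 h2))) _.
    have hV : t * `|nu| <= V * t by rewrite mulrC ler_wpM2r ?(ltW t0)//; lra.
    have hM : M * t <= M * V * t by rewrite ler_wpM2r ?(ltW t0)// ler_peMr.
    rewrite KtE; move: hV hM MVt0 Vt0.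
    move: (M * V * t) (V * t) (M * t) (t * `|nu|) => c1 c2 c3 c4; lra.
  rewrite normrM; have hr : `|r| <= V.
    have := ler_normB nu (nu - r); rewrite opprB addrC subrK => hr.
    by apply: le_trans hr _; apply: le_trans (lerD (lexx _) (le_trans nur t1)) nuV.
  apply: le_trans (ler_pM (normr_ge0 _) (normr_ge0 _) h3 hr) _.
  by rewrite -MV lerDl (le_trans ler01).
have Kt0 : 0 <= K * t by rewrite mulr_ge0 ?(ltW t0)// (le_trans ler01).
have K0 : 0 <= K := le_trans ler01 K1.
have Kt20 : 0 <= 2 * (K * t) by rewrite mulr_ge0.
have nu1V : `|nu1| + 1 <= V by rewrite VE addrAC lerDl.
have nu2V : `|nu2| + 1 <= V by rewrite VE lerD2r lerDr.
have Es : schur_le E ((2 * t + 1 * t) + ((2 * (2 * (K * t)) + K * t) +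
    (2 * (2 * (K * t)) + K * t))).
  apply: (schur_bound_entry (N2 := n2 k) (N3 := n1 k) (m := m k)
    (e1 := band p t 1 xi) (e2 := band p (2 * (K * t)) K eta2)
    (e3 := band p (2 * (K * t)) K eta1)).
  - exact: (sizeE k).
  - by move=> d'; apply: band_ge0 => //; exact: ltW.
  - by move=> d'; apply: band_ge0.
  - by move=> d'; apply: band_ge0.
  - by move=> n; apply: sum_band_le => //; exact: ltW.
  - by move=> n; apply: sum_band_le.
  - by move=> n; apply: sum_band_le.
  move=> i j.
  change (absC (E i j) <= bound_entry xi eta1 eta2 p t (2 * (K * t)) K
    (i %/ (n2 k * n1 k)) (i %/ n1 k %% n2 k) (i %% n1 k)
    (j %/ (n2 k * n1 k)) (j %/ n1 k %% n2 k) (j %% n1 k)).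
  have bnd0 a1 a2 a3 c1 c2 c3 :
      0 <= bound_entry xi eta1 eta2 p t (2 * (K * t)) K a1 a2 a3 c1 c2 c3.
    by rewrite /bound_entry !addr_ge0 ?mulr_ge0 // toepl_ge0 // => d';
      apply: band_ge0 => //; exact: ltW.
  case: (split_ordP i) => i' ->; last first.
    by rewrite /E /block_mx col_mxEd row_mx0 mxE absC0 bnd0.
  case: (split_ordP j) => j' ->; last first.
    by rewrite /E block_mxEur mxE absC0 bnd0.
  have D'E (u v : 'I_(sz k)) : D' u v =
      toC (Amx xi eta1 eta2 rho T lambda a q (m k) (n1 k) (n2 k) u v) -
      feval (N k) (sz k) (model xi eta1 eta2 nu1 nu2 p s) u v.
    by rewrite /D' /D mxE [X in X + _]mxE [X in _ + X]mxE.
  rewrite /E block_mxEul mxE [usubmx _ _ _]mxE D'E feval_model -toCB absC_toC.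
  rewrite Amx_ulE.
  apply: (entry_dist (K := K)) => //.
  - by move=> a2 a3 l2 l3; exact: coef.
  - by move=> a2 a3 l2 l3; exact: coef.
  - by rewrite ltn_mod.
  - by rewrite ltn_mod.
split=> [i|j].
  by apply: le_trans (Es.1 i) _; move: tK tKt; move: (K * t) => c; lra.
by apply: le_trans (Es.2 j) _; move: tK tKt; move: (K * t) => c; lra.
Unshelve. all: by end_near.
Qed.

End Scheme.
End Approximation.

(** * Both distribution results *)

Section Conclusion.
Context {R : realType}.
Local Notation mR := (measurableTypeR R).
Local Notation mR5 := (mR * mR * mR * mR * mR)%type.
Local Notation mR6 := (mR * mR * mR * mR * mR * mR)%type.

(** Measurability is inherited by uniform limits, so nothing has to be known
    about the series defining the symbol of a triangular Toeplitz matrix. *)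
Lemma measurable_of_approx (kap : mR5 -> Cx R) :
  (forall e : R, 0 < e -> exists L : seq (term R),
     forall z, box5 z -> absC (fsymb5 L z - kap z) <= e) ->
  measurable_funC (@box5 R) kap.
Proof.
move=> H.
have /choice[L HL] (k : nat) : exists L : seq (term R),
    forall z, box5 z -> absC (fsymb5 L z - kap z) <= k.+1%:R^-1.
  by apply: H; rewrite invr_gt0 ltr0n.
have meas (f : Cx R -> R) : (forall u v, `|f u - f v| <= absC (u - v)) ->
    (forall k, measurable_fun (@box5 R) (fun z => f (fsymb5 (L k) z))) ->
    measurable_fun (@box5 R) (fun z => f (kap z)).
  move=> flip mf.
  apply: (measurable_fun_cvg (h := fun k z => f (fsymb5 (L k) z))) => // z Dz.
  apply/cvgrPdist_le => e e0.
  have /cvgr0Pnorm_lt/(_ _ e0) h := @cvg_harmonic R.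
  near=> k; rewrite distrC; apply: le_trans (le_trans (flip _ _) (HL k z Dz)) _.
  by apply: le_trans (ler_norm _) (ltW _); near: k; exact: h.
split; apply: meas.
- by move=> [u1 u2] [v1 v2]; exact: (reC_le_absC ((u1 +i* u2)%C - (v1 +i* v2)%C : Cx R)).
- by move=> k; have [[]] := @bmfun_fsymb5 R (L k).
- by move=> [u1 u2] [v1 v2]; exact: (imC_le_absC ((u1 +i* u2)%C - (v1 +i* v2)%C : Cx R)).
- by move=> k; have [[]] := @bmfun_fsymb5 R (L k).
Unshelve. all: by end_near. Qed.

(** From the order of the three levels, in which [x] and its frequency come
    last, to the order of the five variables of the symbol; the first space
    variable is dropped. *)
Definition level_vars (z : mR6) : mR5 :=
  (z.1.1.1.2, z.1.1.1.1.2, z.1.1.2, z.2, z.1.2).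

Definition box6 : set mR6 :=
  @cube3 R `*` `[- pi, pi] `*` `[- pi, pi] `*` `[- pi, pi].

Lemma level_vars_box z : box6 z -> box5 (level_vars z).
Proof.
by move=> [[[[[/= h1 h2] h3] h4] h5] h6].
Qed.

Lemma measurable_level_vars : measurable_fun box6 level_vars.
Proof.
apply: measurable_funTS.
repeat apply: measurable_fun_pair.
all: repeat (first [exact: measurable_snd | exact: measurable_fst |
  apply: (measurableT_comp (f := snd)) => //; try exact: measurable_snd |
  apply: (measurableT_comp (f := fst)) => //; try exact: measurable_fst ]).
Qed.

Lemma measurable_funC_level_vars (kap : mR5 -> Cx R) :
  measurable_funC (@box5 R) kap ->
  measurable_funC box6 (fun z => kap (level_vars z)).
Proof.
move=> [mre mim]; split.
- apply: (measurable_comp (F := @box5 R) _ _ mre measurable_level_vars).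
    exact: measurable_box5.
  by move=> _ [z /level_vars_box bz <-].
- apply: (measurable_comp (F := @box5 R) _ _ mim measurable_level_vars).
    exact: measurable_box5.
  by move=> _ [z /level_vars_box bz <-].
Qed.

End Conclusion.

Theorem theorem4p4 (R : realType) (xi eta1 eta2 rho T lambda : R)
    (q : R -> R) (a : R * R -> R) (nu1 nu2 : R) (m n1 n2 : nat -> nat)
    (hxi : 0 < xi < 1) (heta1 : 0 < eta1 < 1) (heta2 : 0 < eta2 < 1)
    (hrho : 0 < rho) (hT : 0 < T) (hlambda : 0 < lambda)
    (a_cont : {within `[0, 1] `*` `[0, 1], continuous a})
    (a_neq0 : forall x y : R, 0 < x < 1 -> 0 < y < 1 -> a (x, y) != 0)
    (m_gt0 : forall k, (0 < m k)%N)
    (n1_gt0 : forall k, (0 < n1 k)%N)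
    (n2_gt0 : forall k, (0 < n2 k)%N)
    (m_oo : m @ \oo --> \oo) (n1_oo : n1 @ \oo --> \oo)
    (n2_oo : n2 @ \oo --> \oo)
    (size_mono : {homo (fun k => Asize (m k) (n1 k) (n2 k)) : k l / (k <= l)%N})
    (hnu1 : alpha_ xi T (m k) / beta_ eta1 (n1 k) @[k --> \oo] --> nu1)
    (hnu2 : alpha_ xi T (m k) / beta_ eta2 (n2 k) @[k --> \oo] --> nu2)
    (hnu : nu1 != 0 \/ nu2 != 0) :
  let sz k := Asize (m k) (n1 k) (n2 k) in
  let A k : 'M[Cx R]_(sz k) :=
    map_mx (@toC R)
      (Amx xi eta1 eta2 rho T lambda a q (m k) (n1 k) (n2 k)) in
  let kappa := kappa_ xi eta1 eta2 nu1 nu2 a in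
  (* levels: (tau, theta1), (y, theta3), (x, theta2) *)
  GLT3 (fun k => ((m k).+1, n2 k, n1 k)) A
    (fun '(tau, y, x) '(theta1, theta3, theta2) =>
       kappa x y theta1 theta2 theta3) /\
  sv_distributed (@leb5 R)
    (`[0, 1] `*` `[0, 1] `*` `[- pi, pi] `*` `[- pi, pi] `*` `[- pi, pi])
    (fun '(x, y, theta1, theta2, theta3) => kappa x y theta1 theta2 theta3) A.
Proof.
move=> sz A kappa.
have approx := approx_scheme lambda q hxi heta1 heta2 hrho hT a_cont n1_gt0 n2_gt0
  m_oo n1_oo n2_oo hnu1 hnu2.
pose kap (z : R * R * R * R * R) := kappa z.1.1.1.1 z.1.1.1.2 z.1.1.2 z.1.2 z.2.
have szE k : sz k = ((m k).+1 * n2 k * n1 k)%N by exact: (sizeE m n1 n2 k).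
have m1_oo : (fun k => (m k).+1) @ \oo --> \oo.
  apply/cvgnyPge => B; have /cvgnyPge/(_ B) := m_oo.
  by apply: filterS => k /leqW.
have close L (e : R) :
    (forall x y t1 t2 t3 : R, 0 <= x <= 1 -> 0 <= y <= 1 ->
      absC (fsymb L x y t1 t2 t3 - kappa x y t1 t2 t3) <= e) ->
    forall z, box5 z -> absC (fsymb5 L z - kap z) <= e.
  move=> H [[[[x y] t1] t2] t3] [[[[/= x01 y01] _] _] _]; apply: H.
    by move: x01; rewrite in_itv.
  by move: y01; rewrite in_itv.
have kap_meas : measurable_funC (@box5 R) kap.
  apply: measurable_of_approx => e e0; have [p [s [H _]]] := approx e e0.
  by exists (model xi eta1 eta2 nu1 nu2 p s); exact: close.
split; last first.
  rewrite (_ : (fun _ => _) = kap); last first.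
    by apply/funext => -[[[[x y] t1] t2] t3].
  apply: (@sv_distributed_of_approx R (fun k => ((m k).+1, n2 k, n1 k))) => // e e0.
  have [p [s [H HA]]] := approx e e0.
  by exists (model xi eta1 eta2 nu1 nu2 p s); split; [exact: close|exact: HA].
have inv0 (p : nat) : 0 < (p.+1%:R^-1 : R) by rewrite invr_gt0 ltr0n.
have ex_ps (p : nat) : exists u : nat * seq (R * (nat * nat)),
    (forall z, box5 z ->
      absC (fsymb5 (model xi eta1 eta2 nu1 nu2 u.1 u.2) z - kap z) <= p.+1%:R^-1) /\
    \forall k \near \oo, exists Rk E : 'M[Cx R]_(sz k),
      [/\ A k = feval ((m k).+1, n2 k, n1 k) (sz k)
                 (model xi eta1 eta2 nu1 nu2 u.1 u.2) + Rk + E,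
          ((\rank Rk)%:R <= p.+1%:R^-1 * (sz k)%:R :> R) & schur_le E p.+1%:R^-1].
  have [p' [s [H HA]]] := approx _ (inv0 p).
  by exists (p', s); split; [exact: close|exact: HA].
have [ps Hps] := choice ex_ps.
have ex_K (p : nat) : exists K, forall k, (K <= k)%N ->
    exists Rk E : 'M[Cx R]_(sz k),
      [/\ A k = feval ((m k).+1, n2 k, n1 k) (sz k)
                 (model xi eta1 eta2 nu1 nu2 (ps p).1 (ps p).2) + Rk + E,
          ((\rank Rk)%:R <= p.+1%:R^-1 * (sz k)%:R :> R) & schur_le E p.+1%:R^-1].
  by have [K _ HK] := (Hps p).2; exists K => k; exact: HK.
have [K HK] := choice ex_K.
pose b p j := @glt_b R (ps p).2 j.
pose f p j := @glt_f R xi eta1 eta2 nu1 nu2 (ps p).1 j.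
split=> //; split.
  rewrite (_ : (fun _ => _) = fun z => kap (level_vars z)); last first.
    by apply/funext => -[[[[[tau y] x] t1] t3] t2].
  exact: measurable_funC_level_vars.
exists (fun=> 3%N), b, f; split.
- by move=> p j _; exact: smooth_glt_b.
- by move=> p j _; exact: trig_glt_f.
- (* uniform convergence: the exceptional set is eventually empty *)
  move=> e e0; apply: cvg_near_cst.
  have /cvgr0Pnorm_lt/(_ _ e0) h := @cvg_harmonic R.
  near=> p; rewrite [X in leb6 _ X](_ : _ = set0) ?measure0 //.
  rewrite -subset0 => -[[[[[tau y] x] t1] t3] t2] /= [Dz].
  rewrite (glt_symbol xi eta1 eta2 nu1 nu2 (ps p).1 (ps p).2) /= leNgt => /negP; apply.
  apply: le_lt_trans ((Hps p).1 (x, y, t1, t2, t3) _) _.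
    exact: (level_vars_box (z := (tau, y, x, t1, t3, t2)) Dz).
  by apply: le_lt_trans (ler_norm _) _; near: p; exact: h.
exists (fun p => p.+1%:R^-1), (fun p => p.+1%:R^-1), K.
split; [exact: cvg_harmonic|exact: cvg_harmonic|move=> p k kK].
have [Rk [E [AE rk sE]]] := HK p k kK; exists Rk, E; split=> //; last first.
  by apply: specnorm_schur => //; exact: ltW.
rewrite AE; congr (_ + _ + _); apply/matrixP => u v.
by rewrite -glt_matrix.
Unshelve. all: by end_near. Qed.
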